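(* Let $d$ be a fixed positive integer. If the ETH is true, then Subcubic Girth-$d$ Vertex Cover cannot be solved in $2^{o(n+m)}$ time, where $n$ and $m$ are the numbers of vertices and edges of the input graph.
   Context: Subcubic Girth-$d$ Vertex Cover: given an undirected graph $G=(V,E)$ of maximum degree at most three that is $2$-degenerate (every induced subgraph has a vertex of degree at most $2$) and in which every cycle has length at least $d$, and an integer $k$, decide whether $G$ has a vertex cover (a set $S\subseteq V$ meeting every edge) of size at most $k$. The Exponential Time Hypothesis (ETH) states that 3-SAT cannot be solved in $2^{o(N)}$ time, where $N$ is the number of variables of the input formula. *)

(* Defs.v *)
From mathcomp Require Import all_boot.
Set Implicit Arguments. Unset Strict Implicit. Unset Printing Implicit Defensive.

Inductive sym := B0 | B1 | Blank.
Inductive move := MvL | MvR | MvS.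

(* finitely many states 'I_tm_q; tm_delta = None means "halt" *)
Record TM := MkTM {
  tm_q : nat;
  tm_start : 'I_tm_q;
  tm_delta : 'I_tm_q -> sym -> option ('I_tm_q * sym * move);
  tm_accept : 'I_tm_q -> bool }.

(* two-way infinite tape: left part (nearest cell first), head cell, right part *)
Record config (M : TM) := Config {
  c_state : 'I_(tm_q M); c_left : seq sym; c_head : sym; c_right : seq sym }.

Definition step (M : TM) (c : config M) : option (config M) :=
  match tm_delta (c_state c) (c_head c) with
  | None => None
  | Some (q', w, mv) =>
      Some (match mv with
            | MvS => Config q' (c_left c) w (c_right c)
            | MvL => match c_left c with
                     | [::] => Config q' [::] Blank (w :: c_right c)
                     | x :: l => Config q' l x (w :: c_right c)
                     end
            | MvR => match c_right c with
                     | [::] => Config q' (w :: c_left c) Blank [::]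
                     | x :: r => Config q' (w :: c_left c) x r
                     end
            end)
  end.

Fixpoint run (M : TM) (t : nat) (c : config M) : option (config M) :=
  match step c with
  | None => Some c
  | Some c' => match t with 0 => None | t'.+1 => run t' c' end
  end.

Definition sym_of_bool (b : bool) : sym := if b then B1 else B0.

Definition init (M : TM) (w : seq bool) : config M :=
  match map sym_of_bool w with
  | [::] => Config (tm_start M) [::] Blank [::]
  | x :: r => Config (tm_start M) [::] x r
  end.

Definition solves_within (I : Type) (M : TM) (valid yes : I -> Prop)
    (enc : I -> seq bool) (T : I -> nat) : Prop :=
  forall x : I, valid x ->
    exists c : config M, run (T x) (init M (enc x)) = Some c /\
                         (tm_accept (c_state c) = true <-> yes x).

Definition littleo (f : nat -> nat) : Prop :=
  forall c : nat, 0 < c -> exists N0 : nat, forall N, N0 <= N -> c * f N <= N.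

Definition subexp_solvable (I : Type) (valid yes : I -> Prop)
    (enc : I -> seq bool) (mu : I -> nat) : Prop :=
  exists (M : TM) (f : nat -> nat) (a : nat), littleo f /\
    solves_within M valid yes enc
      (fun x => a * 2 ^ (f (mu x)) * (size (enc x)).+1 ^ a).

Definition enc_nat (k : nat) : seq bool := rcons (nseq k true) false.
Definition enc_nats (s : seq nat) : seq bool := flatten (map enc_nat s).

(* literal (v, b): variable v, positive iff b *)
Definition literal := (nat * bool)%type.
Definition clause3 := (literal * literal * literal)%type.
Record CNF3 := MkCNF3 { cnf_N : nat; cnf_clauses : seq clause3 }.

Definition lit_ok (N : nat) (l : literal) : bool := l.1 < N.
Definition lit_true (a : nat -> bool) (l : literal) : bool := a l.1 == l.2.
Definition clause_ok (N : nat) (C : clause3) : bool :=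
  let: (l1, l2, l3) := C in [&& lit_ok N l1, lit_ok N l2 & lit_ok N l3].
Definition clause_true (a : nat -> bool) (C : clause3) : bool :=
  let: (l1, l2, l3) := C in [|| lit_true a l1, lit_true a l2 | lit_true a l3].

Definition cnf_valid (F : CNF3) : Prop := all (clause_ok (cnf_N F)) (cnf_clauses F).
Definition satisfiable (F : CNF3) : Prop :=
  exists a : nat -> bool, all (clause_true a) (cnf_clauses F).

Definition enc_lit (l : literal) : nat := 2 * l.1 + l.2.
Definition enc_cnf (F : CNF3) : seq bool :=
  enc_nats (cnf_N F :: flatten (map (fun C : clause3 =>
     let: (l1, l2, l3) := C in [:: enc_lit l1; enc_lit l2; enc_lit l3])
     (cnf_clauses F))).

Definition ETH : Prop := ~ subexp_solvable cnf_valid satisfiable enc_cnf cnf_N.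

(* Graph on vertices 0..n-1 given by its edge list; an edge is (u,v) with u<v *)
Record VCInst := MkVC { vc_n : nat; vc_edges : seq (nat * nat); vc_k : nat }.

Definition simple_graph (n : nat) (E : seq (nat * nat)) : bool :=
  uniq E && all (fun e => (e.1 < e.2) && (e.2 < n)) E.

Definition adj (E : seq (nat * nat)) : rel nat :=
  fun u v => ((u, v) \in E) || ((v, u) \in E).

Definition degree_in (E : seq (nat * nat)) (X : seq nat) (v : nat) : nat :=
  count (fun e => ((e.1 == v) || (e.2 == v)) && (e.1 \in X) && (e.2 \in X)) E.

Definition max_degree_le3 (n : nat) (E : seq (nat * nat)) : Prop :=
  forall v, v < n -> count (fun e => (e.1 == v) || (e.2 == v)) E <= 3.

Definition two_degenerate (n : nat) (E : seq (nat * nat)) : Prop :=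
  forall X : seq nat, X != [::] -> all (fun v => v < n) X ->
    exists2 v, v \in X & degree_in E X v <= 2.

Definition girth_ge (d : nat) (E : seq (nat * nat)) : Prop :=
  forall c : seq nat, uniq c -> 3 <= size c -> cycle (adj E) c -> d <= size c.

Definition vc_valid (d : nat) (G : VCInst) : Prop :=
  [/\ simple_graph (vc_n G) (vc_edges G), max_degree_le3 (vc_n G) (vc_edges G),
      two_degenerate (vc_n G) (vc_edges G) & girth_ge d (vc_edges G)].

Definition is_vertex_cover (E : seq (nat * nat)) (S : seq nat) : bool :=
  all (fun e => (e.1 \in S) || (e.2 \in S)) E.

Definition has_vc (G : VCInst) : Prop :=
  exists S : seq nat, size S <= vc_k G /\ is_vertex_cover (vc_edges G) S.

Definition enc_vc (G : VCInst) : seq bool :=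
  enc_nats (vc_n G :: vc_k G :: flatten (map (fun e => [:: e.1; e.2]) (vc_edges G))).

Definition vc_size (G : VCInst) : nat := vc_n G + size (vc_edges G).

(* Main.v *)
(** A subexponential algorithm for vertex cover yields one for 3-SAT, in three steps.

    Sparsification (Impagliazzo, Paturi, Zane). Branch on a literal [a] in at least L binary
    clauses ([a], or all its partners), on a pair {a, b} in at least L ternary clauses (the clause
    [a or b], or all third literals), on a literal in at least 2 L^2 ternary clauses (the literal,
    or all the remaining pairs), in this order of priority. Formulas are never simplified by
    substituting values, so no literal is ever in more than 2 L binary clauses, and a potential
    bounded by O(L N) drops by 1 on one side of each branching and by 2 L^2 on the other. Hence
    there are 2^(O(N log L / L)) leaves, each with O(L^2 N) clauses.

    Reduction. Each leaf becomes a graph of degree at most 3 in which every edge is then subdivided 2 d times;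
    this shifts the covering number by d per edge, and forces large girth and 2-degeneracy.

    Machines. Functions on binary trees computed in polynomial time by structured programs on a
    few stacks are closed under composition, pairing, case analysis and folds with polynomially
    bounded accumulators, and such programs run on one tape with polynomial overhead. One round of
    the search, with time budget B for all L <= B, is such a function; the solver performs rounds
    B = 0, 1, 2, ... until one of them decides the formula. *)

From Stdlib Require Import ZArith IndefiniteDescription.
From HB Require Import structures.
Require Import Defs.
From mathcomp Require Import all_boot zify.
Set Implicit Arguments. Unset Strict Implicit. Unset Printing Implicit Defensive.

(** The negation of ETH asks for one machine with an exponent in o(N), whereas sparsification
    yields, for each accuracy [q], a procedure of time 2^(N/q) up to factors depending on [q] and a
    polynomial. Since [f] is an arbitrary function, a machine can neither compute the right
    threshold [L] nor know when the given algorithm will stop. Hence nothing in the solver refers to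
    [f]: a single budget [B] limits the thresholds tried, the number of search steps and the length
    of every simulated run, and a round trusts only searches that ran to completion. [L] and [q]
    live in the analysis alone. A round costs a polynomial in [B] and in the input length, so the
    total time is a fixed power of the first sufficient [B]. That multiplies the exponent by a
    constant, which o(N) absorbs.

    The threshold 2 L^2 comes from the potential: with a potential of about 6 L m on m literals and
    drops of 2 L^2 on one side, a branch of the search tree takes that side at most 3 m / L
    times. *)

(** * Stack programs *)

(** [RI] holds the input, [RS] the stack of encoded values, [RA] and [RB] receive values that are
    being moved, and [RC] controls loops. *)
Inductive reg := RI | RS | RA | RB | RC.
Record store := Store { ri : seq bool; rs : seq bool; ra : seq bool;
                        rb : seq bool; rc : seq bool }.

Definition get (r : reg) (s : store) : seq bool :=
  match r with RI => ri s | RS => rs s | RA => ra s | RB => rb s | RC => rc s end.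
Definition set (r : reg) (v : seq bool) (s : store) : store :=
  let: Store i x a b c := s in
  match r with
  | RI => Store v x a b c | RS => Store i v a b c | RA => Store i x v b c
  | RB => Store i x a v c | RC => Store i x a b v
  end.

(* [While r] pops [r] before each turn and stops when [r] is empty. The input register [RI]
   is read-only: [Push RI] does nothing. *)
Inductive cmd :=
  | Skip | Halt (b : bool) | Push (r : reg) (b : bool)
  | IfPop (r : reg) (ce c0 c1 : cmd) | While (r : reg) (c0 c1 : cmd)
  | Seq (c1 c2 : cmd).

Definition cmd_eq_dec (c c' : cmd) : {c = c'} + {c <> c'}.
Proof. by decide equality; (apply: Bool.bool_dec || decide equality). Defined.
HB.instance Definition _ := comparableMixin cmd_eq_dec.

(** [IfPop] and [While] are the commands that pop. A register together with the continuation for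
    each outcome describes both, so the tape machine can treat them by the same states. *)
Definition popk (k : seq cmd) : option (reg * (option bool -> seq cmd)) :=
  match k with
  | IfPop r ce c0 c1 :: k' =>
      Some (r, fun o => (if o is Some b then if b then c1 else c0 else ce) :: k')
  | While r c0 c1 :: k' =>
      Some (r, fun o => if o is Some b then (if b then c1 else c0) :: k else k')
  | _ => None
  end.

Definition cstate := (seq cmd * store)%type.

Definition sstep (x : cstate) : option cstate :=
  let: (k, s) := x in
  if popk k is Some (r, nx) then
    Some (if get r s is b :: l then (nx (Some b), set r l s) else (nx None, s))
  else match k with
  | Skip :: k' => Some (k', s)
  | Push r b :: k' =>
      Some (k', if r is RI then s else set r (b :: get r s) s)
  | Seq c1 c2 :: k' => Some (c1 :: c2 :: k', s)
  | _ => None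
  end.

(** * Simulation of stack programs on one tape *)

Definition isteps (X : Type) (f : X -> option X) (n : nat) (x : X) : option X :=
  iter n (obind f) (Some x).

Lemma istepsS (X : Type) (f : X -> option X) n x y :
  f x = Some y -> isteps f n.+1 x = isteps f n y.
Proof. by move=> fx; rewrite /isteps iterSr /= fx. Qed.

Lemma istepsD (X : Type) (f : X -> option X) m n x y z :
  isteps f m x = Some y -> isteps f n y = Some z -> isteps f (m + n) x = Some z.
Proof. by rewrite /isteps addnC iterD => -> . Qed.

Lemma isteps_inv (X : Type) (f : X -> option X) n x y :
  isteps f n.+1 x = Some y -> exists2 z, f x = Some z & isteps f n z = Some y.
Proof.
rewrite /isteps iterSr /=; case: (f x) => [z|]; first by move=> H; exists z.
by have -> : iter n (obind f) None = None by elim: n => //= n ->.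
Qed.

(* Tape layout: the input stays at cells 0, 1, ...; cell -2 holds the only B1 of the cells
   -2 - 5 i, and to its left the other four stacks are interleaved, bottom first, with period 5.
   The all-blank columns -2 - 5 i (i > 0) and the blank cell -1 lead the head back to -2. *)
Definition coff (r : reg) : Z :=
  match r with RI => 2 | RS => -1 | RA => -2 | RB => -3 | RC => -4 end.
Definition cstride (r : reg) : Z := if r is RI then 1%Z else (-5)%Z.
(** The way back after an edit: [cpre] leads to the column of the marker, [cback] walks over its
    blank cells up to the [B1] at -2. For [RI] both walk left over the input letters to the blank
    cell -1, from which [cfin] reaches -2. *)
Definition cpre (r : reg) : Z :=
  match r with RI => -1 | RS => 1 | RA => 2 | RB => 3 | RC => 4 end.
Definition cback (r : reg) : Z := if r is RI then (-1)%Z else 5%Z.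
Definition cfin (r : reg) : Z := if r is RI then (-1)%Z else 0%Z.

(** In [MRun] the head is on the marker. [MI0] and [MI1] write the marker; [MP1] walks to the first
    free cell of a stack, [MP2] back; [MQ1] tests for emptiness, [MQ2] walks past the top, [MQ3]
    reads and erases the top, [MQ4 b] carries the bit [b] back. *)
Inductive micro := MRun | MI0 | MI1 | MP1 | MP2 | MQ1 | MQ2 | MQ3 | MQ4 (b : bool).

Definition micro_code (m : micro) : 'I_10 :=
  inord (match m with MRun => 0 | MI0 => 1 | MI1 => 2 | MP1 => 3 | MP2 => 4
   | MQ1 => 5 | MQ2 => 6 | MQ3 => 7 | MQ4 b => if b then 8 else 9 end).
Definition micro_decode (i : 'I_10) : micro :=
  match val i with 0 => MRun | 1 => MI0 | 2 => MI1 | 3 => MP1 | 4 => MP2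
   | 5 => MQ1 | 6 => MQ2 | 7 => MQ3 | 8 => MQ4 true | _ => MQ4 false end.
Lemma micro_codeK : cancel micro_code micro_decode.
Proof. by case=> [||||||||[]]; rewrite /micro_code /micro_decode /= inordK. Qed.
HB.instance Definition _ := Finite.copy micro (can_type micro_codeK).

Definition is_blank (x : sym) : bool := if x is Blank then true else false.
Definition is_one (x : sym) : bool := if x is B1 then true else false.
Definition at_stop (r : reg) (x : sym) : bool :=
  if r is RI then is_blank x else is_one x.

(* The last component is a displacement of the head, of up to 5 cells. *)
Definition mdelta (k : seq cmd) (m : micro) (x : sym) :
    option (seq cmd * micro * sym * Z) :=
  match m with
  | MI0 => Some (k, MI1, x, (-2)%Z)
  | MI1 => Some (k, MRun, B1, 0%Z)
  | MRun =>
    if popk k is Some (r, _) then Some (k, MQ1, x, coff r) else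
    match k with
    | Skip :: k' => Some (k', MRun, x, 0%Z)
    | Push RI _ :: k' => Some (k', MRun, x, 0%Z)
    | Push r b :: k' => Some (k, MP1, x, coff r)
    | Seq c1 c2 :: k' => Some (c1 :: c2 :: k', MRun, x, 0%Z)
    | _ => None
    end
  | MP1 =>
    if k is Push r b :: k' then
      Some (if is_blank x then (k, MP2, sym_of_bool b, cpre r)
            else (k, MP1, x, cstride r))
    else None
  | MP2 =>
    if k is Push r b :: k' then
      Some (if is_one x then (k', MRun, x, 0%Z) else (k, MP2, x, cback r))
    else None
  | MQ1 =>
    if popk k is Some (r, nx) then
      Some (if is_blank x then (nx None, MRun, x, (- coff r)%Z)
            else (k, MQ2, x, cstride r))
    else None
  | MQ2 =>
    if popk k is Some (r, _) then
      Some (if is_blank x then (k, MQ3, x, (- cstride r)%Z)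
            else (k, MQ2, x, cstride r))
    else None
  | MQ3 => if popk k is Some (r, _) then Some (k, MQ4 (is_one x), Blank, cpre r)
           else None
  | MQ4 b =>
    if popk k is Some (r, nx) then
      Some (if at_stop r x then (nx (Some b), MRun, x, cfin r)
            else (k, MQ4 b, x, cback r))
    else None
  end.

Definition tape := Z -> sym.
Definition upd (t : tape) (p : Z) (w : sym) : tape :=
  fun i => if Z.eqb i p then w else t i.

Definition mcfg := (seq cmd * micro * tape * Z)%type.
Definition mstep (x : mcfg) : option mcfg :=
  let: (k, m, t, p) := x in
  if mdelta k m (t p) is Some (k', m', w, d) then Some (k', m', upd t p w, (p + d)%Z)
  else None.

Definition addr (r : reg) (i : nat) : Z := (-2 + coff r + cstride r * Z.of_nat i)%Z.

Definition layout (t : tape) (s : store) : Prop :=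
  [/\ t (-2)%Z = B1, t (-1)%Z = Blank,
      forall i, t (-7 - 5 * Z.of_nat i)%Z = Blank &
      forall r i, t (addr r i) = nth Blank (map sym_of_bool (rev (get r s))) i].

Definition slen (s : store) : nat :=
  size (ri s) + size (rs s) + size (ra s) + size (rb s) + size (rc s).

Lemma size_get r s : size (get r s) <= slen s.
Proof. by case: r; rewrite /slen /=; lia. Qed.

Lemma upd_same t p w : upd t p w p = w.
Proof. by rewrite /upd Z.eqb_refl. Qed.
Lemma upd_other t p w q : q <> p -> upd t p w q = t q.
Proof. by rewrite /upd => /Z.eqb_neq ->. Qed.

Lemma addr_inj r r' i i' : addr r i = addr r' i' -> r = r' /\ i = i'.
Proof.
by case: r; case: r'; rewrite /addr /coff /cstride => H; try lia; split=> //; lia.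
Qed.

Lemma addr_marker r i : addr r i <> (-2)%Z.
Proof. by case: r; rewrite /addr /coff /cstride; lia. Qed.
Lemma addr_gap r i : addr r i <> (-1)%Z.
Proof. by case: r; rewrite /addr /coff /cstride; lia. Qed.
Lemma addr_block r i j : addr r i <> (-7 - 5 * Z.of_nat j)%Z.
Proof. by case: r; rewrite /addr /coff /cstride; lia. Qed.

Lemma get_set_same r v s : get r (set r v s) = v.
Proof. by case: s; case: r. Qed.
Lemma get_set_other r r' v s : r' <> r -> get r' (set r v s) = get r' s.
Proof. by case: s; case: r; case: r'. Qed.

Lemma layout_upd t t' s r v i w :
  layout t s -> t' =1 upd t (addr r i) w ->
  (forall j, nth Blank (map sym_of_bool (rev v)) j =
             if j == i then w else nth Blank (map sym_of_bool (rev (get r s))) j) ->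
  layout t' (set r v s).
Proof.
move=> [h1 h2 h3 h4] Ht Hv; split.
- by rewrite Ht upd_other //; apply: nesym; apply: addr_marker.
- by rewrite Ht upd_other //; apply: nesym; apply: addr_gap.
- by move=> j; rewrite Ht upd_other //; apply: nesym; apply: addr_block.
- move=> r' j; rewrite Ht.
  have [e|ne] : {r' = r} + {r' <> r} by decide equality.
    rewrite e get_set_same Hv; case: eqP => [->|nij]; first by rewrite upd_same.
    by rewrite upd_other ?h4 // => /addr_inj[].
  by rewrite get_set_other // upd_other ?h4 // => /addr_inj[].
Qed.

Lemma upd_id t p : upd t p (t p) =1 t.
Proof. by move=> i; rewrite /upd; case: Z.eqb_spec => [->|]. Qed.

(** Writing back the letter just read gives a tape that is only pointwise equal to the old one, so
    reachability is taken up to pointwise equality at both ends. *)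
Definition mreach n k m t p k' m' t' p' := forall t0 : tape, t0 =1 t ->
  exists t1 : tape, isteps mstep n (k, m, t0, p) = Some (k', m', t1, p') /\ t1 =1 t'.

Lemma mreachD n1 n2 k m t p k1 m1 t1 p1 k2 m2 t2 p2 :
  mreach n1 k m t p k1 m1 t1 p1 -> mreach n2 k1 m1 t1 p1 k2 m2 t2 p2 ->
  mreach (n1 + n2) k m t p k2 m2 t2 p2.
Proof.
move=> h1 h2 t0 /h1 [ta [ea /h2 [tb [eb hb]]]].
by exists tb; split=> //; apply: istepsD ea eb.
Qed.

Lemma mreach_write k m (t : tape) p k' m' w d p' :
  mdelta k m (t p) = Some (k', m', w, d) -> p' = (p + d)%Z ->
  mreach 1 k m t p k' m' (upd t p w) p'.
Proof.
move=> e -> t0 h0; exists (upd t0 p w); split; last by move=> i; rewrite /upd h0.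
by rewrite (@istepsS _ _ _ _ (k', m', upd t0 p w, (p + d)%Z)) //= h0 e.
Qed.

Lemma mreach_ext n k m t p k' m' t' t'' p' :
  mreach n k m t p k' m' t' p' -> t' =1 t'' -> mreach n k m t p k' m' t'' p'.
Proof. by move=> h e t0 /h [t1 [e1 h1]]; exists t1; split=> // i; rewrite h1. Qed.

Lemma mreach_stay k m (t : tape) p k' m' d p' :
  mdelta k m (t p) = Some (k', m', t p, d) -> p' = (p + d)%Z ->
  mreach 1 k m t p k' m' t p'.
Proof. by move=> e ep; apply: mreach_ext (mreach_write e ep) (upd_id _ _). Qed.

Lemma mreach_walk k m (t : tape) p d n p' :
  (forall i, i < n -> mdelta k m (t (p + d * Z.of_nat i)%Z) =
                      Some (k, m, t (p + d * Z.of_nat i)%Z, d)) ->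
  p' = (p + d * Z.of_nat n)%Z -> mreach n k m t p k m t p'.
Proof.
elim: n p' => [|n IH] p' h ep'.
  by move=> t0 h0; exists t0; split=> //; rewrite ep' Z.mul_0_r Z.add_0_r.
rewrite -addn1; apply: mreachD.
  by apply: IH => [i hi|]; [apply: h; apply: ltnW | reflexivity].
by apply: mreach_stay; [apply: h | lia].
Qed.

Lemma nth_sym_bit (v : seq bool) i : i < size v ->
  nth Blank (map sym_of_bool v) i = sym_of_bool (nth false v i).
Proof. by move=> h; rewrite (nth_map false). Qed.
Lemma nth_sym_blank (v : seq bool) i : size v <= i ->
  nth Blank (map sym_of_bool v) i = Blank.
Proof. by move=> h; rewrite nth_default ?size_map. Qed.
Lemma is_blank_bit b : is_blank (sym_of_bool b) = false. Proof. by case: b. Qed.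
Lemma is_one_bit b : is_one (sym_of_bool b) = b. Proof. by case: b. Qed.

Lemma nth_push (l : seq bool) b j :
  nth Blank (map sym_of_bool (rev (b :: l))) j =
  if j == size l then sym_of_bool b else nth Blank (map sym_of_bool (rev l)) j.
Proof.
rewrite rev_cons map_rcons nth_rcons size_map size_rev.
by case: ltngtP => // h; rewrite nth_sym_blank // size_rev ltnW.
Qed.

Lemma nth_pop (l : seq bool) b j :
  nth Blank (map sym_of_bool (rev l)) j =
  if j == size l then Blank else nth Blank (map sym_of_bool (rev (b :: l))) j.
Proof.
rewrite nth_push; case: eqP => [->|//]; by rewrite nth_sym_blank ?size_rev.
Qed.

Lemma layout_mcol t s i : layout t s -> 0 < i -> t (-2 - 5 * Z.of_nat i)%Z = Blank.
Proof. by case: i => // i [_ _ h _] _; rewrite -(h i); congr t; lia. Qed.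

Lemma layout_bit t s r i : layout t s -> i < size (get r s) ->
  t (addr r i) = sym_of_bool (nth false (rev (get r s)) i).
Proof. by move=> [_ _ _ ->] h; rewrite nth_sym_bit ?size_rev. Qed.

Lemma layout_blank t s r i : layout t s -> size (get r s) <= i -> t (addr r i) = Blank.
Proof. by move=> [_ _ _ ->] h; rewrite nth_sym_blank ?size_rev. Qed.

Lemma stack_geometry r : r <> RI ->
  [/\ cstride r = (-5)%Z, cback r = 5%Z & cpre r = (- coff r)%Z].
Proof. by case: r => // ne; split. Qed.

Lemma micro_push t s r b k : r <> RI -> layout t s ->
  exists n t', [/\ n <= 2 * slen s + 10,
    mreach n (Push r b :: k) MRun t (-2) k MRun t' (-2) &
    layout t' (set r (b :: get r s) s)].
Proof.
move=> nr lt; set L := size (get r s); have hL := size_get r s; rewrite -/L in hL.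
have [g1 g2 g3] := stack_geometry nr.
set K := Push r b :: k.
have s1 : mreach 1 K MRun t (-2) K MP1 t (addr r 0).
  by apply: (@mreach_stay _ _ _ _ _ _ (coff r)); [rewrite /K; case: (r) nr|rewrite /addr; lia].
have s2 : mreach L K MP1 t (addr r 0) K MP1 t (addr r L).
  apply: (@mreach_walk _ _ _ _ (cstride r)); last by rewrite /addr; lia.
  move=> i hi; have -> : (addr r 0 + cstride r * Z.of_nat i)%Z = addr r i by rewrite /addr; lia.
  by rewrite (layout_bit lt hi) /= is_blank_bit.
set t' := upd t (addr r L) (sym_of_bool b).
have lt' : layout t' (set r (b :: get r s) s).
  by apply: (layout_upd (i := L) lt) => // j; rewrite nth_push.
have s3 : mreach 1 K MP1 t (addr r L) K MP2 t' (-2 - 5 * Z.of_nat L)%Z.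
  apply: (@mreach_write _ _ _ _ _ _ _ (cpre r)).
    by rewrite (layout_blank lt (leqnn L)).
  by rewrite /addr g1 g3; lia.
have s4 : mreach L K MP2 t' (-2 - 5 * Z.of_nat L)%Z K MP2 t' (-2)%Z.
  apply: (@mreach_walk _ _ _ _ (cback r)).
    move=> i hi.
    have -> : (-2 - 5 * Z.of_nat L + cback r * Z.of_nat i)%Z = (-2 - 5 * Z.of_nat (L - i))%Z.
      by rewrite g2; lia.
    by rewrite (layout_mcol lt') ?subn_gt0.
  by rewrite g2; lia.
have s5 : mreach 1 K MP2 t' (-2)%Z k MRun t' (-2)%Z.
  by apply: (@mreach_stay _ _ _ _ _ _ 0%Z) => //; case: lt' => ->.
exists (1 + L + 1 + L + 1), t'; split=> //; first by lia.
exact: mreachD (mreachD (mreachD (mreachD s1 s2) s3) s4) s5.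
Qed.

(** The end of a stack is visible only as the blank behind its top: the walk goes one cell too far,
    steps back to read and erase, and the bit returns in the state. *)
Lemma micro_pop t s k r nx k' s' : popk k = Some (r, nx) -> layout t s ->
  (k', s') = (if get r s is b :: l then (nx (Some b), set r l s) else (nx None, s)) ->
  exists n t', [/\ n <= 2 * slen s + 10,
    mreach n k MRun t (-2) k' MRun t' (-2) & layout t' s'].
Proof.
move=> pk lt; set L := size (get r s); have hL := size_get r s; rewrite -/L in hL.
have s1 : mreach 1 k MRun t (-2) k MQ1 t (addr r 0).
  by apply: (@mreach_stay _ _ _ _ _ _ (coff r)); [rewrite /= pk | rewrite /addr; lia].
case E: (get r s) => [|b l] [-> ->].
  have s2 : mreach 1 k MQ1 t (addr r 0) (nx None) MRun t (-2)%Z.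
    apply: (@mreach_stay _ _ _ _ _ _ (- coff r)%Z); last by rewrite /addr; lia.
    by rewrite /= pk (layout_blank lt) // E.
  by exists (1 + 1), t; split=> //; [lia | apply: mreachD s1 s2].
have eL : L = (size l).+1 by rewrite /L E.
have s2 : mreach 1 k MQ1 t (addr r 0) k MQ2 t (addr r 1).
  apply: (@mreach_stay _ _ _ _ _ _ (cstride r)); last by rewrite /addr; lia.
  by rewrite /= pk (layout_bit lt) ?E //= is_blank_bit.
have s3 : mreach (size l) k MQ2 t (addr r 1) k MQ2 t (addr r L).
  apply: (@mreach_walk _ _ _ _ (cstride r)); last by rewrite /addr; lia.
  move=> i hi; have -> : (addr r 1 + cstride r * Z.of_nat i)%Z = addr r i.+1 by rewrite /addr; lia.
  by rewrite /= pk (layout_bit lt) ?is_blank_bit // E.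
have s4 : mreach 1 k MQ2 t (addr r L) k MQ3 t (addr r (size l)).
  apply: (@mreach_stay _ _ _ _ _ _ (- cstride r)%Z); last by rewrite /addr; lia.
  by rewrite /= pk (layout_blank lt).
set t' := upd t (addr r (size l)) Blank.
have lt' : layout t' (set r l s).
  by apply: (layout_upd (i := size l) lt) => // j; rewrite E (nth_pop l b).
have s5 : mreach 1 k MQ3 t (addr r (size l)) k (MQ4 b) t' (addr r (size l) + cpre r)%Z.
  apply: (@mreach_write _ _ _ _ _ _ _ (cpre r)) => //.
  rewrite /= pk (layout_bit lt) ?E //= rev_cons nth_rcons size_rev ltnn eqxx.
  by rewrite is_one_bit.
set q := (if r is RI then -1 else -2)%Z.
have s6 : mreach (size l) k (MQ4 b) t' (addr r (size l) + cpre r)%Z k (MQ4 b) t' q.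
  apply: (@mreach_walk _ _ _ _ (cback r)); last first.
    by rewrite /q /addr /coff /cstride /cpre /cback; case: (r); lia.
  move=> i hi; rewrite /= pk; set x := t' _.
  suff -> : at_stop r x = false by [].
  rewrite {}/x; have [er|nr] : {r = RI} + {r <> RI} by decide equality.
    subst r; have -> : (addr RI (size l) + cpre RI + cback RI * Z.of_nat i)%Z = addr RI (size l - i).-1.
      by rewrite /addr /coff /cstride /cpre /cback; lia.
    rewrite (layout_bit lt'); last by rewrite get_set_same; lia.
    by rewrite /= is_blank_bit.
  have [g1 g2 g3] := stack_geometry nr.
  have -> : (addr r (size l) + cpre r + cback r * Z.of_nat i)%Z = (-2 - 5 * Z.of_nat (size l - i))%Z.
    by rewrite /addr g1 g2 g3; lia.
  by rewrite (layout_mcol lt') ?subn_gt0 //; case: (r) nr.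
have s7 : mreach 1 k (MQ4 b) t' q (nx (Some b)) MRun t' (-2)%Z.
  apply: (@mreach_stay _ _ _ _ _ _ (cfin r)); last by rewrite /q; case: (r).
  rewrite /= pk; suff -> : at_stop r (t' q) by [].
  by case: lt' => h1 h2 _ _; rewrite /q; case: (r); rewrite /= ?h1 ?h2.
exists (1 + 1 + size l + 1 + 1 + size l + 1), t'; split=> //; first by lia.
exact: mreachD (mreachD (mreachD (mreachD (mreachD (mreachD s1 s2) s3) s4) s5) s6) s7.
Qed.

Lemma micro_step t s k k' s' : layout t s -> sstep (k, s) = Some (k', s') ->
  exists n t', [/\ n <= 2 * slen s + 10,
    mreach n k MRun t (-2) k' MRun t' (-2) & layout t' s'].
Proof.
move=> lt; rewrite /sstep; case pk: (popk k) => [[r nx]|].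
  by move=> [] e; apply: (micro_pop pk lt); rewrite -e.
have stay k1 : mdelta k MRun (t (-2)%Z) = Some (k1, MRun, t (-2)%Z, 0%Z) ->
  exists n t', [/\ n <= 2 * slen s + 10, mreach n k MRun t (-2) k1 MRun t' (-2) & layout t' s].
  by move=> e; exists 1, t; split=> //; [lia | apply: mreach_stay e _].
case: k pk stay => [|[|b|r b|r ce c0 c1|r c0 c1|c1 c2] k] //= pk stay.
- by move=> [<- <-]; apply: stay.
- move=> [<- <-]; have [e|ne] : {r = RI} + {r <> RI} by decide equality.
    by subst r; apply: stay.
  have -> : (if r is RI then s else set r (b :: get r s) s) = set r (b :: get r s) s by case: (r) ne.
  exact: micro_push.
- by move=> [<- <-]; apply: stay.
Qed.

Lemma slen_step k s k' s' : sstep (k, s) = Some (k', s') -> slen s' <= (slen s).+1.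
Proof.
rewrite /sstep; case: (popk k) => [[r nx]|].
  case E: (get r s) => [|b l] [_ <-] //.
  by move: E; case: s; case: r => i a b' c d /= ->; rewrite /slen /=; lia.
case: k => [|[|b|r b|r ce c0 c1|r c0 c1|c1 c2] k] // [_ <-] //.
by case: s; case: r => i a b' c d; rewrite /slen /=; lia.
Qed.

(** A step lengthens the stacks by at most one cell and costs a walk along one of them and back, so
    the overhead is quadratic. *)
Lemma macro_steps n : forall t s k k' s', layout t s -> isteps sstep n (k, s) = Some (k', s') ->
  exists N t', [/\ N <= n * (2 * (slen s + n) + 10),
    mreach N k MRun t (-2) k' MRun t' (-2) & layout t' s'].
Proof.
elim: n => [|n IH] t s k k' s' lt.
  by move=> [<- <-]; exists 0, t; split=> // t0 h0; exists t0.
move=> H; have [[k1 s1] e1 e2] := isteps_inv H.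
have [N1 [t1 [h1 r1 l1]]] := micro_step lt e1.
have [N2 [t2 [h2 r2 l2]]] := IH _ _ _ _ _ l1 e2.
have h := slen_step e1.
exists (N1 + N2), t2; split=> //; last by apply: mreachD r1 r2.
have : n * (2 * (slen s1 + n) + 10) <= n * (2 * (slen s + n.+1) + 10) by rewrite leq_mul2l; lia.
by rewrite mulSn; lia.
Qed.

(** * Compilation to a Turing machine *)

(** The control stacks that can occur while [c] runs in front of [k]. The bodies of a loop run in
    front of the loop itself, so no turn creates a new stack; the control stack thus becomes part of
    a finite state. *)
Fixpoint conts (c : cmd) (k : seq cmd) : seq (seq cmd) :=
  (c :: k) :: match c with
  | Seq c1 c2 => conts c1 (c2 :: k) ++ conts c2 k
  | IfPop _ ce c0 c1 => conts ce k ++ conts c0 k ++ conts c1 k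
  | While _ c0 c1 => conts c0 (c :: k) ++ conts c1 (c :: k)
  | _ => [::]
  end.

Lemma mem_conts c k : c :: k \in conts c k.
Proof. by case: c => *; rewrite inE eqxx. Qed.

Lemma conts_closed c : forall k x m y k' m' w d, x \in conts c k ->
  mdelta x m y = Some (k', m', w, d) -> k' \in k :: conts c k.
Proof.
have base c0 k0 m y k' m' w d : mdelta (c0 :: k0) m y = Some (k', m', w, d) ->
    k' \in [:: c0 :: k0, k0 & match c0 with
      | Seq c1 c2 => [:: c1 :: c2 :: k0] | IfPop _ a b e => [:: a :: k0; b :: k0; e :: k0]
      | While _ a b => [:: a :: c0 :: k0; b :: c0 :: k0] | _ => [::] end].
  case: m => [||||||||b]; case: c0 => [|b1|r b1|r ce c0 c1|r c0 c1|c1 c2] //=;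
  rewrite ?/at_stop;
  repeat match goal with
  | |- context [if is_blank ?z then _ else _] => case: (is_blank z)
  | |- context [if is_one ?z then _ else _] => case: (is_one z)
  | |- context [match ?r with RI => _ | RS => _ | RA => _ | RB => _ | RC => _ end] => case: r end;
  repeat match goal with
  | |- context [if is_blank ?z then _ else _] => case: (is_blank z)
  | |- context [if is_one ?z then _ else _] => case: (is_one z) end;
  move=> // [<- *]; rewrite ?inE ?eqxx ?orbT //; case: b; rewrite ?eqxx ?orbT //.
elim: c => [|b|r b|r ce IHe c0 IH0 c1 IH1|r c0 IH0 c1 IH1|c1 IH1 c2 IH2] k x m y k' m' w d /=.
- by rewrite inE => /eqP -> /base; rewrite !inE orbC.
- by rewrite inE => /eqP -> /base; rewrite !inE orbC.
- by rewrite inE => /eqP -> /base; rewrite !inE orbC.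
- rewrite inE => /orP[/eqP -> /base|].
    rewrite !inE !mem_cat => /or4P[->|->|/eqP->|/orP[]/eqP->]; rewrite ?orbT ?mem_conts ?orbT //.
  rewrite !inE !mem_cat => /or3P[/IHe H /H|/IH0 H /H|/IH1 H /H];
  by rewrite inE => /orP[]->; rewrite ?orbT.
- rewrite inE => /orP[/eqP -> /base|].
    rewrite !inE !mem_cat => /or4P[->|->|/eqP->|/eqP->]; rewrite ?orbT ?mem_conts ?orbT //.
  rewrite !inE !mem_cat => /orP[/IH0 H /H|/IH1 H /H];
  by rewrite inE => /orP[]->; rewrite ?orbT.
- rewrite inE => /orP[/eqP -> /base|].
    by rewrite !inE !mem_cat => /or3P[->|->|/eqP->]; rewrite ?orbT ?mem_conts ?orbT.
  rewrite !inE !mem_cat => /orP[/IH1 H /H|/IH2 H /H].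
    by rewrite inE => /orP[/eqP->|->]; rewrite ?mem_conts ?orbT.
  by rewrite inE => /orP[]->; rewrite ?orbT.
Qed.

Section Compile.
Variable prog : cmd.

Definition labels : seq (seq cmd) := [::] :: conts prog [::].

(** The last component stores how many single-cell moves are pending and whether they go right: one
    displacement spans up to five cells. *)
Definition tm_state := ('I_(size labels).+1 * micro * ('I_6 * bool))%type.

Definition tcont (q : tm_state) : seq cmd := nth [::] labels q.1.1.
Definition tst (k : seq cmd) (m : micro) (n : nat) (b : bool) : tm_state :=
  (inord (index k labels), m, (inord n, b)).

Definition tdelta (q : tm_state) (x : sym) : option (tm_state * sym * move) :=
  if val q.2.1 is n.+1 then
    Some ((q.1, (inord n, q.2.2)), x, if q.2.2 then MvR else MvL)
  else if mdelta (tcont q) q.1.2 x is Some (k, m, w, d) then Some (tst k m (Z.abs_nat d) (Z.leb 0 d), w, MvS)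
  else None.

Definition compiled : TM :=
  @MkTM #|[the finType of tm_state]| (enum_rank (tst [:: prog] MI0 0 true))
    (fun i x => omap (fun y : tm_state * sym * move => (enum_rank y.1.1, y.1.2, y.2))
                     (tdelta (enum_val i) x))
    (fun i => if tcont (enum_val i) is Halt b :: _ then b else false).

Lemma tcont_tst k m n b : k \in labels -> tcont (tst k m n b) = k.
Proof.
move=> kL; have h : index k labels < (size labels).+1 by rewrite ltnS index_size.
by rewrite /tcont /tst [_.1.1]/= (inordK h) nth_index.
Qed.

Lemma labels_closed k m x k' m' w d : k \in labels ->
  mdelta k m x = Some (k', m', w, d) -> k' \in labels.
Proof.
rewrite {1}/labels inE => /orP[/eqP ->|]; last exact: conts_closed.
by case: m => //= -[<- *]; rewrite inE eqxx.
Qed.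

End Compile.

Fixpoint tsteps (M : TM) (n : nat) (c : config M) : option (config M) :=
  if n is n'.+1 then obind (tsteps n') (step c) else Some c.

Lemma tstepsD (M : TM) m n (c c1 c2 : config M) :
  tsteps m c = Some c1 -> tsteps n c1 = Some c2 -> tsteps (m + n) c = Some c2.
Proof.
elim: m c => [|m IH] c; first by move=> [->].
by rewrite addSn /=; case: (step c) => //= c' /IH.
Qed.

Lemma run_tsteps (M : TM) m n (c c1 : config M) :
  tsteps m c = Some c1 -> run (m + n) c = run n c1.
Proof.
elim: m c => [|m IH] c; first by move=> [->].
by rewrite addSn /=; case: (step c) => //= c' /IH.
Qed.

Lemma run_halted (M : TM) n (c : config M) : step c = None -> run n c = Some c.
Proof. by case: n => [|n] /= ->. Qed.

(** The default [Blank] of [nth] extends the two finite lists to a tape that is blank beyond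
    them. *)
Definition rep (M : TM) (c : config M) (q : 'I_(tm_q M)) (t : tape) (p : Z) : Prop :=
  [/\ c_state c = q, c_head c = t p,
      forall i, nth Blank (c_left c) i = t (p - 1 - Z.of_nat i)%Z &
      forall i, nth Blank (c_right c) i = t (p + 1 + Z.of_nat i)%Z].

Definition dmove (m : move) : Z := match m with MvL => -1 | MvR => 1 | MvS => 0 end.

Lemma step_rep (M : TM) (c : config M) q t p q' w mv : rep c q t p ->
  tm_delta q (t p) = Some (q', w, mv) ->
  exists2 c', step c = Some c' & rep c' q' (upd t p w) (p + dmove mv)%Z.
Proof.
case: c => cq l h r [/= <- <- hl hr] e.
pose c' := match mv with
  | MvS => @Config M q' l w r
  | MvL => Config q' (behead l) (nth Blank l 0) (w :: r)
  | MvR => Config q' (w :: l) (nth Blank r 0) (behead r) end.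
exists c'; first by rewrite /step /= e /c'; case: mv {e c'} => //; [case: (l)|case: (r)].
rewrite /c'; case: mv {e c'}; split=> //=.
- by rewrite upd_other ?hl; [congr t|]; lia.
- by move=> i; rewrite nth_behead upd_other ?hl; [congr t|]; lia.
- case=> [|i]; first by rewrite /= (_ : (p + -1 + 1 + 0)%Z = p) ?upd_same //; lia.
  by rewrite /= upd_other ?hr; [congr t|]; lia.
- by rewrite upd_other ?hr; [congr t|]; lia.
- case=> [|i]; first by rewrite /= (_ : (p + 1 - 1 - 0)%Z = p) ?upd_same //; lia.
  by rewrite /= upd_other ?hl; [congr t|]; lia.
- by move=> i; rewrite nth_behead upd_other ?hr; [congr t|]; lia.
- by rewrite Z.add_0_r upd_same.
- by move=> i; rewrite upd_other ?hl; [congr t|]; lia.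
- by move=> i; rewrite upd_other ?hr; [congr t|]; lia.
Qed.

Lemma mdelta_disp k m x k' m' w d : mdelta k m x = Some (k', m', w, d) ->
  (Z.abs d <= 5)%Z.
Proof.
case: k => [|[|b1|r b1|r ce c0 c1|r c0 c1|c1 c2] k0]; case: m => [||||||||b] //=;
  try case: r; rewrite ?/at_stop;
  repeat match goal with
  | |- context [if is_blank ?z then _ else _] => case: (is_blank z)
  | |- context [if is_one ?z then _ else _] => case: (is_one z) end;
  by move=> // [_ _ _ <-].
Qed.

Section CompileCorrect.
Variable prog : cmd.
Notation M := (compiled prog).
Notation tstr k m n b := (enum_rank (tst prog k m n b)).

Lemma rep_ext (c : config M) q t t' p : rep c q t p -> t' =1 t -> rep c q t' p.
Proof. by move=> [h1 h2 h3 h4] e; split=> // *; rewrite e. Qed.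

Lemma shift_run n : forall (c : config M) k m (t : tape) p b, n < 6 ->
  rep c (tstr k m n b) t p ->
  exists2 c', tsteps n c = Some c' &
    rep c' (tstr k m 0 b) t (if b then p + Z.of_nat n else p - Z.of_nat n)%Z.
Proof.
elim: n => [|n IH] c k m t p b hn hc.
  by exists c => //; case: b hc => hc; rewrite ?Z.add_0_r ?Z.sub_0_r.
have e : tm_delta (tstr k m n.+1 b : 'I_(tm_q M)) (t p) = Some (tstr k m n b, t p, if b then MvR else MvL).
  by rewrite /= enum_rankK /tdelta /= inordK.
have [c1 e1 r1] := step_rep hc e.
have [c' e' r'] := IH _ _ _ _ _ _ (ltnW hn) r1.
exists c'; first by rewrite /= e1.
move: r'; set q := (if b then _ else _); set q' := (if b then _ else _).
have -> : q = q' by rewrite /q /q'; case: (b); rewrite /dmove; lia.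
by move=> r'; apply: rep_ext r' _ => i; rewrite upd_id.
Qed.

Definition at_micro (c : config M) (x : mcfg) : Prop :=
  let: (k, m, t, p) := x in
  k \in labels prog /\ exists b, rep c (tstr k m 0 b) t p.

Lemma compiled_mstep (c : config M) x x' : at_micro c x -> mstep x = Some x' ->
  exists n c', [/\ n <= 6, tsteps n c = Some c' & at_micro c' x'].
Proof.
case: x => [[[k m] t] p] [kL [b0 rc]]; rewrite /mstep.
case E: (mdelta k m (t p)) => [[[[k1 m1] w] d]|] // [<-] {x'}.
have k1L := labels_closed kL E; have hd := mdelta_disp E.
have e : tm_delta (tstr k m 0 b0 : 'I_(tm_q M)) (t p) =
    Some (tstr k1 m1 (Z.abs_nat d) (Z.leb 0 d), w, MvS).
  by rewrite /= enum_rankK /tdelta (tcont_tst m 0 b0 kL) /= inordK //= E.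
have [c1 e1 r1] := step_rep rc e.
have [|c2 e2 r2] := shift_run _ r1; first by lia.
exists (1 + Z.abs_nat d), c2; split; [by lia|by rewrite /= e1|].
split=> //; exists (Z.leb 0 d); move: r2; set q := (if Z.leb 0 d then _ else _).
by have -> : q = (p + d)%Z by rewrite /q /dmove; case: Z.leb_spec0; lia.
Qed.

Lemma compiled_msteps n : forall (c : config M) x x', at_micro c x ->
  isteps mstep n x = Some x' ->
  exists N c', [/\ N <= 6 * n, tsteps N c = Some c' & at_micro c' x'].
Proof.
elim: n => [|n IH] c x x' hx; first by move=> [<-]; exists 0, c.
move=> H; have [y e1 e2] := isteps_inv H.
have [n1 [c1 [h1 s1 a1]]] := compiled_mstep hx e1.
have [n2 [c2 [h2 s2 a2]]] := IH _ _ _ a1 e2.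
by exists (n1 + n2), c2; split=> //; [lia | apply: tstepsD s1 s2].
Qed.

Definition input_tape (w : seq bool) : tape :=
  fun i => if Z.ltb i 0 then Blank else nth Blank (map sym_of_bool w) (Z.to_nat i).

Lemma rep_init w : rep (init M w) (tstr [:: prog] MI0 0 true) (input_tape w) 0.
Proof.
rewrite /init /input_tape; case: w => [|b w]; split=> // i; rewrite [LHS]/= ?nth_nil;
  case: Z.ltb_spec => hi //; try lia; try by case: (Z.to_nat _).
by have -> : Z.to_nat (0 + 1 + Z.of_nat i) = i.+1 by lia.
Qed.

(** The bottom of [RI] is cell 0 and its top the last letter, hence [rev w]. The summand 12 pays for
    the two micro steps that write the marker, at six machine steps each. *)
Theorem compiled_correct w n b k s :
  isteps sstep n ([:: prog], Store (rev w) [::] [::] [::] [::]) = Some (Halt b :: k, s) ->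
  exists c, run (12 + 6 * (n * (2 * (size w + n) + 10))) (init M w) = Some c /\
            tm_accept (c_state c) = b.
Proof.
set s0 := Store _ _ _ _ _ => H.
set t1 := upd (upd (input_tape w) 0 (input_tape w 0%Z)) (-2) B1.
have l1 : layout t1 s0.
  rewrite /t1; split=> //.
    move=> i; rewrite !upd_other; try lia.
    by rewrite /input_tape; case: Z.ltb_spec => //; lia.
  move=> r i; rewrite upd_other; last exact: addr_marker.
  rewrite upd_id /input_tape /addr; case: r; rewrite /coff /cstride.
  - have -> : (-2 + 2 + 1 * Z.of_nat i)%Z = Z.of_nat i by lia.
    have -> : Z.ltb (Z.of_nat i) 0 = false by lia.
    by rewrite Nat2Z.id /= revK.
  1-4: by rewrite (_ : Z.ltb _ 0 = true); [rewrite /= nth_nil | lia].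
have a0 : at_micro (init M w) ([:: prog], MI0, input_tape w, 0%Z).
  split; first by rewrite inE mem_conts orbT.
  by exists true; apply: rep_init.
have e0 : isteps mstep 2 ([:: prog], MI0, input_tape w, 0%Z) = Some ([:: prog], MRun, t1, (-2)%Z).
  by [].
have [N [t' [hN hr hl]]] := macro_steps l1 H.
have [t2 [e2 h2]] := hr t1 (fun=> erefl).
have [N' [c [hN' sc ac]]] := compiled_msteps a0 (istepsD e0 e2).
exists c.
have hz : slen s0 = size w by rewrite /slen /= size_rev; lia.
rewrite hz in hN.
have -> : 12 + 6 * (n * (2 * (size w + n) + 10)) = N' + (12 + 6 * (n * (2 * (size w + n) + 10)) - N') by lia.
rewrite (run_tsteps _ sc).
case: ac => kL [b' [cq ch _ _]].
have hs : step c = None.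
  by rewrite /step cq ch /= enum_rankK /tdelta (tcont_tst _ _ _ kL) /= inordK.
by rewrite (run_halted _ hs) cq /= enum_rankK (tcont_tst _ _ _ kL).
Qed.
End CompileCorrect.

(** * Binary trees on a stack and the cost of programs *)

Inductive tree := Leaf | Node (l r : tree).
(** A prefix code: several values can lie on one stack without separators. *)
Fixpoint bits (t : tree) : seq bool :=
  if t is Node a b then true :: bits a ++ bits b else [:: false].

(** The number of steps is chosen before the continuation [k], which makes costs add up under
    [Seq]. *)
Definition ex (c : cmd) (s s' : store) (b : nat) : Prop :=
  exists2 n, n <= b & forall k, isteps sstep n (c :: k, s) = Some (k, s').

Lemma ex_le c s s' b b' : ex c s s' b -> b <= b' -> ex c s s' b'.
Proof. by move=> [n h H] hb; exists n => //; apply: leq_trans h hb. Qed.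

Lemma ex_skip s : ex Skip s s 1.
Proof. by exists 1. Qed.

Lemma ex_seq c1 c2 s s1 s2 b1 b2 : ex c1 s s1 b1 -> ex c2 s1 s2 b2 ->
  ex (Seq c1 c2) s s2 (b1 + b2 + 1).
Proof.
move=> [n1 h1 H1] [n2 h2 H2]; exists (n1 + n2).+1; first by lia.
move=> k; rewrite (@istepsS _ _ _ _ (c1 :: c2 :: k, s)) //.
by apply: istepsD (H1 _) (H2 _).
Qed.

Lemma ex_push r b s s' : s' = set r (b :: get r s) s -> r <> RI -> ex (Push r b) s s' 1.
Proof.
move=> -> ne; exists 1 => // k; rewrite (@istepsS _ _ _ _ (k, set r (b :: get r s) s)) //.
by case: r ne.
Qed.

Lemma ex_if_cons r ce c0 c1 s s' n b l : get r s = b :: l ->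
  ex (if b then c1 else c0) (set r l s) s' n -> ex (IfPop r ce c0 c1) s s' (n + 1).
Proof.
move=> e [m h H]; exists m.+1; first by lia.
by move=> k; rewrite (@istepsS _ _ _ _ ((if b then c1 else c0) :: k, set r l s)) //= e.
Qed.

Lemma ex_while_nil r c0 c1 s : get r s = [::] -> ex (While r c0 c1) s s 1.
Proof. by move=> e; exists 1 => // k; rewrite (@istepsS _ _ _ _ (k, s)) //= e. Qed.

Lemma ex_while_cons r c0 c1 s s1 s2 b l n1 n2 : get r s = b :: l ->
  ex (if b then c1 else c0) (set r l s) s1 n1 -> ex (While r c0 c1) s1 s2 n2 ->
  ex (While r c0 c1) s s2 (n1 + n2 + 1).
Proof.
move=> e [m1 h1 H1] [m2 h2 H2]; exists (m1 + m2).+1; first by lia.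
move=> k; rewrite (@istepsS _ _ _ _ ((if b then c1 else c0) :: While r c0 c1 :: k, set r l s)) /= ?e //.
exact: istepsD (H1 _) (H2 _).
Qed.

Definition pour (r : reg) (c : bool -> cmd) : cmd := While r (c false) (c true).

Lemma ex_pour r c (F : seq bool -> seq bool -> store) n (l v : seq bool) :
  (forall l v, get r (F l v) = l) ->
  (forall l x v, ex (c x) (set r l (F (x :: l) v)) (F l (x :: v)) n) ->
  ex (pour r c) (F l v) (F [::] (catrev l v)) ((n + 1) * size l + 1).
Proof.
move=> hg hc; elim: l v => [|x l IH] v; first by apply: ex_le (ex_while_nil _ _ (hg _ _)) _; lia.
have h : ex (if x then c true else c false) (set r l (F (x :: l) v)) (F l (x :: v)) n.
  by case: x (hc l x v).
by apply: ex_le (ex_while_cons (hg _ _) h (IH _)) _; rewrite /=; lia.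
Qed.

Lemma ex_pourAS i s a b c :
  ex (pour RA (Push RS)) (Store i s a b c) (Store i (catrev a s) [::] b c) (2 * size a + 1).
Proof. by apply: (@ex_pour _ _ (fun a s => Store i s a b c) 1) => // *; apply: ex_push. Qed.

Lemma ex_pourBS i s a b c :
  ex (pour RB (Push RS)) (Store i s a b c) (Store i (catrev b s) a [::] c) (2 * size b + 1).
Proof. by apply: (@ex_pour _ _ (fun b s => Store i s a b c) 1) => // *; apply: ex_push. Qed.

Lemma ex_pourBA i s a b c :
  ex (pour RB (Push RA)) (Store i s a b c) (Store i s (catrev b a) [::] c) (2 * size b + 1).
Proof. by apply: (@ex_pour _ _ (fun b a => Store i s a b c) 1) => // *; apply: ex_push. Qed.

Lemma ex_pourASB i s a c :
  ex (pour RA (fun x => Seq (Push RS x) (Push RB x))) (Store i s a [::] c)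
     (Store i (catrev a s) [::] (rev a) c) (4 * size a + 1).
Proof.
(* [RS] is split as [v ++ s], so that the part [v] poured so far appears on [RS] and on [RB]
   alike. *)
rewrite -[X in Store _ X a](cat0s s) -[catrev a s]/(catrev a ([::] ++ s)) !catrevE.
apply: (@ex_pour _ _ (fun a v => Store i (v ++ s) a v c) 3) => // l x v.
by apply: (@ex_seq _ _ _ (Store i (x :: v ++ s) l v c) _ 1 1); apply: ex_push.
Qed.

Lemma ex_pourA i s a b c :
  ex (pour RA (fun=> Skip)) (Store i s a b c) (Store i s [::] b c) (2 * size a + 1).
Proof. by apply: (@ex_pour _ _ (fun a _ => Store i s a b c) 1 a [::]) => // *; apply: ex_skip. Qed.

(* [RC] counts the subtrees still to be read in the prefix code. *)
Definition extract (d : bool) : cmd :=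
  let r := if d then RA else RB in
  Seq (Push RC true)
    (While RC Skip (IfPop RS Skip (Push r false)
                     (Seq (Push r true) (Seq (Push RC true) (Push RC true))))).

Definition mkst (d : bool) i s x y c := if d then Store i s x y c else Store i s y x c.

Lemma ex_extract d i t s x y : ex (extract d) (mkst d i (bits t ++ s) x y [::])
  (mkst d i s (catrev (bits t) x) y [::]) (8 * size (bits t) + 3).
Proof.
(* Induction needs a list of pending trees, as many as [RC] counts: reading a node replaces one tree
   by its two children and shortens the total code by one bit. *)
suff H n ts : size (flatten (map bits ts)) <= n ->
  ex (While RC Skip (IfPop RS Skip (Push (if d then RA else RB) false)
        (Seq (Push (if d then RA else RB) true) (Seq (Push RC true) (Push RC true)))))
     (mkst d i (flatten (map bits ts) ++ s) x y (nseq (size ts) true))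
     (mkst d i s (catrev (flatten (map bits ts)) x) y [::])
     (8 * size (flatten (map bits ts)) + 1).
  have := H _ [:: t] (leqnn _); rewrite /= cats0 => {}H.
  apply: ex_le (ex_seq (b1 := 1) _ H) _; last by lia.
  by case: (d); apply: ex_push.
elim: n ts x => [|n IH] [|[|l r] ts] x hn; try by [].
- by apply: ex_while_nil; case: (d).
- by apply: ex_while_nil; case: (d).
- rewrite /= in hn *; have {}IH := IH ts (false :: x) hn.
  apply: ex_le (ex_while_cons (b := true) (n1 := 1 + 1) (l := nseq (size ts) true) _ _ IH) _.
  + by case: (d).
  + apply: (@ex_if_cons _ _ _ _ _ _ _ false (flatten (map bits ts) ++ s)); first by case: (d).
    by case: (d); apply: ex_push.
  + by lia.
- have e : flatten (map bits (Node l r :: ts)) = true :: flatten (map bits [:: l, r & ts]).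
    by rewrite /= catA.
  rewrite e in hn *; have {}IH := IH [:: l, r & ts] (true :: x) hn.
  apply: ex_le (ex_while_cons (b := true) (n1 := 1 + (1 + 1 + 1) + 1 + 1) (l := nseq (size ts) true) _ _ IH) _.
  + by case: (d).
  + apply: (@ex_if_cons _ _ _ _ _ _ _ true (flatten (map bits [:: l, r & ts]) ++ s)); first by case: (d).
    set z := flatten _ ++ s.
    apply: (ex_seq (s1 := mkst d i z (true :: x) y (nseq (size ts) true))).
      by case: (d); apply: ex_push.
    apply: (ex_seq (s1 := mkst d i z (true :: x) y (true :: nseq (size ts) true)));
      by case: (d); apply: ex_push.
  + by rewrite /=; lia.
Qed.

Definition stk (i s : seq bool) : store := Store i s [::] [::] [::].

Lemma ex_top ce c0 c1 i b v s' n : ex (if b then c1 else c0) (stk i v) s' n ->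
  ex (IfPop RS ce c0 c1) (stk i (b :: v)) s' (n + 1).
Proof. by move=> h; apply: (@ex_if_cons RS ce c0 c1 _ _ _ b v). Qed.

Definition cswap : cmd :=
  Seq (extract true) (Seq (extract false) (Seq (pour RA (Push RS)) (pour RB (Push RS)))).
Definition cdup : cmd :=
  Seq (extract true) (Seq (pour RA (fun x => Seq (Push RS x) (Push RB x)))
    (Seq (pour RB (Push RA)) (pour RA (Push RS)))).
Definition cdrop : cmd := Seq (extract true) (pour RA (fun=> Skip)).

Lemma ex_swap i x y s : ex cswap (stk i (bits x ++ bits y ++ s)) (stk i (bits y ++ bits x ++ s))
  (10 * (size (bits x) + size (bits y)) + 20).
Proof.
have h1 := ex_extract true i x (bits y ++ s) [::] [::].
have h2 := ex_extract false i y s [::] (rev (bits x)).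
have h3 := ex_pourAS i s (rev (bits x)) (rev (bits y)) [::].
have h4 := ex_pourBS i (bits x ++ s) [::] (rev (bits y)) [::].
rewrite catrevE revK size_rev in h3; rewrite catrevE revK size_rev in h4.
by apply: ex_le (ex_seq h1 (ex_seq h2 (ex_seq h3 h4))) _; lia.
Qed.

Lemma ex_dup i x s : ex cdup (stk i (bits x ++ s)) (stk i (bits x ++ bits x ++ s))
  (16 * size (bits x) + 20).
Proof.
have h1 := ex_extract true i x s [::] [::].
have h2 := ex_pourASB i s (rev (bits x)) [::].
rewrite catrevE revK size_rev in h2.
have h3 := ex_pourBA i (bits x ++ s) [::] (bits x) [::].
have h4 := ex_pourAS i (bits x ++ s) (rev (bits x)) [::] [::].
rewrite catrevE revK size_rev in h4.
by apply: ex_le (ex_seq h1 (ex_seq h2 (ex_seq h3 h4))) _; lia.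
Qed.

Lemma ex_drop i x s : ex cdrop (stk i (bits x ++ s)) (stk i s) (10 * size (bits x) + 20).
Proof.
have h1 := ex_extract true i x s [::] [::].
have h2 := ex_pourA i s (rev (bits x)) [::] [::]; rewrite size_rev in h2.
by apply: ex_le (ex_seq h1 h2) _; lia.
Qed.

Fixpoint pushes (v : seq bool) : cmd :=
  if v is b :: v' then Seq (pushes v') (Push RS b) else Skip.

Lemma ex_pushes i v s : ex (pushes v) (stk i s) (stk i (v ++ s)) (2 * size v + 1).
Proof.
elim: v => [|b v IH]; first exact: ex_skip.
by apply: ex_le (ex_seq IH (_ : ex _ _ (stk i (b :: v ++ s)) 1)) _; [apply: ex_push|rewrite /=; lia].
Qed.

Lemma slen_isteps n k s k' s' : isteps sstep n (k, s) = Some (k', s') -> slen s' <= slen s + n.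
Proof.
elim: n k s => [|n IH] k s; first by move=> [_ ->]; lia.
move=> H; have [[k1 s1] e1 e2] := isteps_inv H.
by have := IH _ _ e2; have := slen_step e1; lia.
Qed.

(** * Polynomial-time functions between encoded types *)

Class Enc (A : Type) := tr : A -> tree.
Arguments tr {A _} _ : simpl never.
Definition sz (A : Type) {_ : Enc A} (x : A) : nat := size (bits (tr x)).
Arguments sz {A _} _.

Lemma sz_gt0 A {_ : Enc A} (x : A) : 0 < sz x.
Proof. by rewrite /sz; case: (tr x). Qed.

(** With a base of at least 2, the single exponent [a] also absorbs constant factors and
    summands. *)
Definition PB (A : Type) {_ : Enc A} (F : A -> nat) : Prop :=
  exists a, forall x, F x <= (sz x + 2) ^ a.
Arguments PB {A _} F.

(** The rest [r] of the stack stays untouched below the value, which is what lets one program run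
    inside another. *)
Definition PT (A B : Type) {_ : Enc A} {_ : Enc B} (f : A -> B) : Prop :=
  exists c (F : A -> nat), PB F /\ forall x i r,
    ex c (stk i (bits (tr x) ++ r)) (stk i (bits (tr (f x)) ++ r)) (F x).
Arguments PT {A B _ _} f.

Section PolyBound.
Context {A : Type} {EA : Enc A}.
Implicit Types F G : A -> nat.

Lemma pow_le_base (x a b : nat) : a <= b -> (x + 2) ^ a <= (x + 2) ^ b.
Proof. by move=> h; rewrite leq_pexp2l //; lia. Qed.

Lemma PB_le F G : PB G -> (forall x, F x <= G x) -> PB F.
Proof. by move=> [a h] le; exists a => x; apply: leq_trans (le x) (h x). Qed.

Lemma PB_const n : PB (fun _ : A => n).
Proof.
exists n => x; apply: leq_trans (_ : 2 ^ n <= _); first exact/ltnW/ltn_expl.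
by case: n => // n; rewrite leq_exp2r //; lia.
Qed.

Lemma PB_sz : PB (fun x : A => sz x).
Proof. by exists 1 => x; rewrite expn1; lia. Qed.

Lemma PB_mul F G : PB F -> PB G -> PB (fun x => F x * G x).
Proof. by move=> [a hF] [b hG]; exists (a + b) => x; rewrite expnD leq_mul. Qed.

Lemma PB_add F G : PB F -> PB G -> PB (fun x => F x + G x).
Proof.
move=> [a hF] [b hG]; exists (a + b).+1 => x.
have h1 := leq_trans (hF x) (pow_le_base (sz x) (leq_addr b a)).
have h2 := leq_trans (hG x) (pow_le_base (sz x) (leq_addl a b)).
rewrite expnS; move: h1 h2; set p := _ ^ _ => h1 h2.
by apply: leq_trans (_ : 2 * p <= _); [lia | rewrite leq_mul2r; lia].
Qed.

Lemma PB_exp F n : PB F -> PB (fun x => F x ^ n).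
Proof.
move=> h; elim: n => [|n IH]; first exact: PB_const.
by apply: (PB_le (PB_mul h IH)) => x; rewrite expnS.
Qed.
End PolyBound.

(** A step adds at most one bit to the stacks, so the running time also bounds the size of the
    output. This is why time bounds compose. *)
Lemma PT_size A B {EA : Enc A} {EB : Enc B} (f : A -> B) : PT f -> PB (fun x => sz (f x)).
Proof.
move=> [c [F [hF h]]]; apply: (PB_le (PB_add PB_sz hF)) => x.
have [n hn H] := h x [::] [::].
by have := slen_isteps (H [::]); rewrite /slen /= !cats0 -/(sz _) -/(sz _); lia.
Qed.

Lemma PB_comp A B {EA : Enc A} {EB : Enc B} (f : A -> B) (G : B -> nat) :
  PT f -> PB G -> PB (fun x => G (f x)).
Proof.
move=> /PT_size hf [b hG].
have := PB_exp b (PB_add hf (PB_const 2)); move=> h; exact: PB_le h (fun x => hG (f x)).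
Qed.

Lemma PT_comp A B C {EA : Enc A} {EB : Enc B} {EC : Enc C} (g : B -> C) (f : A -> B) :
  PT g -> PT f -> PT (fun x => g (f x)).
Proof.
move=> [cg [G [hG Hg]]] hf; case: (hf) => cf [F [hF Hf]].
exists (Seq cf cg), (fun x => F x + G (f x) + 1); split.
  by apply: PB_add (PB_const 1); apply: PB_add hF (PB_comp hf hG).
by move=> x i r; apply: ex_seq (Hf _ _ _) (Hg _ _ _).
Qed.

Lemma PT_ext A B {EA : Enc A} {EB : Enc B} (f g : A -> B) : PT f -> f =1 g -> PT g.
Proof. by move=> [c [F [hF H]]] e; exists c, F; split=> // x i r; rewrite -e. Qed.

Lemma PT_cast A B {EA : Enc A} {EB : Enc B} (f : A -> B) :
  (forall x, tr (f x) = tr x) -> PT f.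
Proof.
move=> e; exists Skip, (fun=> 1); split; first exact: PB_const.
by move=> x i r; rewrite e; apply: ex_skip.
Qed.

Lemma PT_id A {EA : Enc A} : PT (fun x : A => x).
Proof. exact: PT_cast. Qed.

#[export] Instance enc_unit : Enc unit := fun _ => Leaf.
#[export] Instance enc_bool : Enc bool := fun b => if b then Node Leaf Leaf else Leaf.
(** Numbers are unary, as in [enc_nats]. The codes of [nat] and [seq unit], of [Some x] and
    [[:: x]], and of [x :: s] and [(x, s)] coincide, which makes the conversions free by
    [PT_cast]. *)
#[export] Instance enc_unary : Enc nat := fix f n := if n is n'.+1 then Node Leaf (f n') else Leaf.
#[export] Instance enc_pair A B {EA : Enc A} {EB : Enc B} : Enc (A * B) :=
  fun x => Node (tr x.1) (tr x.2).
#[export] Instance enc_seq A {EA : Enc A} : Enc (seq A) :=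
  fix f s := if s is x :: s' then Node (tr x) (f s') else Leaf.
#[export] Instance enc_option A {EA : Enc A} : Enc (option A) :=
  fun o => if o is Some x then tr [:: x] else Leaf.

Lemma tr_pair A B {EA : Enc A} {EB : Enc B} (x : A) (y : B) : tr (x, y) = Node (tr x) (tr y).
Proof. by []. Qed.
Lemma tr_cons A {EA : Enc A} (x : A) s : tr (x :: s) = Node (tr x) (tr s).
Proof. by []. Qed.
Lemma sz_pair A B {EA : Enc A} {EB : Enc B} (x : A) (y : B) : sz (x, y) = (sz x + sz y).+1.
Proof. by rewrite /sz /tr /enc_pair /= size_cat. Qed.
Lemma sz_nil A {EA : Enc A} : sz ([::] : seq A) = 1.
Proof. by []. Qed.
Lemma sz_cons A {EA : Enc A} (x : A) s : sz (x :: s) = (sz x + sz s).+1.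
Proof. by rewrite /sz /tr /= size_cat. Qed.
Lemma sz_nat (n : nat) : sz n = n.*2.+1.
Proof. by elim: n => //= n; rewrite /sz /tr /= => ->. Qed.
Lemma sz_bool (b : bool) : sz b <= 3.
Proof. by case: b. Qed.
Lemma size_le_sz A {EA : Enc A} (s : seq A) : size s <= sz s.
Proof. by elim: s => //= x s; rewrite sz_cons; lia. Qed.

Lemma PT_pair A B C {EA : Enc A} {EB : Enc B} {EC : Enc C} (f : A -> B) (g : A -> C) :
  PT f -> PT g -> PT (fun x => (f x, g x)).
Proof.
move=> hf hg; case: (hf) => cf [F [hF Hf]]; case: (hg) => cg [G [hG Hg]].
exists (Seq cdup (Seq cg (Seq cswap (Seq cf (Push RS true))))).
exists (fun x => 16 * sz x + 20 + G x + 10 * (sz (g x) + sz x) + 20 + F x + 5); split.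
  have P := PB_const; have S := @PB_sz A _; have Q := PT_size hg.
  by repeat (apply: PB_add || apply: PB_mul || apply: P || assumption).
move=> x i r.
pose proof (ex_dup i (tr x) r) as h1.
pose proof (Hg x i (bits (tr x) ++ r)) as h2.
pose proof (ex_swap i (tr (g x)) (tr x) r) as h3.
pose proof (Hf x i (bits (tr (g x)) ++ r)) as h4.
have h5 : ex (Push RS true) (stk i (bits (tr (f x)) ++ bits (tr (g x)) ++ r))
             (stk i (bits (tr (f x, g x)) ++ r)) 1.
  by apply: ex_push => //; rewrite tr_pair /= catA.
by apply: ex_le (ex_seq h1 (ex_seq h2 (ex_seq h3 (ex_seq h4 h5)))) _; rewrite /sz; lia.
Qed.

Lemma PT_fst0 A B {EA : Enc A} {EB : Enc B} : PT (fun p : A * B => p.1).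
Proof.
exists (IfPop RS Skip Skip (Seq cswap cdrop)), (fun p => 30 * sz p + 60); split.
  by apply: PB_add (PB_const _); apply: PB_mul (PB_const _) PB_sz.
move=> [x y] i r; rewrite sz_pair /=.
pose proof (ex_swap i (tr x) (tr y) r) as h1.
pose proof (ex_drop i (tr y) (bits (tr x) ++ r)) as h2.
pose proof (@ex_top Skip Skip _ i true _ _ _ (ex_seq h1 h2)) as h.
by rewrite ?tr_pair /= -catA; apply: ex_le h _; rewrite /sz; lia.
Qed.

Lemma PT_snd0 A B {EA : Enc A} {EB : Enc B} : PT (fun p : A * B => p.2).
Proof.
exists (IfPop RS Skip Skip cdrop), (fun p => 30 * sz p + 60); split.
  by apply: PB_add (PB_const _); apply: PB_mul (PB_const _) PB_sz.
move=> [x y] i r; rewrite sz_pair /=.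
pose proof (ex_drop i (tr x) (bits (tr y) ++ r)) as h2.
pose proof (@ex_top Skip Skip _ i true _ _ _ h2) as h.
by rewrite ?tr_pair /= -catA; apply: ex_le h _; rewrite /sz; lia.
Qed.

Lemma PT_fst E A B {EE : Enc E} {EA : Enc A} {EB : Enc B} (f : E -> A * B) :
  PT f -> PT (fun e => (f e).1).
Proof. exact: PT_comp PT_fst0. Qed.
Lemma PT_snd E A B {EE : Enc E} {EA : Enc A} {EB : Enc B} (f : E -> A * B) :
  PT f -> PT (fun e => (f e).2).
Proof. exact: PT_comp PT_snd0. Qed.

Lemma PT_const E A {EE : Enc E} {EA : Enc A} (a : A) : PT (fun _ : E => a).
Proof.
exists (Seq cdrop (pushes (bits (tr a)))), (fun x => 10 * sz x + 20 + (2 * sz a + 2)); split.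
  by repeat (apply: PB_add || apply: PB_mul || apply: PB_const || apply: PB_sz).
move=> x i r; apply: ex_le (ex_seq (ex_drop i (tr x) r) (ex_pushes i (bits (tr a)) r)) _.
by rewrite /sz; lia.
Qed.

Lemma PT_if E A {EE : Enc E} {EA : Enc A} (b : E -> bool) (f g : E -> A) :
  PT b -> PT f -> PT g -> PT (fun e => if b e then f e else g e).
Proof.
move=> hb [cf [F [hF Hf]]] [cg [G [hG Hg]]].
have [cb [Bd [hB Hb]]] := PT_pair hb PT_id.
exists (Seq cb (IfPop RS Skip Skip (IfPop RS Skip cg
         (IfPop RS Skip (IfPop RS Skip cf Skip) Skip)))).
exists (fun x => Bd x + (F x + G x + 10)); split.
  by repeat (apply: PB_add || apply: PB_const || assumption).
move=> x i r; apply: ex_le (ex_seq (Hb x i r) (_ : ex _ _ _ (F x + G x + 8))) _; last by lia.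
apply: (@ex_le _ _ _ (F x + G x + 1 + 1 + 1 + 1)); last by lia.
(* After the node of the pair comes the code of the boolean: three bits for [true], one bit for
   [false]; exactly these are popped before [e] is on top. *)
rewrite ?tr_pair /=; case: (b x) => /=.
  apply: ex_top; apply: ex_top.
  apply: ex_top; apply: ex_top.
  by apply: ex_le (Hf _ _ _) _; lia.
apply: ex_top; apply: ex_top.
by apply: ex_le (Hg _ _ _) _; lia.
Qed.

(** Popping two bits of the code of [(l e, e)] reveals whether the list is empty. If not, the cons
    bit is put back: the code of [x :: s] is that of [(x, s)], so a swap and one more node give the
    argument of [g]. *)
Lemma PT_lcase E X A {EE : Enc E} {EX : Enc X} {EA : Enc A} (l : E -> seq X)
    (f : E -> A) (g : E -> X -> seq X -> A) :
  PT l -> PT f -> PT (fun p : E * (X * seq X) => g p.1 p.2.1 p.2.2) ->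
  PT (fun e => if l e is x :: s then g e x s else f e).
Proof.
move=> hl [cf [F [hF Hf]]] [cg [G [hG Hg]]].
have [cl [L [hL Hl]]] := PT_pair hl PT_id.
pose G' e := if l e is x :: s then G (e, (x, s)) else 0.
exists (Seq cl (IfPop RS Skip Skip (IfPop RS Skip cf
         (Seq (Push RS true) (Seq cswap (Seq (Push RS true) cg)))))).
exists (fun x => L x + (F x + G' x + 10 * (sz (l x) + sz x) + 50)); split.
  have hG' : PB G'.
    have [a ha] := hG; have hl2 := PT_size hl.
    have h := PB_exp a (PB_add (PB_add PB_sz hl2) (PB_const 4)).
    apply: (PB_le h) => e; rewrite /G'; case El : (l e) => [|x s] //.
    apply: leq_trans (ha _) _.
    case: (a) => // a'; rewrite leq_exp2r // !sz_pair sz_cons; lia.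
  have Q := PT_size hl.
  by repeat (apply: PB_add || apply: PB_mul || apply: PB_const || apply: PB_sz || assumption).
move=> e i r.
apply: ex_le (ex_seq (Hl e i r) (_ : ex _ _ _ (F e + G' e + 10 * (sz (l e) + sz e) + 45))) _; last by lia.
rewrite ?tr_pair /= /G'; case El : (l e) => [|x s].
  apply: (@ex_le _ _ _ (F e + 1 + 1)); last by lia.
  by apply: ex_top; apply: ex_top.
apply: (@ex_le _ _ _ (G (e, (x, s)) + 10 * (sz (x :: s) + sz e) + 42 + 1 + 1)); last by lia.
apply: ex_top; rewrite ?tr_cons /=; apply: ex_top; rewrite -!catA.
pose proof (ex_swap i (tr (x :: s)) (tr e) r) as h2.
have h1 : ex (Push RS true) (stk i (bits (tr x) ++ bits (tr s) ++ bits (tr e) ++ r))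
             (stk i (bits (tr (x :: s)) ++ bits (tr e) ++ r)) 1.
  by apply: ex_push => //; rewrite ?tr_pair ?tr_cons /= -!catA /= -?catA.
have h3 : ex (Push RS true) (stk i (bits (tr e) ++ bits (tr (x :: s)) ++ r))
             (stk i (bits (tr (e, (x, s))) ++ r)) 1.
  by apply: ex_push => //; rewrite ?tr_pair ?tr_cons /= -!catA /= -?catA.
pose proof (ex_seq h1 (ex_seq h2 (ex_seq h3 (Hg (e, (x, s)) i r)))) as h.
by apply: ex_le h _; rewrite /sz; lia.
Qed.

Definition cloop (c : cmd) : cmd :=
  Seq (Push RC true)
   (While RC Skip
     (IfPop RS Skip (Push RS false)
       (IfPop RS Skip (Seq (Push RS false) (Push RS true))
         (Seq (Push RS true) (Seq (Push RS true) (Seq c (Push RC true))))))).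

(* The loop runs as long as the left subtree of the value on top of [RS] is not a leaf. *)
Lemma ex_loop X {EX : Enc X} (test : X -> bool) (f : X -> X) F c :
  (forall x, exists v, bits (tr x) = [:: true, test x & v]) ->
  (forall x i r, ex c (stk i (bits (tr x) ++ r)) (stk i (bits (tr (f x)) ++ r)) (F x)) ->
  forall n x i r, (forall j, j < n -> test (iter j f x)) -> test (iter n f x) = false ->
  ex (cloop c) (stk i (bits (tr x) ++ r)) (stk i (bits (tr (iter n f x)) ++ r))
     (\sum_(j < n) (F (iter j f x) + 12) + 12).
Proof.
move=> ht hf n x i r hj hn.
pose st v := Store i v [::] [::] [:: true].
set body := IfPop RS Skip (Push RS false) (IfPop RS Skip (Seq (Push RS false) (Push RS true))
         (Seq (Push RS true) (Seq (Push RS true) (Seq c (Push RC true))))).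
have H : ex (While RC Skip body) (st (bits (tr x) ++ r)) (stk i (bits (tr (iter n f x)) ++ r))
     (\sum_(j < n) (F (iter j f x) + 12) + 8); last first.
  have h1 : ex (Push RC true) (stk i (bits (tr x) ++ r)) (st (bits (tr x) ++ r)) 1 by apply: ex_push.
  by apply: ex_le (ex_seq h1 H) _; lia.
elim: n x hj hn => [|n IH] x hj hn.
  rewrite big_ord0 /= in hn *; have [v ev] := ht x; rewrite hn in ev.
  have h1 : ex body (stk i (bits (tr x) ++ r)) (stk i (bits (tr x) ++ r)) (1 + 1 + 1 + 1 + 1).
    rewrite ev /=; apply: ex_top; apply: ex_top.
    by apply: (ex_seq (s1 := stk i (false :: v ++ r))); apply: ex_push.
  pose proof (@ex_while_nil RC Skip body (stk i (bits (tr x) ++ r)) (erefl _)) as h2.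
  have e : get RC (st (bits (tr x) ++ r)) = [:: true] by [].
  by apply: ex_le (@ex_while_cons RC Skip body (st _) _ _ true [::] _ _ e h1 h2) _; lia.
have tx : test x := hj 0 isT.
rewrite iterSr in hn *.
have hj' j : j < n -> test (iter j f (f x)) by move=> lt; rewrite -iterSr; apply: hj.
have {}IH := IH (f x) hj' hn.
rewrite big_ord_recl /=.
have -> : \sum_(j < n) (F (iter (bump 0 j) f x) + 12) = \sum_(j < n) (F (iter j f (f x)) + 12).
  by apply: eq_bigr => j _; rewrite /bump add1n iterSr.
have [v ev] := ht x; rewrite tx in ev.
have h1 : ex body (stk i (bits (tr x) ++ r)) (st (bits (tr (f x)) ++ r)) (1 + (1 + (F x + 1 + 1) + 1) + 1 + 1 + 1).
  rewrite ev /=; apply: ex_top; apply: ex_top.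
  apply: (ex_seq (s1 := stk i (true :: v ++ r))); first by apply: ex_push.
  apply: (ex_seq (s1 := stk i (bits (tr x) ++ r))); first by rewrite ev; apply: ex_push.
  apply: (ex_seq (s1 := stk i (bits (tr (f x)) ++ r))); first exact: hf.
  exact: ex_push.
have e : get RC (st (bits (tr x) ++ r)) = [:: true] by [].
apply: ex_le (@ex_while_cons RC Skip body (st _) _ _ true [::] _ _ e h1 IH) _; lia.
Qed.

Lemma sz_drop A {EA : Enc A} n (s : seq A) : sz (drop n s) <= sz s.
Proof. by elim: s n => [|x s IH] [|n] //=; rewrite ?sz_cons; have := IH n; lia. Qed.

Lemma sz_cat A {EA : Enc A} (s1 s2 : seq A) : (sz (s1 ++ s2)).+1 = sz s1 + sz s2.
Proof. by elim: s1 => [|x s IH] //=; rewrite !sz_cons; lia. Qed.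

Section Foldl.
Context {E A X : Type} {EE : Enc E} {EA : Enc A} {EX : Enc X}.
Variables (h : E -> A -> X -> A) (z : E -> A) (l : E -> seq X).
Hypotheses (hh : PT (fun p : E * (A * X) => h p.1 p.2.1 p.2.2)) (hz : PT z) (hl : PT l).

(** Iterating a polynomial-time function may double the size at every turn; the bound [W] on all
    intermediate accumulators excludes this. The loop state keeps the remaining list leftmost, where
    [ex_loop] tests it. *)
Lemma PT_foldl (W : E -> nat) : PB W ->
  (forall e pre suf, l e = pre ++ suf -> sz (foldl (h e) (z e) pre) <= W e) ->
  PT (fun e => foldl (h e) (z e) (l e)).
Proof.
move=> hW hb.
pose G (st : seq X * (A * E)) :=
  if st.1 is x :: s then (s, (h st.2.2 st.2.1 x, st.2.2)) else st.
have [cG [FG [[a hFG] HG]]] : PT G.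
  apply: (PT_lcase (l := fun st : seq X * (A * E) => st.1)
           (g := fun st x s => (s, (h st.2.2 st.2.1 x, st.2.2)))).
  - exact: PT_fst PT_id.
  - exact: PT_id.
  - apply: PT_pair; first exact: PT_snd (PT_snd PT_id).
    apply: PT_pair; last exact: PT_snd (PT_snd (PT_fst PT_id)).
    have h1 : PT (fun p : (seq X * (A * E)) * (X * seq X) => (p.1.2.2, (p.1.2.1, p.2.1))).
      apply: PT_pair; first exact: PT_snd (PT_snd (PT_fst PT_id)).
      by apply: PT_pair; [exact: PT_fst (PT_snd (PT_fst PT_id)) | exact: PT_fst (PT_snd PT_id)].
    exact: (PT_comp hh h1).
have [c0 [F0 [hF0 H0]]] : PT (fun e => (l e, (z e, e))) by apply: PT_pair hl (PT_pair hz PT_id).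
have [c1 [F1 [[b hF1] H1]]] : PT (fun st : seq X * (A * E) => st.2.1) by exact: PT_fst (PT_snd PT_id).
pose (K := fun e : E => sz (l e) + W e + sz e + 4).
exists (Seq c0 (Seq (cloop cG) c1)).
exists (fun e => F0 e + (sz (l e) * (K e ^ a + 12) + 12) + K e ^ b + 2); split.
  have hl' := PT_size hl.
  have hK : PB K by repeat (apply: PB_add || apply: PB_sz || apply: PB_const || assumption).
  by repeat (apply: PB_add || apply: PB_mul || apply: PB_exp || apply: PB_sz || apply: PB_const || assumption).
move=> e i r.
have iterG n : iter n G (l e, (z e, e)) = (drop n (l e), (foldl (h e) (z e) (take n (l e)), e)).
  elim: n => [|n IH] /=; first by rewrite drop0 take0.
  rewrite IH /G /=; case: (ltnP n (size (l e))) => hn; last first.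
    by rewrite !drop_oversize ?take_oversize //; lia.
  case D : (drop n (l e)) => [|x s]; first by move: (congr1 size D); rewrite size_drop /=; lia.
  have hs : drop n.+1 (l e) = s by rewrite -addn1 addnC -drop_drop D /= drop0.
  rewrite hs -addn1 takeD D /= take0 foldl_cat //.
have szG n : sz (iter n G (l e, (z e, e))) + 2 <= K e.
  rewrite iterG !sz_pair /K.
  have h1 := hb e _ _ (esym (cat_take_drop n (l e))); pose proof (sz_drop n (l e)) as h2.
  by lia.
have ht (st : seq X * (A * E)) : exists v, bits (tr st) = [:: true, ~~ nilp st.1 & v].
  by case: st => [[|x s] y]; eexists; reflexivity.
pose proof (@ex_loop _ _ _ G FG cG ht HG (size (l e)) (l e, (z e, e)) i r) as HL.
have {}HL : ex (cloop cG) (stk i (bits (tr (l e, (z e, e))) ++ r))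
   (stk i (bits (tr (iter (size (l e)) G (l e, (z e, e)))) ++ r))
   (sz (l e) * (K e ^ a + 12) + 12).
  apply: ex_le (HL _ _) _.
  - by move=> j hj; rewrite iterG /nilp size_drop; lia.
  - by rewrite iterG drop_size.
  - rewrite leq_add2r.
    apply: (@leq_trans (\sum_(j < size (l e)) (K e ^ a + 12))).
      apply: leq_sum => j _; rewrite leq_add2r; apply: leq_trans (hFG _) _.
      by case: (a) => // a'; rewrite leq_exp2r.
    by rewrite sum_nat_const card_ord leq_mul2r size_le_sz orbT.
pose proof (H1 (iter (size (l e)) G (l e, (z e, e))) i r) as H2; rewrite {2}iterG take_size in H2.
apply: ex_le (ex_seq (H0 e i r) (ex_seq HL H2)) _.
have : F1 (iter (size (l e)) G (l e, (z e, e))) <= K e ^ b.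
  by apply: leq_trans (hF1 _) _; case: (b) => // b'; rewrite leq_exp2r.
by lia.
Qed.

(** Growth by a bounded summand per element, instead of a factor, yields the bound on intermediate
    accumulators. *)
Lemma PT_foldl_inc (W : E -> nat) : PB W ->
  (forall e x acc, sz x <= sz (l e) -> sz (h e acc x) <= sz acc + W e) ->
  PT (fun e => foldl (h e) (z e) (l e)).
Proof.
move=> hW hb; apply: (@PT_foldl (fun e => sz (z e) + sz (l e) * W e)).
  by have := PT_size hz; have := PT_size hl => h1 h2; apply: PB_add => //; apply: PB_mul.
move=> e pre suf el.
have hs : size pre <= sz (l e).
  by apply: leq_trans (size_le_sz _); rewrite el size_cat leq_addr.
apply: (@leq_trans (sz (z e) + size pre * W e)); last by rewrite leq_add2l leq_mul2r hs orbT.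
elim/last_ind: pre suf el {hs} => [|pre x IH] suf el; first by rewrite addn0.
have {}IH := IH (x :: suf); rewrite -cat_rcons in IH.
rewrite -cats1 foldl_cat /= cats1 size_rcons mulSn.
apply: leq_trans (hb _ _ _ _) _; last by have := IH el; lia.
pose proof (sz_cat (rcons pre x) suf) as e1; rewrite -el in e1.
pose proof (sz_cat pre [:: x]) as e2; rewrite cats1 sz_cons sz_nil in e2.
pose proof (sz_gt0 suf) as g1; pose proof (sz_gt0 pre) as g2.
by lia.
Qed.
End Foldl.


(** * Lists, arithmetic and equality in polynomial time *)

Lemma PT_S {E : Type} {EE : Enc E} (f : E -> nat) : PT f -> PT (fun e => (f e).+1).
Proof.
move=> h; have hc : PT (fun p : unit * nat => p.2.+1) by apply: PT_cast => -[].
exact: (PT_comp hc (PT_pair (PT_const tt) h)).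
Qed.

Lemma PT_cons {E X : Type} {EE : Enc E} {EX : Enc X} (f : E -> X) (g : E -> seq X) : PT f -> PT g -> PT (fun e => f e :: g e).
Proof.
move=> hf hg; have hc : PT (fun p : X * seq X => p.1 :: p.2) by apply: PT_cast => -[].
exact: (PT_comp hc (PT_pair hf hg)).
Qed.

Lemma PT_Some {E X : Type} {EE : Enc E} {EX : Enc X} (f : E -> X) : PT f -> PT (fun e => Some (f e)).
Proof.
move=> hf; have hc : PT (fun p : X * unit => Some p.1) by apply: PT_cast => -[x []].
exact: (PT_comp hc (PT_pair hf (PT_const tt))).
Qed.

Lemma PT_negb {E : Type} {EE : Enc E} (f : E -> bool) : PT f -> PT (fun e => ~~ f e).
Proof.
move=> hf; apply: (PT_ext (PT_if hf (PT_const false) (PT_const true))) => e.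
by case: (f e).
Qed.

Lemma PT_andb {E : Type} {EE : Enc E} (f g : E -> bool) : PT f -> PT g -> PT (fun e => f e && g e).
Proof. by move=> hf hg; apply: (PT_ext (PT_if hf hg (PT_const false))). Qed.

Lemma PT_orb {E : Type} {EE : Enc E} (f g : E -> bool) : PT f -> PT g -> PT (fun e => f e || g e).
Proof. by move=> hf hg; apply: (PT_ext (PT_if hf (PT_const true) hg)). Qed.

(** Passing from a number to a list of units at no cost turns arithmetic into list processing and
    bounded iteration into a fold. *)
Lemma PT_units {E : Type} {EE : Enc E} (n : E -> nat) : PT n -> PT (fun e => nseq (n e) tt).
Proof.
have hc : PT (fun n : nat => nseq n tt).
  by apply: PT_cast; elim=> //= m IH; rewrite tr_cons IH.
exact: PT_comp hc.
Qed.

Lemma PT_count_units {E : Type} {EE : Enc E} (s : E -> seq unit) : PT s -> PT (fun e => size (s e)).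
Proof.
have hc : PT (fun s : seq unit => size s).
  by apply: PT_cast; elim=> //= x m IH; rewrite tr_cons -IH.
exact: PT_comp hc.
Qed.

Lemma PT_ocase {E A X : Type} {EE : Enc E} {EA : Enc A} {EX : Enc X} (o : E -> option X) (f : E -> A) (g : E -> X -> A) :
  PT o -> PT f -> PT (fun p : E * X => g p.1 p.2) ->
  PT (fun e => if o e is Some x then g e x else f e).
Proof.
move=> ho hf hg.
have hc : PT (fun o : option X => if o is Some x then [:: x] else [::]) by apply: PT_cast => -[].
have h1 : PT (fun p : E * (X * seq X) => (p.1, p.2.1)).
  by apply: PT_pair (PT_fst PT_id) (PT_fst (PT_snd PT_id)).
pose proof (PT_lcase (g := fun e x _ => g e x) (PT_comp hc ho) hf (PT_comp hg h1)) as h2.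
by apply: (PT_ext h2) => e; case: (o e).
Qed.

Lemma PT_rev {E X : Type} {EE : Enc E} {EX : Enc X} (l : E -> seq X) : PT l -> PT (fun e => rev (l e)).
Proof.
move=> hl.
have h : PT (fun e => foldl (fun acc x => x :: acc) [::] (l e)).
  apply: (@PT_foldl_inc _ _ _ _ _ _ (fun _ acc x => x :: acc) (fun=> [::]) l _ _ hl (fun e => (sz (l e)).+1)).
  - have hc : PT (fun p : X * seq X => p.1 :: p.2) by apply: PT_cast => -[].
    apply: (PT_comp hc (f := fun p : E * (seq X * X) => (p.2.2, p.2.1))).
    exact: PT_pair (PT_snd (PT_snd PT_id)) (PT_fst (PT_snd PT_id)).
  - exact: PT_const.
  - by apply: (PB_le (PB_add (PT_size hl) (PB_const 1))) => e; rewrite addn1.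
  - by move=> e x acc hx; rewrite sz_cons; lia.
apply: (PT_ext h) => e; rewrite -[l e in LHS]revK foldl_rev.
by elim: (rev (l e)) => //= x s ->.
Qed.

Lemma PT_foldr_inc {E A X : Type} {EE : Enc E} {EA : Enc A} {EX : Enc X} (h : E -> X -> A -> A) (z : E -> A) (l : E -> seq X) (W : E -> nat) :
  PT (fun p : E * (A * X) => h p.1 p.2.2 p.2.1) -> PT z -> PT l -> PB W ->
  (forall e x acc, sz x <= sz (l e) -> sz (h e x acc) <= sz acc + W e) ->
  PT (fun e => foldr (h e) (z e) (l e)).
Proof.
move=> hh hz hl hW hb.
pose proof (PT_rev hl) as hr.
have H : PT (fun e => foldl (fun a x => h e x a) (z e) (rev (l e))).
  apply: (@PT_foldl_inc _ _ _ _ _ _ (fun e a x => h e x a) z _ hh hz hr W hW).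
  move=> e x acc; have -> : sz (rev (l e)) = sz (l e); last exact: hb.
  elim: (l e) => // y s IH; rewrite rev_cons -cats1 sz_cons.
  by pose proof (sz_cat (rev s) [:: y]) as e1; rewrite sz_cons sz_nil IH in e1; lia.
by apply: (PT_ext H) => e; rewrite foldl_rev.
Qed.


Lemma PT_cat {E X : Type} {EE : Enc E} {EX : Enc X} (f g : E -> seq X) : PT f -> PT g -> PT (fun e => f e ++ g e).
Proof.
move=> hf hg.
have H : PT (fun e => foldr cons (g e) (f e)).
  apply: (PT_foldr_inc (h := fun _ x acc => x :: acc) (W := fun e => (sz (f e)).+1) _ hg hf).
  - apply: PT_cons; first exact: PT_snd (PT_snd PT_id).
    exact: PT_fst (PT_snd PT_id).
  - by apply: (PB_le (PB_add (PT_size hf) (PB_const 1))) => e; rewrite addn1.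
  - by move=> e x acc hx; rewrite sz_cons; lia.
by apply: (PT_ext H) => e; elim: (f e) => //= x s ->.
Qed.

Lemma PT_map {E X Y : Type} {EE : Enc E} {EX : Enc X} {EY : Enc Y} (F : E -> X -> Y) (l : E -> seq X) :
  PT (fun p : E * X => F p.1 p.2) -> PT l -> PT (fun e => [seq F e x | x <- l e]).
Proof.
move=> hF hl; have [a ha] := PT_size hF.
have H : PT (fun e => foldr (fun x acc => F e x :: acc) [::] (l e)).
  apply: (PT_foldr_inc (h := fun e x acc => F e x :: acc) (z := fun=> [::])
     (W := fun e => (sz e + sz (l e) + 3) ^ a + 1) _ (PT_const _) hl).
  - apply: PT_cons; last exact: PT_fst (PT_snd PT_id).
    apply: (PT_comp hF (f := fun p : E * (seq Y * X) => (p.1, p.2.2))).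
    exact: PT_pair (PT_fst PT_id) (PT_snd (PT_snd PT_id)).
  - have hl' := PT_size hl.
    by repeat (apply: PB_add || apply: PB_exp || apply: PB_const || apply: PB_sz || assumption).
  - move=> e x acc hx; rewrite sz_cons; have := ha (e, x); rewrite sz_pair /= => h.
    have h' : ((sz e + sz x).+1 + 2) ^ a <= (sz e + sz (l e) + 3) ^ a.
      by case: (a) => // a'; rewrite leq_exp2r //; lia.
    by lia.
by apply: (PT_ext H) => e; elim: (l e) => //= x s ->.
Qed.

Lemma PT_filter {E X : Type} {EE : Enc E} {EX : Enc X} (p : E -> X -> bool) (l : E -> seq X) :
  PT (fun q : E * X => p q.1 q.2) -> PT l -> PT (fun e => [seq x <- l e | p e x]).
Proof.
move=> hp hl.
have H : PT (fun e => foldr (fun x acc => if p e x then x :: acc else acc) [::] (l e)).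
  apply: (PT_foldr_inc (h := fun e x acc => if p e x then x :: acc else acc) (z := fun=> [::])
     (W := fun e => sz (l e) + 1) _ (PT_const _) hl).
  - apply: PT_if.
    + apply: (PT_comp hp (f := fun p : E * (seq X * X) => (p.1, p.2.2))).
      exact: PT_pair (PT_fst PT_id) (PT_snd (PT_snd PT_id)).
    + by apply: PT_cons; [exact: PT_snd (PT_snd PT_id) | exact: PT_fst (PT_snd PT_id)].
    + exact: PT_fst (PT_snd PT_id).
  - exact: PB_add (PT_size hl) (PB_const _).
  - by move=> e x acc hx; case: ifP => _; rewrite ?sz_cons; lia.
by apply: (PT_ext H) => e; elim: (l e) => //= x s ->.
Qed.

Lemma PT_flatten {E X : Type} {EE : Enc E} {EX : Enc X} (l : E -> seq (seq X)) : PT l -> PT (fun e => flatten (l e)).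
Proof.
move=> hl.
apply: (PT_foldr_inc (h := fun _ x acc => x ++ acc) (z := fun=> [::]) (W := fun e => sz (l e)) _ (PT_const _) hl).
- by apply: PT_cat; [exact: PT_snd (PT_snd PT_id) | exact: PT_fst (PT_snd PT_id)].
- exact: PT_size.
- by move=> e x acc hx; pose proof (sz_cat x acc) as h; lia.
Qed.

Lemma PT_size_seq {E X : Type} {EE : Enc E} {EX : Enc X} (l : E -> seq X) : PT l -> PT (fun e => size (l e)).
Proof.
move=> hl.
pose proof (PT_count_units (PT_map (F := fun _ _ => tt) (PT_const _) hl)) as h.
by apply: (PT_ext h) => e; rewrite size_map.
Qed.

Lemma PT_behead {E X : Type} {EE : Enc E} {EX : Enc X} (l : E -> seq X) : PT l -> PT (fun e => behead (l e)).
Proof.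
move=> hl; pose proof (PT_lcase (g := fun _ _ s => s) hl (PT_const [::]) (PT_snd (PT_snd PT_id))) as h.
by apply: (PT_ext h) => e; case: (l e).
Qed.

Lemma PT_head {E X : Type} {EE : Enc E} {EX : Enc X} (d : E -> X) (l : E -> seq X) : PT d -> PT l -> PT (fun e => head (d e) (l e)).
Proof.
move=> hd hl; pose proof (PT_lcase (g := fun _ x _ => x) hl hd (PT_fst (PT_snd PT_id))) as h.
by apply: (PT_ext h) => e; case: (l e).
Qed.

Lemma PT_nilp {E X : Type} {EE : Enc E} {EX : Enc X} (l : E -> seq X) : PT l -> PT (fun e => nilp (l e)).
Proof.
move=> hl; pose proof (PT_lcase (g := fun _ _ _ => false) hl (PT_const true) (PT_const false)) as h.
by apply: (PT_ext h) => e; case: (l e).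
Qed.

Lemma PT_drop {E X : Type} {EE : Enc E} {EX : Enc X} (n : E -> nat) (l : E -> seq X) : PT n -> PT l -> PT (fun e => drop (n e) (l e)).
Proof.
move=> hn hl.
have H : PT (fun e => foldr (fun (_ : unit) acc => behead acc) (l e) (nseq (n e) tt)).
  apply: (PT_foldr_inc (h := fun _ _ acc => behead acc) (W := fun=> 0) _ hl (PT_units hn)).
  - exact: PT_behead (PT_fst (PT_snd PT_id)).
  - exact: PB_const.
  - by move=> e x [|y s] _ //; rewrite [behead _]/= sz_cons; lia.
by apply: (PT_ext H) => e; elim: (n e) (l e) => [|m IH] s /=; rewrite ?drop0 // IH -drop1 drop_drop add1n.
Qed.

Lemma PT_nth {E X : Type} {EE : Enc E} {EX : Enc X} (d : E -> X) (l : E -> seq X) (n : E -> nat) :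
  PT d -> PT l -> PT n -> PT (fun e => nth (d e) (l e) (n e)).
Proof.
move=> hd hl hn; pose proof (PT_head hd (PT_drop hn hl)) as h.
by apply: (PT_ext h) => e; rewrite -nth0 nth_drop addn0.
Qed.

Lemma PT_has {E X : Type} {EE : Enc E} {EX : Enc X} (p : E -> X -> bool) (l : E -> seq X) :
  PT (fun q : E * X => p q.1 q.2) -> PT l -> PT (fun e => has (p e) (l e)).
Proof.
move=> hp hl; pose proof (PT_negb (PT_nilp (PT_filter hp hl))) as h.
by apply: (PT_ext h) => e; elim: (l e) => //= x s <-; case: (p e x).
Qed.

Lemma PT_addn {E : Type} {EE : Enc E} (f g : E -> nat) : PT f -> PT g -> PT (fun e => f e + g e).
Proof.
move=> hf hg; pose proof (PT_count_units (PT_cat (PT_units hf) (PT_units hg))) as h.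
by apply: (PT_ext h) => e; rewrite size_cat !size_nseq.
Qed.

Lemma PT_leq {E : Type} {EE : Enc E} (f g : E -> nat) : PT f -> PT g -> PT (fun e => f e <= g e).
Proof.
move=> hf hg; pose proof (PT_nilp (PT_drop hg (PT_units hf))) as h.
by apply: (PT_ext h) => e; rewrite /nilp size_drop size_nseq.
Qed.

Lemma PT_eqn {E : Type} {EE : Enc E} (f g : E -> nat) : PT f -> PT g -> PT (fun e => f e == g e).
Proof.
move=> hf hg; pose proof (PT_andb (PT_leq hf hg) (PT_leq hg hf)) as h.
by apply: (PT_ext h) => e; rewrite eqn_leq.
Qed.


Lemma PT_muln {E : Type} {EE : Enc E} (f g : E -> nat) : PT f -> PT g -> PT (fun e => f e * g e).
Proof.
move=> hf hg.
pose proof (PT_count_units (PT_flatten (PT_map (F := fun e (_ : unit) => nseq (g e) tt)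
   (PT_comp (PT_units hg) (PT_fst PT_id)) (PT_units hf)))) as h.
apply: (PT_ext h) => e; rewrite size_flatten /shape -map_comp.
by elim: (f e) => //= n ->; rewrite size_nseq mulSn.
Qed.

Lemma PT_iota {E : Type} {EE : Enc E} (f g : E -> nat) : PT f -> PT g -> PT (fun e => iota (f e) (g e)).
Proof.
move=> hf hg.
pose h (e : E) (acc : nat * seq nat) (_ : unit) := (acc.1.+1, acc.1 :: acc.2).
have it e n : foldl (h e) (f e, [::]) (nseq n tt) = (f e + n, rev (iota (f e) n)).
  elim: n => [|n IH]; first by rewrite addn0.
  rewrite -[n.+1]addn1 nseqD foldl_cat IH /= /h /= iotaD rev_cat addnA addn1 //.
have szi a n : sz (rev (iota a n)) <= n * (2 * (a + n) + 3) + 1.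
  elim: n => [|n IH] //; rewrite -[n.+1]addn1 iotaD rev_cat /=.
  rewrite sz_cons sz_nat; rewrite addn1 mulSn.
  have : n * (2 * (a + n) + 3) <= n * (2 * (a + n.+1) + 3) by rewrite leq_mul2l; lia.
  by lia.
have H : PT (fun e => foldl (h e) (f e, [::]) (nseq (g e) tt)).
  apply: (PT_foldl _ _ (PT_units hg) (W := fun e => sz (f e) * 5 + sz (g e) * 5 + sz (g e) * (2 * (sz (f e) + sz (g e)) + 3) + 4)).
  - apply: PT_pair; first exact: PT_S (PT_fst (PT_fst (PT_snd PT_id))).
    by apply: PT_cons; [exact: PT_fst (PT_fst (PT_snd PT_id)) | exact: PT_snd (PT_fst (PT_snd PT_id))].
  - exact: PT_pair hf (PT_const _).
  - have h1 := PT_size hf; pose proof (PT_size hg) as h2.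
    by repeat (apply: PB_add || apply: PB_mul || apply: PB_const || assumption).
  - move=> e pre suf eq.
    have -> : pre = nseq (size pre) tt by elim: (pre) => //= -[] s {1}->.
    have hs : size pre <= g e by move: (congr1 size eq); rewrite size_nseq size_cat; lia.
    rewrite it sz_pair; pose proof (szi (f e) (size pre)) as hi.
    rewrite !sz_nat.
    have : size pre * (2 * (f e + size pre) + 3) <= (g e).*2.+1 * (2 * ((f e).*2.+1 + (g e).*2.+1) + 3).
      by apply: leq_mul; lia.
    by lia.
apply: (PT_ext (PT_rev (PT_snd H))) => e.
by rewrite it revK.
Qed.

(** The pair of [n./2] and [uphalf n] is updated by a swap and one successor when [n] grows by 1. *)
Lemma PT_half {E : Type} {EE : Enc E} (f : E -> nat) : PT f -> PT (fun e => (f e)./2).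
Proof.
move=> hf.
pose h (e : E) (acc : nat * nat) (_ : unit) := (acc.2, acc.1.+1).
have it e n : foldl (h e) (0, 0) (nseq n tt) = (n./2, uphalf n).
  elim: n => [|n IH] //.
  by rewrite -[n.+1]addn1 nseqD foldl_cat IH /= /h /= addn1 /= uphalfE.
have H : PT (fun e => foldl (h e) (0, 0) (nseq (f e) tt)).
  apply: (PT_foldl_inc _ _ (PT_units hf) (W := fun=> 2)).
  - apply: PT_pair; first exact: (PT_snd (PT_fst (PT_snd PT_id))).
    exact: PT_S (PT_fst (PT_fst (PT_snd PT_id))).
  - exact: PT_const.
  - exact: PB_const.
  - by move=> e x [a b] _; rewrite /h [_.1]/= [_.2]/= !sz_pair !sz_nat; lia.
by apply: (PT_ext (PT_fst H)) => e; rewrite it.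
Qed.

Lemma PT_double {E : Type} {EE : Enc E} (f : E -> nat) : PT f -> PT (fun e => (f e).*2).
Proof.
by move=> hf; apply: (PT_ext (PT_addn hf hf)) => e; rewrite addnn.
Qed.

Lemma PT_odd {E : Type} {EE : Enc E} (f : E -> nat) : PT f -> PT (fun e => odd (f e)).
Proof.
move=> hf; pose proof (PT_negb (PT_eqn (PT_double (PT_half hf)) hf)) as h.
apply: (PT_ext h) => e; have := odd_double_half (f e); case: (odd _) => /=; lia.
Qed.

Lemma PT_nseq {E X : Type} {EE : Enc E} {EX : Enc X} (f : E -> nat) (g : E -> X) : PT f -> PT g -> PT (fun e => nseq (f e) (g e)).
Proof.
move=> hf hg; pose proof (PT_map (F := fun e (_ : unit) => g e) (PT_comp hg (PT_fst PT_id)) (PT_units hf)) as h.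
by apply: (PT_ext h) => e; elim: (f e) => //= n ->.
Qed.

Definition PTeq (T : eqType) {ET : Enc T} := PT (fun p : T * T => p.1 == p.2).
Arguments PTeq T {ET}.

Lemma PT_eq (E : Type) {EE : Enc E} (T : eqType) {ET : Enc T} (f g : E -> T) :
  PTeq T -> PT f -> PT g -> PT (fun e => f e == g e).
Proof. by move=> h hf hg; apply: (PT_comp h (PT_pair hf hg)). Qed.

Lemma PTeq_nat : PTeq nat.
Proof. exact: PT_eqn (PT_fst PT_id) (PT_snd PT_id). Qed.

Lemma PTeq_pair (T1 T2 : eqType) {E1 : Enc T1} {E2 : Enc T2} :
  PTeq T1 -> PTeq T2 -> PTeq (T1 * T2)%type.
Proof.
move=> h1 h2.
have h : PT (fun p : (T1 * T2) * (T1 * T2) => (p.1.1 == p.2.1) && (p.1.2 == p.2.2)).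
  apply: PT_andb; apply: PT_eq => //.
  - exact: PT_fst (PT_fst PT_id).
  - exact: PT_fst (PT_snd PT_id).
  - exact: PT_snd (PT_fst PT_id).
  - exact: PT_snd (PT_snd PT_id).
by apply: (PT_ext h) => -[[a b] [c d]]; rewrite xpair_eqE.
Qed.

Lemma PT_mem (E : Type) {EE : Enc E} (T : eqType) {ET : Enc T} (f : E -> T) (l : E -> seq T) :
  PTeq T -> PT f -> PT l -> PT (fun e => f e \in l e).
Proof.
move=> h hf hl.
have H : PT (fun e => has (fun x => f e == x) (l e)).
  apply: PT_has hl; apply: PT_eq h _ (PT_snd PT_id).
  exact: PT_comp hf (PT_fst PT_id).
apply: (PT_ext H) => e; rewrite -has_pred1; apply: eq_has => x /=; exact: eq_sym.
Qed.

Lemma PT_undup (E : Type) {EE : Enc E} (T : eqType) {ET : Enc T} (l : E -> seq T) :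
  PTeq T -> PT l -> PT (fun e => undup (l e)).
Proof.
move=> h hl.
have H : PT (fun e => foldr (fun x (acc : seq T) => if x \in acc then acc else x :: acc) [::] (l e)).
  apply: (PT_foldr_inc (h := fun _ x (acc : seq T) => if x \in acc then acc else x :: acc) (z := fun=> [::])
     (W := fun e => sz (l e) + 1) _ (PT_const _) hl).
  - apply: PT_if; first apply: PT_mem h _ _.
    + exact: PT_snd (PT_snd PT_id).
    + exact: PT_fst (PT_snd PT_id).
    + exact: PT_fst (PT_snd PT_id).
    + by apply: PT_cons; [exact: PT_snd (PT_snd PT_id) | exact: PT_fst (PT_snd PT_id)].
  - exact: PB_add (PT_size hl) (PB_const _).
  - by move=> e x acc hx; case: ifP => _; rewrite ?sz_cons; lia.
apply: (PT_ext H) => e; elim: (l e) => //= x s ->.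
by rewrite mem_undup.
Qed.

(** A hook that is redefined below, whenever lemmas about further functions become available to
    [pt]. *)
Ltac pt_ext := fail.
Ltac pt1 := cbv beta zeta; first [ assumption | lazymatch goal with
  | |- PT (fun e => e) => apply PT_id
  | |- PT (fun _ => ?c) => apply PT_const
  | |- PT (@fst _ _) => apply PT_fst0
  | |- PT (@snd _ _) => apply PT_snd0
  | |- PT (fun e => fst (@?f e)) => apply (PT_fst (f := f))
  | |- PT (fun e => snd (@?f e)) => apply (PT_snd (f := f))
  | |- PT (fun e => pair (@?f e) (@?g e)) => apply (PT_pair (f := f) (g := g))
  | |- PT (fun e => S (@?f e)) => apply (PT_S (f := f))
  | |- PT (fun e => cons (@?f e) (@?g e)) => apply (PT_cons (f := f) (g := g))
  | |- PT (fun e => Some (@?f e)) => apply (PT_Some (f := f))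
  | |- PT (fun e => negb (@?f e)) => apply (PT_negb (f := f))
  | |- PT (fun e => andb (@?f e) (@?g e)) => apply (PT_andb (f := f) (g := g))
  | |- PT (fun e => orb (@?f e) (@?g e)) => apply (PT_orb (f := f) (g := g))
  | |- PT (fun e => cat (@?f e) (@?g e)) => apply (PT_cat (f := f) (g := g))
  | |- PT (fun e => flatten (@?f e)) => apply (PT_flatten (l := f))
  | |- PT (fun e => size (@?f e)) => apply (PT_size_seq (l := f))
  | |- PT (fun e => behead (@?f e)) => apply (PT_behead (l := f))
  | |- PT (fun e => nilp (@?f e)) => apply (PT_nilp (l := f))
  | |- PT (fun e => head (@?d e) (@?f e)) => apply (PT_head (d := d) (l := f))
  | |- PT (fun e => nth (@?d e) (@?f e) (@?n e)) => apply (PT_nth (d := d) (l := f) (n := n))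
  | |- PT (fun e => map (@?F e) (@?l e)) => apply (PT_map (F := F) (l := l))
  | |- PT (fun e => filter (@?F e) (@?l e)) => apply (PT_filter (p := F) (l := l))
  | |- PT (fun e => has (@?F e) (@?l e)) => apply (PT_has (p := F) (l := l))
  | |- PT (fun e => addn (@?f e) (@?g e)) => apply (PT_addn (f := f) (g := g))
  | |- PT (fun e => muln (@?f e) (@?g e)) => apply (PT_muln (f := f) (g := g))
  | |- PT (fun e => leq (@?f e) (@?g e)) => apply (PT_leq (f := f) (g := g))
  | |- PT (fun e => iota (@?f e) (@?g e)) => apply (PT_iota (f := f) (g := g))
  | |- PT (fun e => half (@?f e)) => apply (PT_half (f := f))
  | |- PT (fun e => odd (@?f e)) => apply (PT_odd (f := f))
  | |- PT (fun e => nseq (@?f e) (@?g e)) => apply (PT_nseq (f := f) (g := g))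
  | |- PT (fun e => undup (@?f e)) => apply (PT_undup (l := f))
  | |- PT (fun e => @eq_op ?T (@?f e) (@?g e)) => apply (PT_eq (T := T) (f := f) (g := g))
  | |- PT (fun e => @in_mem ?T (@?f e) (mem (@?g e))) => apply (PT_mem (f := f) (l := g))
  | |- PTeq _ => first [exact PTeq_nat | apply PTeq_pair]
  end | pt_ext
  | match goal with H : PT ?F |- PT (fun e => ?F (@?g e)) => apply (PT_comp (f := g) H) end
  | apply PT_if ].
Ltac pt := repeat pt1.

(** * Simulating a given Turing machine in polynomial time *)

Definition sym_code (x : sym) : nat := match x with B0 => 0 | B1 => 1 | Blank => 2 end.
Definition sym_decode (n : nat) : sym := match n with 0 => B0 | 1 => B1 | _ => Blank end.
Definition move_code (m : move) : nat := match m with MvL => 0 | MvR => 1 | MvS => 2 end.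

#[export] Instance enc_sym : Enc sym := fun x => tr (sym_code x).
#[export] Instance enc_move : Enc move := fun x => tr (move_code x).
#[export] Instance enc_ord n : Enc 'I_n := fun i => tr (nat_of_ord i).
#[export] Instance enc_config M : Enc (config M) :=
  fun c => tr (c_state c, (c_left c, (c_head c, c_right c))).

Section Simulation.
Variable M : TM.

(** The transition function becomes a constant list, so that applying it is a lookup by [nth]; state
    [q] and letter [x] sit at position [3 q + sym_code x]. *)
Definition delta_table : seq (option ('I_(tm_q M) * sym * move)) :=
  [seq (if insub (i %/ 3) is Some q then tm_delta q (sym_decode (i %% 3)) else None)
  | i <- iota 0 (3 * tm_q M)].
Definition accept_table : seq bool :=
  [seq (if insub i is Some q then tm_accept (q : 'I_(tm_q M)) else false) | i <- iota 0 (tm_q M)].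

Lemma delta_tableE (q : 'I_(tm_q M)) x :
  nth None delta_table (nat_of_ord q * 3 + sym_code x) = tm_delta q x.
Proof.
have hx : sym_code x < 3 by case: x.
have hq := ltn_ord q.
rewrite (nth_map 0) ?size_iota; last by lia.
rewrite nth_iota ?add0n; last by lia.
rewrite divnMDl // divn_small // addn0 modnMDl modn_small // valK.
by case: x {hx}.
Qed.

Lemma accept_tableE (q : 'I_(tm_q M)) : nth false accept_table q = tm_accept q.
Proof. by rewrite (nth_map 0) ?size_iota // nth_iota // add0n valK. Qed.

Definition adv (c : config M) : config M := odflt c (step c).
Definition simulate (n : nat) (w : seq bool) : option bool :=
  let c := iter n adv (init M w) in
  if step c is None then Some (tm_accept (c_state c)) else None.

Lemma simulate_run n w : forall b, simulate n w = Some b ->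
  exists2 c, run n (init M w) = Some c & tm_accept (c_state c) = b.
Proof.
rewrite /simulate => b; case E: (step _) => // -[<-].
exists (iter n adv (init M w)) => //.
elim: n (init M w) E => [|n IH] c E; first by rewrite /= in E *; rewrite E.
rewrite iterSr in E *; rewrite /=; case E1 : (step c) => [c'|].
  have ea : adv c = c' by rewrite /adv E1.
  by rewrite ea in E *; apply: IH.
have ea : adv c = c by rewrite /adv E1.
by rewrite ea iter_fix.
Qed.

Lemma run_simulate n n' w c : run n (init M w) = Some c -> n <= n' ->
  simulate n' w = Some (tm_accept (c_state c)).
Proof.
rewrite /simulate; move: (init M w) => c0 hr hn.
suff [e1 e2] : iter n' adv c0 = c /\ step c = None by rewrite e1 e2.
elim: n n' c0 hn hr => [|n IH] n' c0 hn /=.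
  case E : (step c0) => // -[<-]; split=> //.
  by apply: iter_fix; rewrite /adv E.
case E : (step c0) => [c'|]; last first.
  by move=> [<-]; split=> //; apply: iter_fix; rewrite /adv E.
case: n' hn => // n' hn h; rewrite iterSr [adv c0](_ : _ = c') /adv ?E //; exact: IH.
Qed.

Lemma PT_config_fields :
  PT (fun c : config M => (nat_of_ord (c_state c), (c_left c, (c_head c, c_right c)))).
Proof. exact: PT_cast. Qed.

Lemma PT_config_mk : PT (fun p : 'I_(tm_q M) * (seq sym * (sym * seq sym)) =>
  Config p.1 p.2.1 p.2.2.1 p.2.2.2 : config M).
Proof. by apply: PT_cast => -[q [l [h r]]]. Qed.

Lemma PT_step E {EE : Enc E} (f : E -> config M) :
  PT f -> PT (fun e => step (f e)).
Proof.
move=> hf; have h : PT (fun c : config M => step c); last exact: (PT_comp h hf).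
have hst := PT_fst PT_config_fields.
have hl := PT_fst (PT_snd PT_config_fields).
have hh := PT_fst (PT_snd (PT_snd PT_config_fields)).
have hr := PT_snd (PT_snd (PT_snd PT_config_fields)).
have hcode : PT (fun x : sym => sym_code x) by exact: PT_cast.
have hmv : PT (fun x : move => move_code x) by exact: PT_cast.
have hdelta : PT (fun c : config M => tm_delta (c_state c) (c_head c)).
  have h : PT (fun c : config M => nth None delta_table (nat_of_ord (c_state c) * 3 + sym_code (c_head c))).
    by pt; exact: (PT_comp hcode hh).
  by apply: (PT_ext h) => c; rewrite delta_tableE.
pose nxt (c : config M) (y : 'I_(tm_q M) * sym * move) : 'I_(tm_q M) * (seq sym * (sym * seq sym)) :=
  if move_code y.2 == 0 then (y.1.1, (behead (c_left c), (head Blank (c_left c), y.1.2 :: c_right c)))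
  else if move_code y.2 == 1 then (y.1.1, (y.1.2 :: c_left c, (head Blank (c_right c), behead (c_right c))))
  else (y.1.1, (c_left c, (y.1.2, c_right c))).
have hn : PT (fun p : config M * ('I_(tm_q M) * sym * move) => nxt p.1 p.2).
  have hl' : PT (fun p : config M * ('I_(tm_q M) * sym * move) => c_left p.1) by exact: (PT_comp hl (PT_fst PT_id)).
  have hr' : PT (fun p : config M * ('I_(tm_q M) * sym * move) => c_right p.1) by exact: (PT_comp hr (PT_fst PT_id)).
  have hm' : PT (fun p : config M * ('I_(tm_q M) * sym * move) => move_code p.2.2) by exact: (PT_comp hmv (PT_snd (PT_snd PT_id))).
  by rewrite /nxt; pt.
have h := PT_ocase (g := fun c y => Some (Config (nxt c y).1 (nxt c y).2.1 (nxt c y).2.2.1 (nxt c y).2.2.2))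
   hdelta (PT_const None) (PT_Some (PT_comp PT_config_mk hn)).
apply: (PT_ext h) => c; rewrite /step; case: (tm_delta _ _) => // -[[q w] []] //=.
  by case: (c_left c).
by case: (c_right c).
Qed.
End Simulation.

Lemma PT_iter (E A : Type) {EE : Enc E} {EA : Enc A} (h : E -> A -> A) (z : E -> A)
    (n : E -> nat) (W : E -> nat) :
  PT (fun p : E * A => h p.1 p.2) -> PT z -> PT n -> PB W ->
  (forall e j, j <= n e -> sz (iter j (h e) (z e)) <= W e) ->
  PT (fun e => iter (n e) (h e) (z e)).
Proof.
move=> hh hz hn hW hb.
have fe e m a : foldl (fun a (_ : unit) => h e a) a (nseq m tt) = iter m (h e) a.
  by elim: m a => //= m IH a; rewrite IH -iterS iterSr.
have H : PT (fun e => foldl (fun a (_ : unit) => h e a) (z e) (nseq (n e) tt)).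
  apply: (PT_foldl (h := fun e a (_ : unit) => h e a) _ hz (PT_units hn) hW).
    apply: (PT_comp hh (f := fun p : E * (A * unit) => (p.1, p.2.1))).
    by pt.
  move=> e pre suf eq.
  have -> : pre = nseq (size pre) tt by elim: (pre) => //= -[] s {1}->.
  rewrite fe; apply: hb.
  by move: (congr1 size eq); rewrite size_nseq size_cat; lia.
by apply: (PT_ext H) => e.
Qed.

Lemma sz_sym (x : sym) : sz x <= 5.
Proof. by case: x. Qed.
Lemma sz_ord n (i : 'I_n) : sz i <= 2 * n + 1.
Proof. by rewrite (_ : sz i = sz (nat_of_ord i)) // sz_nat; have := ltn_ord i; lia. Qed.
Lemma sz_config M (c : config M) :
  sz c = sz (c_state c) + sz (c_left c) + sz (c_head c) + sz (c_right c) + 3.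
Proof.
rewrite (_ : sz c = sz (c_state c, (c_left c, (c_head c, c_right c)))) // !sz_pair; lia.
Qed.

Lemma sz_adv M (c : config M) : sz (adv c) <= sz c + (2 * tm_q M + 20).
Proof.
rewrite /adv /step; case: (tm_delta _ _) => [[[q w] mv]|] /=; last by rewrite leq_addr.
pose proof (sz_ord q) as hq; pose proof (sz_sym w) as hw.
pose proof (sz_sym (c_head c)) as hh.
case: mv => /=; rewrite !sz_config /=.
- case: (c_left c) => [|x l] /=; rewrite ?sz_cons ?sz_nil /=; first by pose proof (sz_sym Blank); lia.
  by pose proof (sz_sym x); lia.
- case: (c_right c) => [|x l] /=; rewrite ?sz_cons ?sz_nil /=; first by pose proof (sz_sym Blank); lia.
  by pose proof (sz_sym x); lia.
- by lia.
Qed.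

Lemma PT_simulate (M : TM) E {EE : Enc E} (n : E -> nat) (w : E -> seq bool) :
  PT n -> PT w -> PT (fun e => simulate M (n e) (w e)).
Proof.
move=> hn hw.
have hsym : PT (fun b : bool => sym_of_bool b).
  by apply: (PT_ext (PT_if PT_id (PT_const B1) (PT_const B0))) => -[].
have hi : PT (fun e => init M (w e)).
  pose s e := map sym_of_bool (w e).
  have hs : PT s by rewrite /s; pt.
  have h : PT (fun e => (tm_start M, ([::] : seq sym, (head Blank (s e), behead (s e))))) by pt.
  by apply: (PT_ext (PT_comp (PT_config_mk M) h)) => e; rewrite /init /s; case: (w e).
have hc : PT (fun e => iter (n e) (@adv M) (init M (w e))).
  apply: (PT_iter (h := fun _ => @adv M) (W := fun e => sz (init M (w e)) + sz (n e) * (2 * tm_q M + 20))) => //.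
  - pose proof (PT_ocase (g := fun _ c => c) (PT_step (M := M) (PT_snd (PT_id (A := E * config M)))) (PT_snd PT_id) (PT_snd PT_id)) as h.
    by apply: (PT_ext h) => -[e c]; rewrite /adv /=; case: (step c).
  - pose proof (PT_size hi) as h1; pose proof (PT_size hn) as h2.
    by repeat (apply: PB_add || apply: PB_mul || apply: PB_const || assumption).
  - move=> e j hj; apply: (@leq_trans (sz (init M (w e)) + j * (2 * tm_q M + 20))).
      by elim: j {hj} => [|j IH] /=; [rewrite addn0 | have := sz_adv (iter j (@adv M) (init M (w e))); lia].
    by rewrite leq_add2l leq_mul2r sz_nat; lia.
have hst := PT_fst (PT_config_fields M).
pose proof (PT_ocase (g := fun _ _ => None) (PT_step hc)
  (f := fun e => Some (nth false (accept_table M) (nat_of_ord (c_state (iter (n e) (@adv M) (init M (w e)))))))) as h.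
have {}h := h (PT_Some (PT_nth (PT_const _) (PT_const _) (PT_comp hst hc))) (PT_const _).
by apply: (PT_ext h) => e; rewrite /simulate accept_tableE; case: (step _).
Qed.

(* Literals are coded as in [enc_lit]: variable [v] by [2 * v], with 1 added if positive. *)
Definition lit3 := (nat * nat * nat)%type.

(** * The search algorithm: normalisation, branching, reduction, rounds *)

Section Normalise.
Variable N : nat.

(* Padding with both signs of a fresh variable makes the three literals of a clause distinct
   without changing its truth value under any assignment. *)
Definition strict_clause (c : lit3) : seq lit3 :=
  let y0 := 2 * N in let y1 := 2 * N + 1 in let z0 := 2 * N + 2 in let z1 := 2 * N + 3 in
  let a := c.1.1 in let b := c.1.2 in let e := c.2 in
  if a == b then
    if b == e then [:: (a, y0, z0); (a, y0, z1); (a, y1, z0); (a, y1, z1)]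
    else [:: (a, e, z0); (a, e, z1)]
  else if (a == e) || (b == e) then [:: (a, b, z0); (a, b, z1)]
  else [:: (a, b, e)].
End Normalise.

Definition perms3 (c : lit3) : seq lit3 :=
  let a := c.1.1 in let b := c.1.2 in let e := c.2 in
  [:: (a, b, e); (a, e, b); (b, a, e); (b, e, a); (e, a, b); (e, b, a)].

(* Unit, binary and ternary clauses; the last two lists are closed under permutations of the
   literals, so that a common subclause always sits in front. *)
Definition form := (seq nat * (seq (nat * nat) * seq lit3))%type.

Definition init_form (N : nat) (cs : seq lit3) : form :=
  ([::], ([::], undup (flatten [seq perms3 c | c <- flatten [seq strict_clause N c | c <- cs]]))).

(** Only clauses subsumed by a present unit or pair disappear, so the result is equivalent to the
    conjunction. In use, [P1] is closed under swapping, so each of the three pairs of a clause is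
    looked up in one order only. *)
Definition add_clauses (U : seq nat) (P : seq (nat * nat)) (F : form) : form :=
  let U1 := U ++ F.1 in let P1 := P ++ F.2.1 in
  (U1, ([seq p <- P1 | (p.1 \notin U1) && (p.2 \notin U1)],
        [seq c <- F.2.2 | (((c.1.1 \notin U1) && (c.1.2 \notin U1)) && (c.2 \notin U1)) &&
                         ((((c.1.1, c.1.2) \notin P1) && ((c.1.1, c.2) \notin P1)) &&
                          ((c.1.2, c.2) \notin P1))])).

(** Sunflowers: the heart is a subclause common to many clauses of the same width, the petals are
    what these clauses have besides it. *)
Definition petals2 (F : form) (a : nat) : seq nat := [seq p.2 | p <- [seq p <- F.2.1 | p.1 == a]].
Definition petals3 (F : form) (ab : nat * nat) : seq nat :=
  [seq c.2 | c <- [seq c <- F.2.2 | c.1 == ab]].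
Definition petals32 (F : form) (a : nat) : seq (nat * nat) :=
  [seq (c.1.2, c.2) | c <- [seq c <- F.2.2 | c.1.1 == a]].

Definition hearts2 (L : nat) (F : form) : seq nat :=
  [seq a <- [seq p.1 | p <- F.2.1] | L <= size (petals2 F a)].
Definition hearts3 (L : nat) (F : form) : seq (nat * nat) :=
  [seq ab <- [seq c.1 | c <- F.2.2] | L <= size (petals3 F ab)].
Definition hearts32 (L : nat) (F : form) : seq nat :=
  [seq a <- [seq c.1.1 | c <- F.2.2] | 2 * L * L <= size (petals32 F a)].

Definition branch (L : nat) (F : form) : option (form * form) :=
  if hearts2 L F is a :: _ then
    Some (add_clauses [:: a] [::] F, add_clauses (petals2 F a) [::] F)
  else if hearts3 L F is ab :: _ then
    Some (add_clauses [::] [:: ab; (ab.2, ab.1)] F, add_clauses (petals3 F ab) [::] F)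
  else if hearts32 L F is a :: _ then
    Some (add_clauses [:: a] [::] F, add_clauses [::] (petals32 F a) F)
  else None.

Definition leaf_clauses (F : form) : seq lit3 :=
  [seq (a, a, a) | a <- F.1] ++ ([seq (p.1, p.2, p.2) | p <- F.2.1] ++ F.2.2).

(* The reduction to vertex cover: with [n] literal occurrences, [j], [n + j] and [2 * n + j]
   are the true-vertex, the false-vertex and the clause-vertex of occurrence [j].
   [okey] sorts the occurrences by literal, so the negative occurrences of a variable come
   before the positive ones. Joining the false-vertex of each to the true-vertex of its
   predecessor propagates "true" downwards; this already excludes a true positive occurrence
   together with a true negative one, and costs each vertex a single edge. *)
Definition occs (cs : seq lit3) : seq nat := flatten [seq [:: c.1.1; c.1.2; c.2] | c <- cs].
Definition okey (o : seq nat) (j : nat) : nat := nth 0 o j * size o + j.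
Definition osucc (o : seq nat) (j i : nat) : bool :=
  ((nth 0 o i)./2 == (nth 0 o j)./2) &&
  ((okey o j < okey o i) &&
   ~~ has (fun k => (okey o j < okey o k) && (okey o k < okey o i)) (iota 0 (size o))).
Definition ochain (o : seq nat) (j : nat) : seq (nat * nat) :=
  if [seq i <- iota 0 (size o) | osucc o j i] is i :: _ then [:: (size o + i, j)] else [::].
Definition oedges (o : seq nat) (j : nat) : seq (nat * nat) :=
  (j, size o + j) ::
  (2 * size o + j, if odd (nth 0 o j) then j else size o + j) :: ochain o j.
Definition triangle (n i : nat) : seq (nat * nat) :=
  let a := 2 * n + 3 * i in [:: (a, a + 1); (a, a + 2); (a + 1, a + 2)].
Definition base_edges (cs : seq lit3) : seq (nat * nat) :=
  let o := occs cs in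
  flatten [seq oedges o j | j <- iota 0 (size o)] ++
  flatten [seq triangle (size o) i | i <- iota 0 (size cs)].

(** The edge becomes a path through the [2 t] new vertices [o], ..., [o + 2 t - 1]. Both end edges
    list the old vertex first, because old vertices have the smaller numbers. *)
Definition subpath (t o : nat) (e : nat * nat) : seq (nat * nat) :=
  (e.1, o) :: (e.2, o + (2 * t - 1)) :: [seq (o + i, o + i + 1) | i <- iota 0 (2 * t - 1)].
Definition subdivide (t nv : nat) (E0 : seq (nat * nat)) : seq (nat * nat) :=
  flatten [seq subpath t (nv + x * (2 * t)) (nth (0, 0) E0 x) | x <- iota 0 (size E0)].

(** The budget per clause is 5: one vertex for each of its three occurrences and two for its
    triangle. Each subdivided edge adds [t]. *)
Definition vc_of (t : nat) (cs : seq lit3) : VCInst :=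
  let nv := 3 * size (occs cs) in
  let E0 := base_edges cs in
  MkVC (nv + size E0 * (2 * t)) (subdivide t nv E0) (5 * size cs + t * size E0).

Definition search_state := (seq form * nat)%type.

(* Second component: 0 = undecided, 1 = satisfiable, 2 = out of time. *)
Definition search_step (M : TM) (t B L : nat) (s : search_state) : search_state :=
  if s.1 is F :: fs then
    if branch L F is Some FF then (FF.1 :: FF.2 :: fs, s.2)
    else if simulate M B (enc_vc (vc_of t (leaf_clauses F))) is Some b then
      if b then ([::], 1) else (fs, s.2)
    else ([::], 2)
  else s.

Definition search (M : TM) (t B : nat) (F : form) (L : nat) : search_state :=
  iter B (search_step M t B L) ([:: F], 0).

(** Searches with open formulas left or with flag 2 are discarded. A completed search is right for
    every threshold, so the first completed one may answer. *)
Definition stage (M : TM) (t B : nat) (F : form) : option bool :=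
  if [seq s <- [seq search M t B F L | L <- iota 1 B] | nilp s.1 && (s.2 != 2)] is s :: _
  then Some (s.2 == 1) else None.

(** Read from the right, [false] ends the code of a number and so opens a new one with value 0; each
    [true] in front of it adds 1. *)
Definition parse_nats (w : seq bool) : seq nat :=
  foldr (fun b acc => if b then (head 0 acc).+1 :: behead acc else 0 :: acc) [::] w.
Definition parse (w : seq bool) : nat * seq lit3 :=
  let s := parse_nats w in let l := behead s in
  (head 0 s, [seq (nth 0 l (3 * i), nth 0 l (3 * i + 1), nth 0 l (3 * i + 2)) |
              i <- [seq i <- iota 0 (size l) | 3 * i + 2 < size l]]).

(** * The components of the search run in polynomial time *)

Section PolyTimeReduction.
Context {E : Type} {EE : Enc E}.

Lemma PT_strict_clause (N : E -> nat) (c : E -> lit3) :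
  PT N -> PT c -> PT (fun e => strict_clause (N e) (c e)).
Proof. by move=> hN hc; rewrite /strict_clause; pt. Qed.

Lemma PT_perms3 (c : E -> lit3) : PT c -> PT (fun e => perms3 (c e)).
Proof. by move=> hc; rewrite /perms3; pt. Qed.

Lemma PT_petals2 (F : E -> form) (a : E -> nat) :
  PT F -> PT a -> PT (fun e => petals2 (F e) (a e)).
Proof. by move=> hF ha; rewrite /petals2; pt. Qed.
Lemma PT_petals3 (F : E -> form) (a : E -> nat * nat) :
  PT F -> PT a -> PT (fun e => petals3 (F e) (a e)).
Proof. by move=> hF ha; rewrite /petals3; pt. Qed.
Lemma PT_petals32 (F : E -> form) (a : E -> nat) :
  PT F -> PT a -> PT (fun e => petals32 (F e) (a e)).
Proof. by move=> hF ha; rewrite /petals32; pt. Qed.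
Lemma PT_add_clauses (U : E -> seq nat) (P : E -> seq (nat * nat)) (F : E -> form) :
  PT U -> PT P -> PT F -> PT (fun e => add_clauses (U e) (P e) (F e)).
Proof. by move=> hU hP hF; rewrite /add_clauses; pt. Qed.
Lemma PT_leaf_clauses (F : E -> form) : PT F -> PT (fun e => leaf_clauses (F e)).
Proof. by move=> hF; rewrite /leaf_clauses; pt. Qed.
Lemma PT_occs (c : E -> seq lit3) : PT c -> PT (fun e => occs (c e)).
Proof. by move=> hc; rewrite /occs; pt. Qed.
Lemma PT_okey (o : E -> seq nat) (j : E -> nat) : PT o -> PT j -> PT (fun e => okey (o e) (j e)).
Proof. by move=> ho hj; rewrite /okey; pt. Qed.
Lemma PT_triangle (n i : E -> nat) : PT n -> PT i -> PT (fun e => triangle (n e) (i e)).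
Proof. by move=> hn hi; rewrite /triangle; pt. Qed.
Lemma PT_subpath (t : nat) (o : E -> nat) (e0 : E -> nat * nat) :
  PT o -> PT e0 -> PT (fun e => subpath t (o e) (e0 e)).
Proof. by move=> ho he; rewrite /subpath; pt. Qed.
End PolyTimeReduction.

Ltac pt_red := lazymatch goal with
  | |- PT (fun e => strict_clause (@?f e) (@?g e)) => apply (PT_strict_clause (N := f) (c := g))
  | |- PT (fun e => perms3 (@?f e)) => apply (PT_perms3 (c := f))
  | |- PT (fun e => petals2 (@?f e) (@?g e)) => apply (PT_petals2 (F := f) (a := g))
  | |- PT (fun e => petals3 (@?f e) (@?g e)) => apply (PT_petals3 (F := f) (a := g))
  | |- PT (fun e => petals32 (@?f e) (@?g e)) => apply (PT_petals32 (F := f) (a := g))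
  | |- PT (fun e => add_clauses (@?f e) (@?g e) (@?h e)) => apply (PT_add_clauses (U := f) (P := g) (F := h))
  | |- PT (fun e => leaf_clauses (@?f e)) => apply (PT_leaf_clauses (F := f))
  | |- PT (fun e => occs (@?f e)) => apply (PT_occs (c := f))
  | |- PT (fun e => okey (@?f e) (@?g e)) => apply (PT_okey (o := f) (j := g))
  | |- PT (fun e => triangle (@?f e) (@?g e)) => apply (PT_triangle (n := f) (i := g))
  | |- PT (fun e => subpath ?t (@?f e) (@?g e)) => apply (PT_subpath t (o := f) (e0 := g))
  end.
Ltac pt_ext ::= pt_red.

Section PolyTimeReduction2.
Context {E : Type} {EE : Enc E}.

Lemma PT_init_form (N : E -> nat) (cs : E -> seq lit3) :
  PT N -> PT cs -> PT (fun e => init_form (N e) (cs e)).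
Proof. by move=> hN hc; rewrite /init_form; pt. Qed.

Lemma PT_osucc (o : E -> seq nat) (j i : E -> nat) :
  PT o -> PT j -> PT i -> PT (fun e => osucc (o e) (j e) (i e)).
Proof. by move=> ho hj hi; rewrite /osucc; pt. Qed.
Lemma PT_branch (L : E -> nat) (F : E -> form) :
  PT L -> PT F -> PT (fun e => branch (L e) (F e)).
Proof.
move=> hL hF; rewrite /branch.
apply: (PT_lcase (l := fun e => hearts2 (L e) (F e)) (g := fun e a _ =>
  Some (add_clauses [:: a] [::] (F e), add_clauses (petals2 (F e) a) [::] (F e)))).
- by rewrite /hearts2; pt.
- apply: (PT_lcase (l := fun e => hearts3 (L e) (F e)) (g := fun e ab _ =>
    Some (add_clauses [::] [:: ab; (ab.2, ab.1)] (F e), add_clauses (petals3 (F e) ab) [::] (F e)))).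
  + by rewrite /hearts3; pt.
  + apply: (PT_lcase (l := fun e => hearts32 (L e) (F e)) (g := fun e a _ =>
      Some (add_clauses [:: a] [::] (F e), add_clauses [::] (petals32 (F e) a) (F e)))).
    * by rewrite /hearts32; pt.
    * exact: PT_const.
    * by pt.
  + by pt.
- by pt.
Qed.
End PolyTimeReduction2.

Section PolyTimeReduction3.
Context {E : Type} {EE : Enc E}.

Lemma PT_ochain (o : E -> seq nat) (j : E -> nat) : PT o -> PT j -> PT (fun e => ochain (o e) (j e)).
Proof.
move=> ho hj; rewrite /ochain.
apply: (PT_lcase (l := fun e => [seq i <- iota 0 (size (o e)) | osucc (o e) (j e) i])
   (g := fun e i _ => [:: (size (o e) + i, j e)])).
- apply: (PT_filter (p := fun e i => osucc (o e) (j e) i)); last by pt.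
  by apply: PT_osucc; pt.
- exact: PT_const.
- by pt.
Qed.
End PolyTimeReduction3.

Section PolyTimeReduction4.
Context {E : Type} {EE : Enc E}.

Lemma PT_oedges (o : E -> seq nat) (j : E -> nat) : PT o -> PT j -> PT (fun e => oedges (o e) (j e)).
Proof.
move=> ho hj; rewrite /oedges.
by pt; apply: PT_ochain.
Qed.
End PolyTimeReduction4.

Section PolyTimeReduction5.
Context {E : Type} {EE : Enc E}.

Lemma PT_base_edges (cs : E -> seq lit3) : PT cs -> PT (fun e => base_edges (cs e)).
Proof.
move=> hc; rewrite /base_edges; pt.
by apply: PT_oedges; pt.
Qed.

Lemma PT_enc_nats (s : E -> seq nat) : PT s -> PT (fun e => enc_nats (s e)).
Proof.
move=> hs; have h : PT (fun e => flatten [seq nseq n true ++ [:: false] | n <- s e]) by pt.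
apply: (PT_ext h) => e; congr flatten; apply: eq_map => n.
by rewrite /enc_nat cats1.
Qed.
End PolyTimeReduction5.

Ltac pt_ext ::= first [ pt_red | lazymatch goal with
  | |- PT (fun e => base_edges (@?f e)) => apply (PT_base_edges (cs := f))
  end ].

Lemma PT_enc_vc E {EE : Enc E} (t : nat) (cs : E -> seq lit3) :
  PT cs -> PT (fun e => enc_vc (vc_of t (cs e))).
Proof.
move=> hc; rewrite /enc_vc /vc_of /= /subdivide.
by apply: PT_enc_nats; pt.
Qed.

Lemma PT_search_step (M : TM) (t : nat) E {EE : Enc E} (B L : E -> nat) (s : E -> search_state) :
  PT B -> PT L -> PT s -> PT (fun e => search_step M t (B e) (L e) (s e)).
Proof.
move=> hB hL hs; rewrite /search_step.
apply: (PT_lcase (l := fun e => (s e).1) (g := fun e F fs =>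
  if branch (L e) F is Some FF then (FF.1 :: FF.2 :: fs, (s e).2)
  else if simulate M (B e) (enc_vc (vc_of t (leaf_clauses F))) is Some b then
      if b then ([::], 1) else (fs, (s e).2)
    else ([::], 2))); [by pt | by [] | ].
apply: (PT_ocase (o := fun p : E * (form * seq form) => branch (L p.1) p.2.1)
  (g := fun p FF => (FF.1 :: FF.2 :: p.2.2, (s p.1).2))).
- by apply: PT_branch; pt.
- apply: (PT_ocase (o := fun p : E * (form * seq form) => simulate M (B p.1) (enc_vc (vc_of t (leaf_clauses p.2.1))))
    (g := fun p b => if b then ([::], 1) else (p.2.2, (s p.1).2))).
  + by apply: PT_simulate; [pt | apply: PT_enc_vc; pt].
  + exact: PT_const.
  + by pt.
- by pt.
Qed.

Lemma PT_parse_nats E {EE : Enc E} (w : E -> seq bool) : PT w -> PT (fun e => parse_nats (w e)).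
Proof.
move=> hw; rewrite /parse_nats.
apply: (PT_foldr_inc (h := fun _ b acc => if b then (head 0 acc).+1 :: behead acc else 0 :: acc)
  (z := fun=> [::]) (W := fun=> 4) _ (PT_const _) hw (PB_const _)).
  by pt.
move=> e [] [|n s] _ /=; rewrite ?sz_cons ?sz_nil ?sz_nat; lia.
Qed.

Lemma PT_parse E {EE : Enc E} (w : E -> seq bool) : PT w -> PT (fun e => parse (w e)).
Proof.
move=> hw; pose proof (PT_parse_nats hw) as h; rewrite /parse.
have H : PT (fun s : seq nat => (head 0 s,
    [seq (nth 0 (behead s) (3 * i), nth 0 (behead s) (3 * i + 1), nth 0 (behead s) (3 * i + 2)) |
       i <- [seq i <- iota 0 (size (behead s)) | 3 * i + 2 < size (behead s)]])) by pt.
exact: (PT_comp H h).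
Qed.

(** * The search state stays of polynomial size *)

Lemma sz_filter A {EA : Enc A} (p : pred A) s : sz (filter p s) <= sz s.
Proof. by elim: s => //= x s IH; case: (p x); rewrite !sz_cons; lia. Qed.

Lemma sz_map_le A B {EA : Enc A} {EB : Enc B} (f : A -> B) s :
  (forall x, sz (f x) <= sz x) -> sz (map f s) <= sz s.
Proof. by move=> h; elim: s => //= x s IH; rewrite !sz_cons; have := h x; lia. Qed.

Lemma sz_mem (T : eqType) {ET : Enc T} (x : T) (s : seq T) : x \in s -> sz x < sz s.
Proof.
elim: s => //= y s IH; rewrite inE sz_cons => /orP[/eqP ->|/IH]; last by lia.
by pose proof (sz_gt0 s) as h; lia.
Qed.

Lemma mem_head_filter (T : eqType) (p : pred T) s x r :
  [seq y <- s | p y] = x :: r -> x \in s /\ p x.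
Proof.
move=> e; have : x \in [seq y <- s | p y] by rewrite e inE eqxx.
by rewrite mem_filter => /andP[].
Qed.

Lemma sz_add_clauses U P F :
  [/\ (sz (add_clauses U P F).1).+1 = sz U + sz F.1,
      sz (add_clauses U P F).2.1 < sz P + sz F.2.1 &
      sz (add_clauses U P F).2.2 <= sz F.2.2].
Proof.
split=> /=; [exact: sz_cat | | exact: sz_filter].
by rewrite -sz_cat ltnS; exact: sz_filter.
Qed.

Lemma sz_fst A B {EA : Enc A} {EB : Enc B} (p : A * B) : sz p.1 <= sz p.
Proof. by case: p => a b; rewrite sz_pair /=; lia. Qed.
Lemma sz_snd A B {EA : Enc A} {EB : Enc B} (p : A * B) : sz p.2 <= sz p.
Proof. by case: p => a b; rewrite sz_pair /=; lia. Qed.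

(** The growth is triangular: ternary clauses never grow, binary ones gain at most a multiple of the
    ternary part, units at most the binary and ternary parts. Hence [i] steps give linear and
    quadratic bounds in [i] instead of exponential ones; [small] records them. *)
Lemma sz_branch L (F : form) FF (G : form) : branch L F = Some FF -> G \in [:: FF.1; FF.2] ->
  [/\ sz G.1 <= sz F.1 + sz F.2.1 + sz F.2.2, sz G.2.1 <= sz F.2.1 + 4 * sz F.2.2 &
      sz G.2.2 <= sz F.2.2].
Proof.
have H U P : sz U <= sz F.2.1 + sz F.2.2 + 1 -> sz P <= 4 * sz F.2.2 ->
    [/\ sz (add_clauses U P F).1 <= sz F.1 + sz F.2.1 + sz F.2.2,
      sz (add_clauses U P F).2.1 <= sz F.2.1 + 4 * sz F.2.2 &
      sz (add_clauses U P F).2.2 <= sz F.2.2].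
  move=> hU hP; have [h1 h2 h3] := sz_add_clauses U P F; split=> //; last by lia.
  by lia.
pose proof (sz_gt0 F.2.1) as g1; pose proof (sz_gt0 F.2.2) as g2.
have n0 A (EA : Enc A) : sz ([::] : seq A) = 1 by [].
rewrite /branch /hearts2 /hearts3 /hearts32.
case e1 : [seq a <- _ | _] => [|a r].
case e2 : [seq a <- _ | _] => [|ab r].
case e3 : [seq a <- _ | _] => [|a r] //.
- have [/mapP[c cT ea] _] := mem_head_filter e3.
  have hc : sz c < sz F.2.2 by exact: sz_mem.
  have ha : sz a <= sz c.
    by rewrite ea; apply: leq_trans (sz_fst _) (sz_fst _).
  move=> [<-]; rewrite !inE => /orP[] /eqP ->; apply: H; rewrite ?n0; try lia.
  + by rewrite sz_cons sz_nil; lia.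
  + apply: leq_trans (sz_map_le _ _) _; last by (apply: leq_trans (sz_filter _ _) _; exact: leq_pmull).
    by move=> [[x y] z]; rewrite /= !sz_pair; lia.
- have [/mapP[c cT ea] _] := mem_head_filter e2.
  have hc : sz c < sz F.2.2 by exact: sz_mem.
  have ha : sz ab < sz c by rewrite ea; case: (c) => x y /=; rewrite sz_pair; lia.
  move=> [<-]; rewrite !inE => /orP[] /eqP ->; apply: H; rewrite ?n0; try lia.
  + have -> : sz [:: ab; (ab.2, ab.1)] = sz ab + sz ab + 3.
      by case: (ab) => x y; rewrite !sz_cons !sz_pair sz_nil /=; lia.
    by lia.
  + apply: leq_trans (sz_map_le _ _) _; last by (apply: leq_trans (sz_filter _ _) _; rewrite addnAC leq_addl).
    by move=> c'; exact: sz_snd.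
- have [/mapP[c cT ea] _] := mem_head_filter e1.
  have hc : sz c < sz F.2.1 by exact: sz_mem.
  have ha : sz a <= sz c by rewrite ea; exact: sz_fst.
  move=> [<-]; rewrite !inE => /orP[] /eqP ->; apply: H; rewrite ?n0; try lia.
  + by rewrite sz_cons sz_nil; lia.
  + apply: leq_trans (sz_map_le _ _) _; last by (apply: leq_trans (sz_filter _ _) _; rewrite -addnA leq_addr).
    by move=> c'; exact: sz_snd.
Qed.

Section DfsSize.
Variables (M : TM) (t B L : nat) (F0 : form).

Definition small (i : nat) (F : form) : Prop :=
  [/\ sz F.2.2 <= sz F0, sz F.2.1 <= sz F0 + i * (4 * sz F0) &
      sz F.1 <= sz F0 + i * (2 * sz F0 + B * (4 * sz F0))].

Lemma small_iter i : i <= B ->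
  let s := iter i (search_step M t B L) ([:: F0], 0) in
  [/\ s.2 <= 2, size s.1 <= i.+1 & {in s.1, forall F, small i F}].
Proof.
elim: i => [_ /=|i IH hi].
  split=> // F; rewrite inE => /eqP ->; rewrite /small !mul0n !addn0.
  by split; [exact: leq_trans (sz_snd _) (sz_snd _) | exact: leq_trans (sz_fst _) (sz_snd _) | exact: sz_fst].
have {IH} := IH (ltnW hi); rewrite iterS; move: (iter i _ _) => [fs fl] /= [h1 h2 h3].
have mono F : small i F -> small i.+1 F by move=> [a b c]; split=> //; rewrite mulSn; lia.
rewrite /search_step; case: fs h2 h3 => [|F fs] /= h2 h3.
  by split=> //; lia.
have hF : small i F by apply: h3; rewrite inE eqxx.
have hfs : {in fs, forall G, small i.+1 G}.
  by move=> G hG; apply/mono/h3; rewrite inE hG orbT.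
case e : (branch L F) => [FF|].
  split=> //=; have ch (G : form) := sz_branch (G := G) e.
  have hG (G : form) : G \in [:: FF.1; FF.2] -> small i.+1 G.
    move=> /(ch G)[c1 c2 c3]; case: hF => [a b c]; split; [by lia | by rewrite mulSn; lia |].
    have : i * (4 * sz F0) <= B * (4 * sz F0) by rewrite leq_mul2r; lia.
    by rewrite mulSn; lia.
  move=> G; rewrite !inE orbA => /orP[h|]; last exact: hfs.
  by apply: hG; rewrite !inE.
by case: (simulate _ _ _) => [[]|]; split=> //=; lia.
Qed.

Lemma search_size i : i <= B ->
  sz (iter i (search_step M t B L) ([:: F0], 0)) <=
  (B + 1) * (4 * sz F0 + B * (10 * sz F0 + B * (4 * sz F0)) + 4) + 20.
Proof.
move=> hi; have := small_iter hi; move: (iter i _ _) => [fs fl] /= [h1 h2 h3].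
rewrite sz_pair.
have hf : sz fl <= 5 by rewrite sz_nat; lia.
have hs : sz fs <= size fs * (3 * sz F0 + B * (10 * sz F0 + B * (4 * sz F0)) + 4) + 1.
  elim: fs h3 {h2} => //= F fs IH h3; rewrite sz_cons.
  have {}IH : sz fs <= size fs * (3 * sz F0 + B * (10 * sz F0 + B * (4 * sz F0)) + 4) + 1.
    by apply: IH => G hG; apply: h3; rewrite inE hG orbT.
  have [a b c] : small i F by apply: h3; rewrite inE eqxx.
  have e : sz F = sz F.1 + sz F.2.1 + sz F.2.2 + 2.
    by case: (F) => U [P T]; rewrite !sz_pair /=; lia.
  have m1 : i * (4 * sz F0) <= B * (4 * sz F0) by rewrite leq_mul2r; lia.
  have m2 : i * (2 * sz F0 + B * (4 * sz F0)) <= B * (2 * sz F0 + B * (4 * sz F0)) by rewrite leq_mul2r; lia.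
  have m3 : B * (10 * sz F0 + B * (4 * sz F0)) = B * (4 * sz F0) + B * (2 * sz F0 + B * (4 * sz F0)) + B * (4 * sz F0).
    by rewrite -!mulnDr; congr (_ * _); lia.
  by rewrite mulSn; lia.
have : size fs * (3 * sz F0 + B * (10 * sz F0 + B * (4 * sz F0)) + 4) <=
  (B + 1) * (4 * sz F0 + B * (10 * sz F0 + B * (4 * sz F0)) + 4).
  by apply: leq_mul; lia.
by lia.
Qed.
End DfsSize.

Lemma PT_search (M : TM) (t : nat) E {EE : Enc E} (B L : E -> nat) (F : E -> form) :
  PT B -> PT F -> PT L -> PT (fun e => search M t (B e) (F e) (L e)).
Proof.
move=> hB hF hL; rewrite /search.
apply: (PT_iter (h := fun e s => search_step M t (B e) (L e) s) (W := fun e =>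
   (sz (B e) + 1) * (4 * sz (F e) + sz (B e) * (10 * sz (F e) + sz (B e) * (4 * sz (F e))) + 4) + 20)) => //.
- by apply: PT_search_step; pt.
- by pt.
- pose proof (PT_size hF) as h1; pose proof (PT_size hB) as h2.
  by repeat (apply: PB_add || apply: PB_mul || apply: PB_const || assumption).
- move=> e j hj; apply: leq_trans (search_size _ _ _ _ hj) _.
  have hb : B e <= sz (B e) by rewrite sz_nat; lia.
  rewrite leq_add2r; apply: leq_mul; first by lia.
  rewrite leq_add2r leq_add2l; apply: leq_mul => //.
  by rewrite leq_add2l leq_mul2r hb orbT.
Qed.

Lemma PT_stage (M : TM) (t : nat) E {EE : Enc E} (B : E -> nat) (F : E -> form) :
  PT B -> PT F -> PT (fun e => stage M t (B e) (F e)).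
Proof.
move=> hB hF; rewrite /stage.
apply: (PT_lcase (l := fun e => [seq s <- [seq search M t (B e) (F e) L | L <- iota 1 (B e)] | nilp s.1 && (s.2 != 2)])
  (g := fun e s _ => Some (s.2 == 1))).
- pose proof (PT_map (F := fun e L => search M t (B e) (F e) L) (l := fun e => iota 1 (B e))) as h.
  have {}h : PT (fun e => [seq search M t (B e) (F e) L | L <- iota 1 (B e)]).
    by apply: h; [apply: PT_search; pt | pt].
  by apply: PT_filter h; pt.
- exact: PT_const.
- by pt.
Qed.

(** * The solver as a machine *)

Lemma sz_bits (w : seq bool) : sz w <= 4 * size w + 1.
Proof. by elim: w => //= b w IH; rewrite sz_cons; pose proof (sz_bool b) as h; lia. Qed.

Lemma run_mono (M : TM) n n' (c c' : config M) : run n c = Some c' -> n <= n' -> run n' c = Some c'.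
Proof.
elim: n n' c => [|n IH] [|n'] c //=; case: (step c) => // c1 h hn; exact: IH h hn.
Qed.

(** [RI] delivers the last letter first, which is the order in which consing builds the list. Each
    turn pushes the code of the letter and then the cons bit. *)
Definition cload : cmd :=
  Seq (Push RS false)
    (While RI (Seq (Push RS false) (Push RS true))
       (Seq (Push RS false) (Seq (Push RS false) (Seq (Push RS true) (Push RS true))))).

Lemma ex_load w : ex cload (Store (rev w) [::] [::] [::] [::]) (stk [::] (bits (tr w)))
  (8 * size w + 3).
Proof.
have H l (v : seq bool) : ex (While RI (Seq (Push RS false) (Push RS true))
       (Seq (Push RS false) (Seq (Push RS false) (Seq (Push RS true) (Push RS true)))))
    (stk l (bits (tr v))) (stk [::] (bits (tr (catrev l v)))) (8 * size l + 1).
  elim: l v => [|b l IH] v; first exact: ex_while_nil.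
  have h : ex (if b then Seq (Push RS false) (Seq (Push RS false) (Seq (Push RS true) (Push RS true)))
               else Seq (Push RS false) (Push RS true))
      (stk l (bits (tr v))) (stk l (bits (tr (b :: v)))) (1 + (1 + (1 + 1 + 1) + 1) + 1).
    case: b.
      apply: (ex_seq (s1 := stk l (false :: bits (tr v)))); first exact: ex_push.
      apply: (ex_seq (s1 := stk l [:: false, false & bits (tr v)])); first exact: ex_push.
      by apply: (ex_seq (s1 := stk l [:: true, false, false & bits (tr v)])); exact: ex_push.
    apply: (@ex_le _ _ _ (1 + 1 + 1)) => //.
    by apply: (ex_seq (s1 := stk l (false :: bits (tr v)))); exact: ex_push.
  apply: ex_le (@ex_while_cons RI _ _ (stk (b :: l) (bits (tr v))) _ _ b l _ _ (erefl _) h (IH (b :: v))) _.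
  by rewrite /=; lia.
have h1 : ex (Push RS false) (Store (rev w) [::] [::] [::] [::]) (stk (rev w) (bits (tr ([::] : seq bool)))) 1.
  exact: ex_push.
have h2 := H (rev w) [::]; rewrite catrevE revK cats0 size_rev in h2.
by apply: ex_le (ex_seq h1 h2) _; lia.
Qed.

Section Solver.
Variables (M : TM) (t : nat).

(** In order: whether to go on, the answer, the budget of the next round, the formula. The flag is
    leftmost because [ex_loop] tests the left subtree. *)
Definition round_state := (bool * (bool * (nat * form)))%type.

Lemma sz_round a b n (F : form) :
  sz ((a, (b, (n, F))) : round_state) = sz a + sz b + sz n + sz F + 3.
Proof. by rewrite (sz_pair a) (sz_pair b) (sz_pair n); lia. Qed.

Definition round (s : round_state) : round_state :=
  if stage M t s.2.2.1 s.2.2.2 is Some b then (false, (b, (s.2.2.1.+1, s.2.2.2)))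
  else (true, (false, (s.2.2.1.+1, s.2.2.2))).

Lemma PT_round : PT round.
Proof.
rewrite /round.
apply: (PT_ocase (o := fun s : round_state => stage M t s.2.2.1 s.2.2.2)
  (g := fun s b => (false, (b, (s.2.2.1.+1, s.2.2.2))))).
- by apply: PT_stage; pt.
- by pt.
- by pt.
Qed.

Definition formula_of (w : seq bool) : form := init_form (parse w).1 (parse w).2.

Lemma PT_formula_of : PT formula_of.
Proof.
have h : PT (fun w : seq bool => parse w) by apply: PT_parse; pt.
by rewrite /formula_of; apply: PT_init_form; pt.
Qed.

(** The loop stops after the first deciding round [B]. All states until then have size polynomial in
    [size w + B], so the exponent [a] can be fixed before [w] and [B]. *)
Theorem solver_exists : exists (S : TM) (a : nat), forall w B b,
  (forall B', B' < B -> stage M t B' (formula_of w) = None) ->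
  stage M t B (formula_of w) = Some b ->
  exists c, run ((size w + B + 2) ^ a) (init S w) = Some c /\ tm_accept (c_state c) = b.
Proof.
have [cp [Fp [hFp Hp]]] : PT (fun w : seq bool => (true, (false, (0, formula_of w))) : round_state).
  by pose proof PT_formula_of as h; pt.
have [cg [Fg [[ag hFg] Hg]]] := PT_round.
have [co [Fo [[ao hFo] Ho]]] : PT (fun s : round_state => s.2.1) by pt.
pose work := Seq cload (Seq cp (Seq (cloop cg) co)).
pose prog := Seq work (IfPop RS (Halt false) (Halt false) (Halt true)).
(* [K] bounds the size of the loop states, [n] the steps of the stack program, [T] the steps of the
   compiled machine. *)
pose (K := fun e : seq bool * nat => sz (formula_of e.1) + 2 * sz e.2 + 20).
pose (n := fun e : seq bool * nat => 8 * sz e.1 + 3 + Fp e.1 + (sz e.2 * (K e ^ ag + 12) + 12) + K e ^ ao + 6).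
pose (T := fun e : seq bool * nat => 12 + 6 * (n e * (2 * (sz e.1 + n e) + 10))).
have [a ha] : PB T.
  have h1 : PT (fun e : seq bool * nat => e.1) by pt.
  have h2 : PT (fun e : seq bool * nat => e.2) by pt.
  pose proof (PB_comp h1 hFp) as h3.
  pose proof (PT_size h1) as h4; pose proof (PT_size h2) as h5.
  pose proof (PT_size (PT_comp PT_formula_of h1)) as h6.
  have hK : PB K by repeat (apply: PB_add || apply: PB_mul || apply: PB_const || assumption).
  have hn : PB n by repeat (apply: PB_add || apply: PB_mul || apply: PB_exp || apply: PB_const || assumption).
  by repeat (assumption || apply: PB_add || apply: PB_mul || apply: PB_exp || apply: PB_const).
exists (compiled prog), (4 * a) => w B b hnone hsome.
pose x0 : round_state := (true, (false, (0, formula_of w))).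
have it j : j <= B -> iter j round x0 = (true, (false, (j, formula_of w))).
  by elim: j => // j IH hj; rewrite iterS IH 1?ltnW // /round /= hnone.
have itB : iter B.+1 round x0 = (false, (b, (B.+1, formula_of w))).
  by rewrite iterS it // /round /= hsome.
pose e := (w, B).
have szK j : j <= B.+1 -> sz (iter j round x0) + 2 <= K e.
  rewrite leq_eqVlt => /orP[/eqP ->|hj].
    by rewrite itB sz_round !sz_nat /K /e [(w, B).1]/= [(w, B).2]/= sz_nat; pose proof (sz_bool b) as hb; pose proof (sz_bool false) as hb'; lia.
  rewrite it // sz_round !sz_nat /K /e [(w, B).1]/= [(w, B).2]/= sz_nat.
  by pose proof (sz_bool true) as hb; pose proof (sz_bool false) as hb'; lia.
have ht (s : round_state) : exists v, bits (tr s) = [:: true, s.1 & v].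
  by case: s => [[] y]; eexists; reflexivity.
pose proof (@ex_loop _ _ (fun s : round_state => s.1) round Fg cg ht Hg B.+1 x0 [::] [::]) as HL.
have hj j : j < B.+1 -> (iter j round x0).1 by move=> lt; rewrite it.
have {}HL := HL hj; rewrite itB in HL; have {}HL := HL (erefl _).
have {}HL : ex (cloop cg) (stk [::] (bits (tr x0) ++ [::]))
    (stk [::] (bits (tr ((false, (b, (B.+1, formula_of w))) : round_state)) ++ [::])) (sz B * (K e ^ ag + 12) + 12).
  apply: ex_le HL _.
  rewrite leq_add2r; apply: (@leq_trans (\sum_(j < B.+1) (K e ^ ag + 12))).
    apply: leq_sum => j _; rewrite leq_add2r; apply: leq_trans (hFg _) _.
    case: (ag) => // a'; rewrite leq_exp2r //; apply: szK; exact: ltnW (ltn_ord j).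
  by rewrite sum_nat_const card_ord leq_mul2r sz_nat; lia.
have hw : ex work (Store (rev w) [::] [::] [::] [::]) (stk [::] (bits (tr b))) (n e - 2).
  have h1 := Hp w [::] [::]; have h2 := Ho (false, (b, (B.+1, formula_of w))) [::] [::].
  rewrite !cats0 in h1 h2 HL.
  apply: ex_le (ex_seq (ex_load w) (ex_seq h1 (ex_seq HL h2))) _.
  have : Fo (false, (b, (B.+1, formula_of w))) <= K e ^ ao.
    apply: leq_trans (hFo _) _; case: (ao) => // a'; rewrite leq_exp2r // -itB.
    exact: szK.
  by pose proof (size_le_sz w) as hz; rewrite /n; change e.1 with w; change e.2 with B; lia.
have [m hm Hm] := hw.
have hrun : isteps sstep (m + 2) ([:: prog], Store (rev w) [::] [::] [::] [::]) =
    Some ([:: Halt b], stk [::] (behead (bits (tr b)))).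
  rewrite addn2 (@istepsS _ _ _ _ ([:: work; IfPop RS (Halt false) (Halt false) (Halt true)], Store (rev w) [::] [::] [::] [::])) //.
  rewrite -addn1; apply: istepsD (Hm _) _.
  by case: (b).
have [c [hc1 hc2]] := compiled_correct hrun.
exists c; split=> //.
have hle : 12 + 6 * ((m + 2) * (2 * (size w + (m + 2)) + 10)) <= (size w + B + 2) ^ (4 * a).
  apply: (@leq_trans (T e)).
    have hmn : m + 2 <= n e by rewrite /n in hm *; lia.
    rewrite /T leq_add2l leq_mul2l /=; apply: leq_mul => //.
    by pose proof (size_le_sz w) as hz; change e.1 with w; lia.
  apply: leq_trans (ha e) _; rewrite expnM.
  case: (a) => // a'; rewrite leq_exp2r // /e sz_pair sz_nat.
  (* The base [sz e + 2] is at most [8 * (x + 2)], hence at most [(x + 2) ^ 4]; this is the factor 4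
     in the exponent. *)
  have h := sz_bits w; set x := size w + B.
  apply: (@leq_trans (8 * (x + 2))); first by rewrite /x; lia.
  rewrite (mulnC 8) expnS leq_mul2l; apply/orP; right.
  by apply: (@leq_trans (2 ^ 3)) => //; rewrite leq_exp2r //; lia.
exact: run_mono hc1 hle.
Qed.
End Solver.

(** * Correctness of branching and search *)

Definition ltrue (a : nat -> bool) (x : nat) : bool := a x./2 == odd x.
Definition ptrue (a : nat -> bool) (p : nat * nat) : bool := ltrue a p.1 || ltrue a p.2.
Definition ctrue (a : nat -> bool) (c : lit3) : bool :=
  [|| ltrue a c.1.1, ltrue a c.1.2 | ltrue a c.2].
Definition ftrue (a : nat -> bool) (F : form) : bool :=
  [&& all (ltrue a) F.1, all (ptrue a) F.2.1 & all (ctrue a) F.2.2].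

Lemma all_flatten_map (X Y : Type) (f : X -> seq Y) (p : pred Y) s :
  all p (flatten (map f s)) = all (fun x => all p (f x)) s.
Proof. by elim: s => //= x s IH; rewrite all_cat IH. Qed.

Lemma strict_clause_true N a c : all (ctrue a) (strict_clause N c) = ctrue a c.
Proof.
have e1 : ltrue a (2 * N + 1) = ~~ ltrue a (2 * N).
  rewrite /ltrue addn1 !mul2n /= uphalf_double doubleK odd_double.
  by case: (a N).
have e2 : ltrue a (2 * N + 3) = ~~ ltrue a (2 * N + 2).
  have -> : 2 * N + 3 = (N.+1).*2.+1 by lia.
  have -> : 2 * N + 2 = (N.+1).*2 by lia.
  by rewrite /ltrue [_.+1./2]/= uphalf_double doubleK oddS odd_double; case: (a _).
case: c => [[x y] z]; rewrite /strict_clause /=.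
case: (x =P y) => [->|_]; case: (y =P z) => [->|_]; try case: (x =P z) => [->|_];
  rewrite /ctrue /= ?e1 ?e2;
  repeat match goal with |- context [ltrue a ?v] => case: (ltrue a v) => //= end.
Qed.

Lemma perms3_true a c : all (ctrue a) (perms3 c) = ctrue a c.
Proof.
case: c => [[x y] z]; rewrite /perms3 /ctrue /=.
by case: (ltrue a x); case: (ltrue a y); case: (ltrue a z).
Qed.

Lemma init_form_true N cs a : ftrue a (init_form N cs) = all (ctrue a) cs.
Proof.
rewrite /ftrue /= (eq_all_r (mem_undup _)) all_flatten_map.
rewrite (eq_all (perms3_true a)) all_flatten_map.
exact/eq_all/strict_clause_true.
Qed.

(** Every clause that the filters drop contains a unit or a pair that is kept or is itself implied
    by a unit, so its truth is automatic. *)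
Lemma add_clauses_true a U P F :
  ftrue a (add_clauses U P F) = [&& all (ltrue a) U, all (ptrue a) P & ftrue a F].
Proof.
rewrite /ftrue /add_clauses /= all_cat.
case hU : (all (ltrue a) U) => //=; case hF : (all (ltrue a) F.1) => /=; last by rewrite !andbF.
set U1 := U ++ F.1; set P1 := P ++ F.2.1.
have tU1 x : x \in U1 -> ltrue a x.
  by rewrite mem_cat => /orP[] h; [apply: (allP hU) | apply: (allP hF)].
have -> : all (ptrue a) [seq p <- P1 | (p.1 \notin U1) && (p.2 \notin U1)] = all (ptrue a) P1.
  rewrite all_filter; apply: eq_all => p /=.
  case h1 : (p.1 \in U1) => /=; first by rewrite /ptrue (tU1 _ h1).
  by case h2 : (p.2 \in U1) => //=; rewrite /ptrue (tU1 _ h2) orbT.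
rewrite all_cat -andbA; case hP : (all (ptrue a) P) => //=.
case hQ : (all (ptrue a) F.2.1) => //=.
have tP1 p : p \in P1 -> ptrue a p.
  by rewrite mem_cat => /orP[] h; [apply: (allP hP) | apply: (allP hQ)].
rewrite all_filter; apply: eq_all => -[[x y] z] /=; rewrite /ctrue /=.
case h1 : (x \in U1) => /=; first by rewrite (tU1 _ h1).
case h2 : (y \in U1) => /=; first by rewrite (tU1 _ h2) orbT.
case h3 : (z \in U1) => /=; first by rewrite (tU1 _ h3) !orbT.
case h4 : ((x, y) \in P1) => /=; first by have /orP[->|->] := tP1 _ h4; rewrite ?orbT.
case h5 : ((x, z) \in P1) => /=; first by have /orP[->|->] := tP1 _ h5; rewrite ?orbT.
by case h6 : ((y, z) \in P1) => //=; have /orP[->|->] := tP1 _ h6; rewrite ?orbT.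
Qed.

(** If the heart is false, each clause containing it must be satisfied by its petal; conversely both
    branches only add clauses to [F]. *)
Lemma branch_true L F FF a : branch L F = Some FF ->
  ftrue a F = ftrue a FF.1 || ftrue a FF.2.
Proof.
rewrite /branch.
case: (hearts2 L F) => [|x r]; last first.
  move=> [<-]; rewrite !add_clauses_true /= andbT.
  case hF : (ftrue a F); rewrite ?andbF //= !andbT.
  case hx : (ltrue a x) => //=; symmetry; apply/allP => y /mapP[p].
  rewrite mem_filter => /andP[/eqP e pP] ->.
  move: hF => /and3P[_ /allP/(_ _ pP) + _]; rewrite /ptrue e hx //.
case: (hearts3 L F) => [|x r]; last first.
  move=> [<-]; rewrite !add_clauses_true /= andbT.
  case hF : (ftrue a F); rewrite ?andbF //= !andbT.
  have -> : ptrue a (x.2, x.1) = ptrue a x by rewrite /ptrue orbC.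
  rewrite andbb; case hx : (ptrue a x) => //=; symmetry; apply/allP => y /mapP[c].
  rewrite mem_filter => /andP[/eqP e cT] ->.
  move: hF => /and3P[_ _ /allP/(_ _ cT)]; rewrite /ctrue e orbA.
  by move: hx; rewrite /ptrue => ->.
case: (hearts32 L F) => [|x r] //.
move=> [<-]; rewrite !add_clauses_true /= andbT.
case hF : (ftrue a F); rewrite ?andbF //= !andbT.
case hx : (ltrue a x) => //=; symmetry; apply/allP => y /mapP[c].
rewrite mem_filter => /andP[/eqP e cT] ->.
move: hF => /and3P[_ _ /allP/(_ _ cT)]; rewrite /ctrue e hx //.
Qed.

Lemma leaf_clauses_true a F : all (ctrue a) (leaf_clauses F) = ftrue a F.
Proof.
rewrite /leaf_clauses !all_cat !all_map /ftrue; congr [&& _, _ & _].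
  by apply: eq_all => x; rewrite /= /ctrue /= !orbb.
by apply: eq_all => x; rewrite /= /ctrue /= orbb.
Qed.

Definition csat (cs : seq lit3) : Prop := exists a, all (ctrue a) cs.
Definition fsat (F : form) : Prop := exists a, ftrue a F.

Section SearchCorrect.
Variables (M : TM) (t : nat).
Hypothesis sim_ok : forall cs B b, simulate M B (enc_vc (vc_of t cs)) = Some b ->
  (b <-> csat cs).

Lemma leaf_ok F B b :
  simulate M B (enc_vc (vc_of t (leaf_clauses F))) = Some b -> (b <-> fsat F).
Proof.
by move=> /sim_ok ->; split=> -[a h]; exists a; rewrite ?leaf_clauses_true // -leaf_clauses_true.
Qed.

(** Under flag 0 all leaves met so far were unsatisfiable, so the open formulas carry the whole
    question. Flag 2 claims nothing about [F]. *)
Lemma search_inv B F L n : let s := iter n (search_step M t B L) ([:: F], 0) in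
  match s.2 with
  | 0 => fsat F <-> exists2 G, G \in s.1 & fsat G
  | 1 => fsat F /\ s.1 = [::]
  | 2 => s.1 = [::]
  | _ => False
  end.
Proof.
elim: n => [|n] /=.
  by split=> [h|[G]]; [exists F => //; rewrite inE | rewrite inE => /eqP ->].
move: (iter _ _ _) => [fs [|[|[|fl]]]] //=; rewrite /search_step /=.
- case: fs => [|G fs] //= IH; case e : (branch L G) => [FF|] /=.
    rewrite IH; split=> -[H]; rewrite !inE.
      move=> /orP[/eqP ->|hH] [a]; last by exists H; rewrite ?inE ?hH ?orbT //; exists a.
      rewrite (branch_true a e) => /orP[] h; [exists FF.1|exists FF.2]; rewrite ?inE ?eqxx ?orbT //; by exists a.
    move=> /or3P[/eqP ->|/eqP ->|hH] [a h]; last by exists H; [rewrite inE hH orbT | exists a].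
      by exists G; [rewrite inE eqxx | exists a; rewrite (branch_true a e) h].
    by exists G; [rewrite inE eqxx | exists a; rewrite (branch_true a e) h orbT].
  case e1 : (simulate _ _ _) => [[]|] //=; have hb := leaf_ok e1.
    by split=> //; rewrite IH; exists G; [rewrite inE eqxx | apply/hb].
  rewrite IH; split=> -[H]; last by move=> h1 h2; exists H => //; rewrite inE h1 orbT.
  rewrite inE => /orP[/eqP -> /hb //|h1 h2]; by exists H.
- by case=> hF ->.
- by move=> ->.
Qed.

Lemma stage_ok B F b : stage M t B F = Some b -> (b <-> fsat F).
Proof.
rewrite /stage; case e : [seq s <- _ | _] => [|s r] // [<-].
have [/mapP[L _ eL] /andP[h1 h2]] := mem_head_filter e.
have := search_inv B F L B; rewrite -/(search M t B F L) -eL.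
case: (s) h1 h2 => [fs fl] /= /nilP -> {e eL}.
by case: fl => [|[|[|fl]]] //= _ IH; split=> //; [move=> /IH[]|case: IH].
Qed.
End SearchCorrect.

(** * Size of the search tree and of its leaves *)

(** An explicit supersolution of T(n) = 1 + T(n - 1) + T(n - H): linear inside each block of length
    [H], multiplied by [H + 2] from one block to the next. The 2 pays for the smaller subtree and
    the node itself. *)
Definition node_bound (H n : nat) : nat := (H + 2) ^ (n %/ H) * (n %% H + 1).

Lemma node_bound_gt0 H n : 0 < node_bound H n.
Proof. by rewrite muln_gt0 expn_gt0; lia. Qed.

Lemma node_bound_step H n : 0 < H -> H <= n ->
  1 + node_bound H n.-1 + node_bound H (n - H) <= node_bound H n.
Proof.
move=> H0 hn; rewrite /node_bound; set q := n %/ H; set r := n %% H.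
have en : n = q * H + r by rewrite -divn_eq.
have hr : r < H by rewrite ltn_mod.
have q0 : 0 < q by rewrite divn_gt0.
have e1 : (n - H) %/ H = q.-1 by rewrite en -{2}[H]mul1n -addnBAC ?leq_mul2r ?q0 ?orbT // -mulnBl divnMDl // divn_small // addn0 subn1.
have e2 : (n - H) %% H = r by rewrite en -{2}[H]mul1n -addnBAC ?leq_mul2r ?q0 ?orbT // -mulnBl modnMDl modn_small.
rewrite e1 e2.
have eA : (H + 2) ^ q = (H + 2) ^ q.-1 * (H + 2) by rewrite -{1}(prednK q0) expnSr.
set A := (H + 2) ^ q.-1 in eA *.
have A0 : 0 < A by rewrite expn_gt0; lia.
case: (posnP r) => [r0|r0].
  have e3 : n.-1 %/ H = q.-1 /\ n.-1 %% H = H.-1.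
    have -> : n.-1 = q.-1 * H + H.-1 by rewrite en r0 -{1}(prednK q0) mulSn; lia.
    by rewrite divnMDl // modnMDl divn_small ?modn_small; lia.
  case: e3 => -> ->; rewrite r0 eA -/A addn1 prednK // add0n !muln1 mulnDr; lia.
have e3 : n.-1 %/ H = q /\ n.-1 %% H = r.-1.
  have -> : n.-1 = q * H + r.-1 by rewrite en; lia.
  by rewrite divnMDl // modnMDl divn_small ?modn_small; lia.
case: e3 => -> ->; rewrite eA addn1 prednK //.
have : A * (r + 1) <= A * H by rewrite leq_mul2l; lia.
rewrite mulnDr muln1 => h.
have -> : A * (H + 2) * (r + 1) = A * (H + 2) * r + A * H + A * 2.
  by rewrite mulnDr muln1 mulnDr; lia.
by lia.
Qed.

Lemma node_bound_le H n k : 0 < H -> n <= H * k -> node_bound H n <= (H + 2) ^ k.+1.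
Proof.
move=> H0 hn; rewrite /node_bound expnSr; apply: leq_mul.
  by rewrite leq_pexp2l ?addn2 // -(mulKn k H0) leq_div2r.
by have := ltn_pmod n H0; lia.
Qed.

Lemma size_by_key (X : eqType) (f : X -> nat) (s : seq X) (ks : seq nat) D :
  {in s, forall x, f x \in ks} -> (forall k, count (fun x => f x == k) s <= D) ->
  size s <= D * size ks.
Proof.
elim: ks s => [|k ks IH] s h hD.
  by case: s h {hD} => // x s /(_ x); rewrite inE eqxx => /(_ isT).
rewrite -(count_predC (fun x => f x == k)) /= mulnS leq_add ?hD // -size_filter.
apply: IH => [x|k']; first by rewrite mem_filter /= => /andP[/negP hx /h]; rewrite inE => /orP[].
apply: leq_trans (hD k'); rewrite count_filter; apply: sub_count => x /=.
by case/andP.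
Qed.

Lemma uniq_map_filter (X Y : eqType) (Z : eqType) (f : X -> Y) (g : X -> Z) (s : seq X) z :
  uniq s -> (forall x y, f x = f y -> g x = g y -> x = y) ->
  uniq [seq f x | x <- [seq x <- s | g x == z]].
Proof.
move=> us inj; rewrite map_inj_in_uniq; first exact: filter_uniq.
by move=> x y; rewrite !mem_filter => /andP[/eqP hx _] /andP[/eqP hy _] e; apply: inj; rewrite ?hx ?hy.
Qed.

Section Sparsify.
Variables (m L : nat).
Hypothesis L_gt0 : 0 < L.

(** The bound [m] limits the literal codes. Closure under the swap of pairs and under two
    transpositions of triples, which generate all permutations, lets every other condition mention
    the first literals only. *)
Record wf (F : form) : Prop := Wf {
  wf_U : uniq F.1;
  wf_Um : {in F.1, forall x, x < m};
  wf_P : uniq F.2.1;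
  wf_Pm : {in F.2.1, forall p, [/\ p.1 < m, p.1 \notin F.1, p.2 \notin F.1 & (p.2, p.1) \in F.2.1]};
  wf_T : uniq F.2.2;
  wf_Tm : {in F.2.2, forall c, [/\ c.1.1 < m, c.1.1 \notin F.1, c.1.1 != c.1.2,
            (c.1.1, c.1.2) \notin F.2.1 &
            (c.1.2, c.1.1, c.2) \in F.2.2 /\ (c.1.1, c.2, c.1.2) \in F.2.2]};
  wf_deg : forall a, count (fun p => p.1 == a) F.2.1 <= 2 * L }.

Lemma size_petals2 F a : size (petals2 F a) = count (fun p => p.1 == a) F.2.1.
Proof. by rewrite size_map size_filter. Qed.
Lemma size_petals3 F ab : size (petals3 F ab) = count (fun c => c.1 == ab) F.2.2.
Proof. by rewrite size_map size_filter. Qed.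
Lemma size_petals32 F a : size (petals32 F a) = count (fun c => c.1.1 == a) F.2.2.
Proof. by rewrite size_map size_filter. Qed.

Lemma wf_add W Q F : wf F -> uniq W -> {in W, forall x, x < m /\ x \notin F.1} ->
  uniq Q -> {in Q, forall p, [/\ p.1 < m, p \notin F.2.1 & (p.2, p.1) \in Q]} ->
  (forall a, count (fun p => p.1 == a) (Q ++ F.2.1) <= 2 * L) ->
  wf (add_clauses W Q F).
Proof.
move=> [U0 Um P0 Pm T0 Tm dg] uW hW uQ hQ hd.
have symP1 p : p \in Q ++ F.2.1 -> (p.2, p.1) \in Q ++ F.2.1.
  by rewrite !mem_cat => /orP[/hQ[_ _ ->]|/Pm[_ _ _ ->]]; rewrite ?orbT.
have symP1' x y : (x, y) \notin Q ++ F.2.1 -> (y, x) \notin Q ++ F.2.1.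
  by apply: contra => /symP1.
split=> /=.
- rewrite cat_uniq uW U0 /= andbT; apply/hasPn => x xU; apply/negP => /hW[_].
  by rewrite xU.
- by move=> x; rewrite mem_cat => /orP[/hW[]|/Um].
- rewrite filter_uniq // cat_uniq uQ P0 /= andbT; apply/hasPn => p pP; apply/negP => /hQ[_].
  by rewrite pP.
- move=> p; rewrite !mem_filter /= => /andP[/andP[h1 h2] pP]; split=> //.
    by move: pP; rewrite mem_cat => /orP[/hQ[]|/Pm[]].
  by rewrite h1 h2 symP1.
- exact: filter_uniq.
- move=> [[x y] z]; rewrite !mem_filter /=.
  move=> /andP[/andP[/andP[/andP[h1 h2] h3] /andP[/andP[p1 p2] p3]] cT].
  have [/= q1 q2 q3 q4 [q5 q6]] := Tm _ cT; split=> //.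
    by rewrite negb_and p1 orbT.
  by rewrite h1 h2 h3 p1 p2 p3 q5 q6 (symP1' _ _ p1) (symP1' _ _ p3).
- move=> a; apply: leq_trans (hd a); rewrite count_filter; apply: sub_count => p /=.
  by case/andP.
Qed.

(* A new unit clause removes at most [4 * L] ordered pairs, so it lowers [phi] by at least
   [2 * L], and a new pair lowers it by 1: every branching lowers [phi] on one side by at least 1
   and on the other side by at least [2 * L * L], while [phi <= 6 * L * m]. *)
Definition phi (F : form) : nat := 6 * L * (m - size F.1) - size F.2.1.

Lemma wf_sizeU F : wf F -> size F.1 <= m.
Proof.
move=> [U0 Um _ _ _ _ _]; rewrite -[m in _ <= m](size_iota 0); apply: uniq_leq_size => // x /Um.
by rewrite mem_iota.
Qed.

Lemma wf_sizeP F : wf F -> size F.2.1 <= 2 * L * (m - size F.1).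
Proof.
move=> w; have [U0 Um _ Pm _ _ dg] := w.
have e : m - size F.1 = size [seq x <- iota 0 m | x \notin F.1].
  have h1 := count_predC (mem F.1) (iota 0 m); rewrite size_iota in h1.
  have h2 : count (mem F.1) (iota 0 m) = size F.1.
    rewrite -size_filter; apply/perm_size/uniq_perm => //; first exact/filter_uniq/iota_uniq.
    move=> x; rewrite mem_filter mem_iota /= add0n.
    by case hx : (x \in F.1) => //=; rewrite (Um _ hx).
  rewrite size_filter -h2 -{1}h1 addKn; apply: eq_count => x //.
rewrite e; apply: (size_by_key (f := fst)) => // p /Pm[h1 h2 _ _].
by rewrite mem_filter h2 mem_iota /= add0n.
Qed.

Lemma count_swap F a : wf F -> count (fun p => p.2 == a) F.2.1 = count (fun p => p.1 == a) F.2.1.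
Proof.
move=> [_ _ P0 Pm _ _ _].
have hs (p : nat * nat) : (p.2, p.1) \in F.2.1 -> p \in F.2.1.
  by case: p => x y /Pm[].
have h : perm_eq F.2.1 [seq (p.2, p.1) | p <- F.2.1].
  apply: uniq_perm => //; first by rewrite map_inj_uniq // => -[x y] [x' y'] [-> ->].
  move=> p; apply/idP/mapP => [pP|[q /Pm[_ _ _ h] ->] //].
  by exists (p.2, p.1); [case: (Pm _ pP) | case: (p)].
by rewrite (permP h) count_map.
Qed.

Lemma phi_units W F : wf F -> wf (add_clauses W [::] F) ->
  phi (add_clauses W [::] F) + 2 * L * size W <= phi F.
Proof.
move=> w w'; have hU := wf_sizeU w'; have hP := wf_sizeP w; move: hU.
rewrite /phi /add_clauses /= size_cat size_filter => hU.
set P := F.2.1; set keep := count _ _.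
have hk : size P <= keep + 4 * L * size W.
  rewrite -(count_predC (fun p => (p.1 \notin W ++ F.1) && (p.2 \notin W ++ F.1)) P) -/keep leq_add2l.
  (* A pair is lost through its first or its second literal. By [count_swap] both positions obey the
     degree bound [2 L], so a new unit costs at most [4 L] pairs. *)
  have hc (V : seq nat) (f : nat * nat -> nat) : (forall a, count (fun p => f p == a) P <= 2 * L) ->
      count (fun p => f p \in V) P <= 2 * L * size V.
    move=> hf; elim: V => [|a V IH]; first by rewrite (eq_count (a2 := pred0)) ?count_pred0.
    rewrite /= mulnS; apply: leq_trans (leq_add (hf a) IH).
    rewrite -count_predUI; apply: leq_trans (leq_addr _ _).
    by apply: sub_count => p /=; rewrite inE.
  have h1 := hc W fst (wf_deg w).
  have h2 := hc W snd (fun a => leq_trans (eq_leq (count_swap a w)) (wf_deg w a)).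
  apply: (@leq_trans (count (fun p => p.1 \in W) P + count (fun p => p.2 \in W) P)).
    rewrite -count_predUI; apply: leq_trans (leq_addr _ _).
    rewrite -!size_filter; apply: uniq_leq_size; first exact/filter_uniq/(wf_P w).
    move=> p; rewrite !mem_filter => /andP[/= h pP]; rewrite pP andbT /=.
    have [_ n1 n2 _] := wf_Pm w pP.
    by move: h; rewrite !mem_cat !(negbTE n1) !(negbTE n2) !orbF negb_and !negbK.
  by apply: leq_trans (leq_add h1 h2) _; lia.
(* From here on everything is linear in [x] and [y]; [hP] keeps the truncated subtraction in [phi]
   exact. *)
have e : m - size F.1 = (m - (size W + size F.1)) + size W by lia.
rewrite e in hP *; rewrite !mulnDr in hP *.
pose x := L * (m - (size W + size F.1)); pose y := L * size W.
have e1 k : k * L * (m - (size W + size F.1)) = k * x by rewrite -mulnA.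
have e2 k : k * L * size W = k * y by rewrite -mulnA.
move: hk hP; rewrite !e1 !e2 -/P; lia.
Qed.

Lemma phi_pairs Q F : wf F -> wf (add_clauses [::] Q F) ->
  {in Q, forall p, p.1 \notin F.1 /\ p.2 \notin F.1} ->
  phi (add_clauses [::] Q F) + size Q <= phi F.
Proof.
move=> w w' hQ; have hP' := wf_sizeP w'; move: hP'; rewrite /phi /add_clauses /=.
have -> : [seq p <- Q ++ F.2.1 | (p.1 \notin F.1) && (p.2 \notin F.1)] = Q ++ F.2.1.
  apply/all_filterP/allP => p; rewrite mem_cat => /orP[/hQ[-> ->] //|/(wf_Pm w)[_ -> -> _] //].
rewrite size_cat => h.
have : 2 * L * (m - size F.1) <= 6 * L * (m - size F.1) by rewrite !leq_mul2r !orbT.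
lia.
Qed.

Lemma hearts2_nil F a : hearts2 L F = [::] -> size (petals2 F a) < L.
Proof.
move=> h; rewrite ltnNge; apply/negP => hL.
have : a \in hearts2 L F; last by rewrite h.
rewrite mem_filter hL /=; move: hL; rewrite size_petals2 => hL.
have : has (fun p => p.1 == a) F.2.1 by rewrite has_count; lia.
by move=> /hasP[p pP /eqP <-]; apply: map_f.
Qed.

Lemma hearts3_nil F ab : hearts3 L F = [::] -> size (petals3 F ab) < L.
Proof.
move=> h; rewrite ltnNge; apply/negP => hL.
have : ab \in hearts3 L F; last by rewrite h.
rewrite mem_filter hL /=; move: hL; rewrite size_petals3 => hL.
have : has (fun c => c.1 == ab) F.2.2 by rewrite has_count; lia.
by move=> /hasP[p pP /eqP <-]; apply: map_f.
Qed.

Lemma hearts32_nil F a : hearts32 L F = [::] -> size (petals32 F a) < 2 * L * L.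
Proof.
move=> h; rewrite ltnNge; apply/negP => hL.
have : a \in hearts32 L F; last by rewrite h.
rewrite mem_filter hL /=; move: hL; rewrite size_petals32 => hL.
have : has (fun c => c.1.1 == a) F.2.2 by rewrite has_count; apply: leq_trans hL; rewrite !muln_gt0 L_gt0.
by move=> /hasP[p pP /eqP <-]; apply: map_f.
Qed.

Lemma wf_lits F x y z : wf F -> (x, y, z) \in F.2.2 ->
  [/\ x < m /\ x \notin F.1, y < m /\ y \notin F.1 & z < m /\ z \notin F.1].
Proof.
move=> w h; have [/= a1 a2 _ _ [h1 h2]] := wf_Tm w h.
have [/= b1 b2 _ _ _] := wf_Tm w h1.
have [/= _ _ _ _ [h3 _]] := wf_Tm w h2.
by have [/= c1 c2 _ _ _] := wf_Tm w h3.
Qed.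

(** The priorities preserve [wf_deg]. Pairs are added only when [hearts2] is empty, so each literal
    is in fewer than [L] old pairs; a ternary heart of one literal is used only when [hearts3] is
    empty, so each literal gets fewer than [L] new pairs. *)
Lemma wf_branch F FF : wf F -> branch L F = Some FF ->
  [/\ wf FF.1, wf FF.2, phi FF.1 + 1 <= phi F & phi FF.2 + 2 * L * L <= phi F].
Proof.
pose ok W Q k := wf (add_clauses W Q F) /\ phi (add_clauses W Q F) + k <= phi F.
move=> w; have [U0 Um P0 Pm T0 Tm dg] := w.
have units W : uniq W -> {in W, forall x, x < m /\ x \notin F.1} ->
    ok W [::] (2 * L * size W).
  move=> uW hW; have w' : wf (add_clauses W [::] F) by apply: wf_add.
  by split=> //; apply: phi_units.
have pairs Q : uniq Q -> {in Q, forall p, [/\ p.1 < m, p \notin F.2.1 & (p.2, p.1) \in Q]} ->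
    (forall a, count (fun p => p.1 == a) (Q ++ F.2.1) <= 2 * L) ->
    {in Q, forall p, p.1 \notin F.1 /\ p.2 \notin F.1} ->
    ok [::] Q (size Q).
  move=> uQ hQ hd hU; have w' : wf (add_clauses [::] Q F) by apply: wf_add.
  by split=> //; apply: phi_pairs.
have light k x : k + 2 * L * 1 <= x -> k + 1 <= x by lia.
have heavy k s x : k + 2 * L * s <= x -> L <= s -> k + 2 * L * L <= x.
  by move=> h hs; apply: leq_trans h; rewrite leq_add2l leq_mul2l hs orbT.
rewrite /branch; case e1 : (hearts2 L F) => [|a r]; last first.
  have [/mapP[[a' y0] pP /= ea] hL] := mem_head_filter e1; subst a'.
  have [/= a1 a2 _ _] := Pm _ pP.
  have [w1 f1] : ok [:: a] [::] (2 * L * 1).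
    by apply: units => // x; rewrite inE => /eqP ->.
  have [w2 f2] : ok (petals2 F a) [::] (2 * L * size (petals2 F a)).
    apply: units.
      by apply: uniq_map_filter => // -[x y] [x' y'] /= -> ->.
    move=> y /mapP[[x y'] /=]; rewrite mem_filter => /andP[_ pP'] ->.
    have [_ _ /= h1 h2] := Pm _ pP'; have [/= h3 _ _ _] := Pm _ h2; by [].
  by move=> [<-]; split; [exact: w1 | exact: w2 | exact: light f1 | exact: heavy f2 hL].
case e2 : (hearts3 L F) => [|ab r]; last first.
  have [/mapP[[[a b] c0] cT /= eab] hL] := mem_head_filter e2; subst ab.
  have [[a1 a2] [b1 b2] _] := wf_lits w cT.
  have [/= _ _ hab habP [h12 _]] := Tm _ cT.
  have habP' : (b, a) \notin F.2.1 by apply: contra habP => /Pm[].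
  have [w1 f1] : ok [::] [:: (a, b); (b, a)] 2.
    apply: (pairs [:: (a, b); (b, a)]).
    - by rewrite /= inE andbT; apply: contra hab => /eqP[-> _].
    - by move=> p; rewrite !inE => /orP[] /eqP -> /=; rewrite ?eqxx ?orbT.
    - move=> x; have := hearts2_nil x e1; rewrite size_petals2 /=.
      set n := count _ _ => hn; apply: (@leq_trans (1 + (1 + n))); first by rewrite !leq_add // leq_b1.
      by rewrite mul2n -addnn; apply: leq_trans (leq_add hn L_gt0); rewrite addn1.
    - by move=> p; rewrite !inE => /orP[] /eqP ->.
  have [w2 f2] : ok (petals3 F (a, b)) [::] (2 * L * size (petals3 F (a, b))).
    apply: units.
      by apply: (uniq_map_filter (f := fun c : lit3 => c.2) (g := fun c : lit3 => c.1)) => // -[x y] [x' y'] /= -> ->.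
    move=> y /mapP[[[x y'] z] /=]; rewrite mem_filter => /andP[_ cT'] ->.
    by have [_ _ []] := wf_lits w cT'.
  by move=> [<-]; split; [exact: w1 | exact: w2 | exact: leq_trans (leq_add (leqnn _) (ltnW (ltnSn 1))) f1 | exact: heavy f2 hL].
case e3 : (hearts32 L F) => [|a r] //.
have [/mapP[[[a' b0] c0] cT /= ea] hL] := mem_head_filter e3; subst a'.
have [[a1 a2] _ _] := wf_lits w cT.
have [w1 f1] : ok [:: a] [::] (2 * L * 1).
  by apply: units => // x; rewrite inE => /eqP ->.
have memQ p : (p \in petals32 F a) = ((a, p.1, p.2) \in F.2.2).
  apply/mapP/idP => [[[[x y] z]]|h]; first by rewrite mem_filter /= => /andP[/eqP <- h] ->.
  by exists (a, p.1, p.2); [rewrite mem_filter eqxx | case: (p)].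
have [w2 f2] : ok [::] (petals32 F a) (size (petals32 F a)).
  apply: pairs.
  - by apply: (uniq_map_filter (f := fun c : lit3 => (c.1.2, c.2)) (g := fun c : lit3 => c.1.1)) => // -[[x y] z] [[x' y'] z'] /= [-> ->] ->.
  - move=> [x y]; rewrite memQ /= => h; have [_ [h1 _] _] := wf_lits w h.
    have [/= _ _ _ _ [h12 h23]] := Tm _ h; split=> //.
      have [/= _ _ _ _ [_ h3]] := Tm _ h12.
      by have [] := Tm _ h3.
    by rewrite memQ.
  - move=> x; rewrite count_cat.
    have h1 := hearts2_nil x e1; have h2 := hearts3_nil (a, x) e2; rewrite size_petals2 in h1.
    rewrite size_petals3 in h2.
    (* The new pairs starting with [x] are the triples starting with [a, x], that is, the petals of
       the pair [(a, x)]. *)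
    have -> : count (fun p => p.1 == x) (petals32 F a) = count (fun c => c.1 == (a, x)) F.2.2.
      rewrite count_map count_filter; apply: eq_count => -[[u v] z] /=.
      by rewrite xpair_eqE andbC.
    by apply: leq_trans (leq_add (ltnW h2) (ltnW h1)) _; lia.
  - move=> [x y]; rewrite memQ /= => h; by have [_ [_ h1] [_ h2]] := wf_lits w h.
by move=> [<-]; split; [exact: w1 | exact: w2 | exact: light f1 | exact: leq_trans (leq_add (leqnn _) hL) f2].
Qed.

Lemma leaf_size F : wf F -> branch L F = None ->
  size (leaf_clauses F) <= m * (1 + 2 * L + 2 * L * L).
Proof.
move=> w; rewrite /branch.
case e1 : (hearts2 L F) => [|a r] //; case e2 : (hearts3 L F) => [|a r] //.
case e3 : (hearts32 L F) => [|a r] // _.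
rewrite /leaf_clauses !size_cat !size_map.
have hU := wf_sizeU w; have hP := wf_sizeP w.
have hT : size F.2.2 <= 2 * L * L * size (iota 0 m).
  apply: (size_by_key (f := fun c : lit3 => c.1.1)).
    by move=> [[x y] z] /(wf_lits w)[[h _] _ _]; rewrite mem_iota.
  by move=> k; have := hearts32_nil k e3; rewrite size_petals32 => /ltnW.
rewrite size_iota in hT.
have : 2 * L * (m - size F.1) <= 2 * L * m by rewrite leq_mul2l leq_subr orbT.
have -> : m * (1 + 2 * L + 2 * L * L) = m + 2 * L * m + 2 * L * L * m.
  by lia.
by lia.
Qed.

Section Terminate.
Variables (M : TM) (t B : nat).
Hypothesis leaf_fast : forall F, wf F -> branch L F = None ->
  simulate M B (enc_vc (vc_of t (leaf_clauses F))) <> None.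

(** The formulas [fs] below [F] on the search stack are untouched until [F] is finished, and the
    step count is independent of them; so the counts of two sibling subtrees add up. *)
Lemma search_visits k : forall F, wf F -> phi F <= k ->
  exists2 n, n <= node_bound (2 * L * L) k & forall fs,
    iter n (search_step M t B L) (F :: fs, 0) = (fs, 0) \/
    iter n (search_step M t B L) (F :: fs, 0) = ([::], 1).
Proof.
have H0 : 0 < 2 * L * L by rewrite !muln_gt0 L_gt0.
elim/ltn_ind: k => k IH F w hk.
case e : (branch L F) => [FF|].
  have [w1 w2 p1 p2] := wf_branch w e.
  have [n1 h1 it1] := IH k.-1 ltac:(lia) FF.1 w1 ltac:(lia).
  have [n2 h2 it2] := IH (k - 2 * L * L) ltac:(lia) FF.2 w2 ltac:(lia).
  exists (n2 + n1 + 1).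
    apply: leq_trans (node_bound_step H0 (_ : 2 * L * L <= k)); lia.
  have stop n : iter n (search_step M t B L) ([::], 1) = ([::], 1) by exact: iter_fix.
  move=> fs; rewrite addn1 iterSr {2 4}/search_step /= e /= iterD.
  case: (it1 (FF.2 :: fs)) => ->; last by right.
  exact: it2.
exists 1; first exact: node_bound_gt0.
move=> fs; rewrite /= /search_step /= e.
have := leaf_fast w e; case: (simulate _ _ _) => [[]|] //= _; by [left|right].
Qed.

Lemma search_done F : wf F -> node_bound (2 * L * L) (phi F) <= B ->
  let s := search M t B F L in nilp s.1 && (s.2 != 2).
Proof.
move=> w hB /=; have [n hn it] := search_visits w (leqnn _).
have e : search M t B F L =
    iter (B - n) (search_step M t B L) (iter n (search_step M t B L) ([:: F], 0)).
  by rewrite -iterD subnK //; apply: leq_trans hn hB.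
by rewrite e; case: (it [::]) => ->; rewrite iter_fix.
Qed.
End Terminate.
End Sparsify.

(** * The initial formula is well formed *)

Lemma mem_perms3 x y z c : (x, y, z) \in perms3 c ->
  (y, x, z) \in perms3 c /\ (x, z, y) \in perms3 c.
Proof.
case: c => [[a b] e]; rewrite /perms3 /= !inE.
by case/orP=> [|/orP[|/orP[|/orP[|/orP[|]]]]] /eqP[-> -> ->]; rewrite !eqxx ?orbT.
Qed.

Lemma strict_clause_lits N c c' : c.1.1 < 2 * N -> c.1.2 < 2 * N -> c.2 < 2 * N ->
  c' \in strict_clause N c ->
  [/\ c'.1.1 < 2 * N + 4, c'.1.2 < 2 * N + 4 & c'.2 < 2 * N + 4] /\
  [/\ c'.1.1 != c'.1.2, c'.1.1 != c'.2 & c'.1.2 != c'.2].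
Proof.
case: c => [[a b] e] /= ha hb he; rewrite /strict_clause /=.
case: (a =P b) => [eab|/eqP nab]; case: (b =P e) => [ebe|/eqP nbe] /=;
  try case: (a =P e) => [eae|/eqP nae] /=; rewrite !inE;
  repeat (case/orP); move=> /eqP -> /=; split; split; lia.
Qed.

(** The two fresh variables of the padding account for the four literal codes beyond [2 * N]. *)
Lemma init_form_wf N L cs :
  {in cs, forall c, [/\ c.1.1 < 2 * N, c.1.2 < 2 * N & c.2 < 2 * N]} ->
  wf (2 * N + 4) L (init_form N cs).
Proof.
move=> h; split=> //=; first exact: undup_uniq.
move=> [[x y] z]; rewrite mem_undup => /flatten_mapP[c' /flatten_mapP[c hc hc'] hp].
have [h1 h2 h3] := h _ hc.
have [[l1 l2 l3] [n1 n2 n3]] := strict_clause_lits h1 h2 h3 hc'.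
have [hp1 hp2] := mem_perms3 hp.
have inT q : q \in perms3 c' -> q \in undup (flatten [seq perms3 c | c <- flatten [seq strict_clause N c | c <- cs]]).
  move=> hq; rewrite mem_undup; apply/flatten_mapP; exists c' => //.
  by apply/flatten_mapP; exists c => //.
have [p1 p2] : x < 2 * N + 4 /\ x != y.
  case: c' hp l1 l2 l3 n1 n2 n3 {h1 h2 h3 hc' hp1 hp2 inT} => [[a b] e] /=; rewrite /perms3 /= !inE => hp.
  by move: hp; case/orP=> [|/orP[|/orP[|/orP[|/orP[|]]]]] /eqP[-> -> _] *; split=> //; rewrite eq_sym.
by split=> //=; split; apply: inT.
Qed.

(** * Counting lemmas *)

Lemma size_count_sub (T : eqType) (P : pred T) (l S : seq T) :
  uniq l -> {subset l <= S} -> all P l -> size l <= count P S.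
Proof.
move=> ul sl al; rewrite -size_filter; apply: uniq_leq_size => // x xl.
by rewrite mem_filter (allP al _ xl) sl.
Qed.

Lemma count_hasN (T : Type) (P : pred T) s : ~~ has P s -> count P s = 0.
Proof. by rewrite has_count -leqNgt leqn0 => /eqP. Qed.

Lemma sum_count_disjoint (P : nat -> pred nat) n (S : seq nat) :
  (forall y, \sum_(x < n) P x y <= 1) -> \sum_(x < n) count (P x) S <= size S.
Proof.
move=> h; elim: S => [|y S IH] /=; first by rewrite big1.
by rewrite big_split /= -add1n leq_add.
Qed.

Lemma sum_indicator_le1 (P : nat -> bool) n :
  (forall x y, x < n -> y < n -> P x -> P y -> x = y) -> \sum_(x < n) P x <= 1.
Proof.
move=> h; case: (pickP (fun x : 'I_n => P x)) => [x0 hx|h0]; last first.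
  by rewrite big1 // => x _; rewrite h0.
rewrite (bigD1 x0) //= hx big1 // => x nx.
case hP : (P x) => //; case/eqP: nx; apply: val_inj; exact: h hP hx.
Qed.

Lemma uniq_flatten_key (X : eqType) (Y : eqType) (f : X -> seq Y) (key : Y -> X) (s : seq X) :
  uniq s -> {in s, forall x, uniq (f x)} -> {in s, forall x, {in f x, forall y, key y = x}} ->
  uniq (flatten (map f s)).
Proof.
elim: s => //= x s IH /andP[nx us] hu hk.
rewrite cat_uniq hu ?inE ?eqxx //= IH //.
- rewrite andbT; apply/hasPn => y /flatten_mapP[x' hx' hy]; apply/negP => hy'.
  have e1 := hk x (mem_head _ _) y hy'.
  have e2 : key y = x' by apply: hk hy; rewrite inE hx' orbT.
  by move: nx; rewrite -e1 e2 hx'.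
- by move=> z hz; apply: hu; rewrite inE hz orbT.
- by move=> z hz; apply: hk; rewrite inE hz orbT.
Qed.

Lemma count_flatten_map (X Y : Type) (f : X -> seq Y) (p : pred Y) s :
  count p (flatten (map f s)) = sumn [seq count p (f x) | x <- s].
Proof. by elim: s => //= x s IH; rewrite count_cat IH. Qed.

Lemma sumn_eq0 (X : eqType) (f : X -> nat) s : {in s, forall x, f x = 0} -> sumn (map f s) = 0.
Proof.
elim: s => //= x s IH h; rewrite h ?inE ?eqxx // IH // => y hy.
by apply: h; rewrite inE hy orbT.
Qed.

Lemma sumn_single (f : nat -> nat) s x0 K : uniq s -> (f x0 <= K) ->
  {in s, forall x, x != x0 -> f x = 0} -> sumn (map f s) <= K.
Proof.
move=> us h0 h; elim: s us h => //= x s IH /andP[nx us] h.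
case: (x =P x0) => [e|/eqP ne].
  rewrite sumn_eq0 ?addn0 ?e // => y hy; apply: h; first by rewrite inE hy orbT.
  by apply: contraNneq nx => ey; rewrite e -ey.
rewrite h ?inE ?eqxx // add0n IH // => y hy; apply: h; by rewrite inE hy orbT.
Qed.

(** Degree in a multigraph: a loop would count twice, as it does after subdivision. *)
Definition incidence (v : nat) (E : seq (nat * nat)) : nat :=
  sumn [seq (e.1 == v) + (e.2 == v) | e <- E].

(** * Subdividing every edge *)

Section Subdivision.
Variables (t nv : nat) (E0 : seq (nat * nat)).
Hypothesis t0 : 0 < t.
Hypothesis E0v : {in E0, forall e, e.1 < nv /\ e.2 < nv}.
Notation E := (subdivide t nv E0).
Notation off x := (nv + x * (2 * t)).
Notation edge x := (nth (0, 0) E0 x).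

Lemma edge_lt x : x < size E0 -> [/\ (edge x).1 < nv, (edge x).2 < nv & nv <= off x].
Proof. by move=> h; have [] := E0v (mem_nth (0, 0) h); split=> //; apply: leq_addr. Qed.

Lemma subpathP o e (p : nat * nat) : reflect
  [\/ p = (e.1, o), p = (e.2, o + (2 * t - 1)) |
      exists2 i, i < 2 * t - 1 & p = (o + i, o + i + 1)] (p \in subpath t o e).
Proof.
rewrite /subpath !inE; apply: (iffP or3P).
  case=> [/eqP ->|/eqP ->|/mapP[i]]; [by constructor 1|by constructor 2|].
  by rewrite mem_iota /= add0n => hi ->; constructor 3; exists i.
case=> [->|->|[i hi ->]]; [by constructor 1|by constructor 2|constructor 3].
by apply/mapP; exists i; rewrite ?mem_iota.
Qed.

Lemma subdivideP (p : nat * nat) : reflect (exists2 x, x < size E0 & p \in subpath t (off x) (edge x)) (p \in E).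
Proof.
apply: (iffP flatten_mapP) => -[x hx hp]; exists x => //; by rewrite mem_iota in hx *.
Qed.

Lemma subpath_snd o e (p : nat * nat) : p \in subpath t o e -> o <= p.2 < o + 2 * t.
Proof. by move=> /subpathP[->|->|[i hi ->]] /=; lia. Qed.

Lemma subpath_key x (p : nat * nat) : p \in subpath t (off x) (edge x) -> (p.2 - nv) %/ (2 * t) = x.
Proof.
move=> /subpath_snd h; have -> : p.2 - nv = x * (2 * t) + (p.2 - off x) by lia.
by rewrite divnMDl ?muln_gt0 // divn_small ?addn0 //; lia.
Qed.

(** The second end of every new edge lies among the new vertices of its path and determines the
    path. So repeated edges of [E0] are separated, and simplicity of the base graph need not be
    established. *)
Lemma subdivide_simple : simple_graph (nv + size E0 * (2 * t)) E.
Proof.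
apply/andP; split.
  apply: (uniq_flatten_key (key := fun p => (p.2 - nv) %/ (2 * t))).
  - exact: iota_uniq.
  - move=> x; rewrite mem_iota add0n /= => hx; have [h1 h2 nvo] := edge_lt hx.
    rewrite /subpath /= !inE !negb_or map_inj_uniq ?iota_uniq ?andbT; last first.
      by move=> i j [] /addnI.
    have hn k : k < nv -> forall l, (k, l) \notin [seq (off x + i, off x + i + 1) | i <- iota 0 (2 * t - 1)].
      by move=> hk l; apply/mapP => -[i _ [e _]]; lia.
    rewrite !hn // !andbT; apply/eqP => -[_]; lia.
  - by move=> x _ p; apply: subpath_key.
apply/allP => p /subdivideP[x hx hp]; have [h1 h2 nvo] := edge_lt hx; have h := subpath_snd hp.
have h3 : off x + 2 * t <= nv + size E0 * (2 * t).
  by rewrite -addnA leq_add2l addnC -mulSn leq_mul2r hx orbT.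
rewrite /=; apply/andP; split; last by case/andP: h => _ h; exact: leq_trans h h3.
by case/subpathP: hp => [->|->|[i hi ->]] /=; lia.
Qed.

Definition touches (v : nat) (e : nat * nat) : bool := (e.1 == v) || (e.2 == v).

Lemma touches_base v x : x < size E0 -> v < nv ->
  count (touches v) (subpath t (off x) (edge x)) = ((edge x).1 == v) + ((edge x).2 == v).
Proof.
move=> hx hv; rewrite /= /touches /= addnA.
have -> : (off x == v) = false by apply/eqP; lia.
have -> : (off x + (2 * t - 1) == v) = false by apply/eqP; lia.
rewrite !orbF -[RHS]addn0; congr (_ + _); apply: count_hasN.
by apply/hasPn => p /mapP[i _ ->] /=; rewrite negb_or; apply/andP; split; apply/eqP; lia.
Qed.

Lemma touches_path x i : x < size E0 -> i < 2 * t -> count (touches (off x + i)) E <= 2.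
Proof.
move=> hx hi; rewrite count_flatten_map.
apply: (@sumn_single _ _ x); first exact: iota_uniq.
  have [h1 h2 nvo] := edge_lt hx; rewrite /= /touches /=.
  have -> : ((edge x).1 == off x + i) = false by apply/eqP; lia.
  have -> : ((edge x).2 == off x + i) = false by apply/eqP; lia.
  rewrite count_map /=.
  have -> : (off x == off x + i) = (i == 0) by apply/eqP/eqP; lia.
  have -> : (off x + (2 * t - 1) == off x + i) = (i == 2 * t - 1) by apply/eqP/eqP; lia.
  have : count (preim (fun i0 => (off x + i0, off x + i0 + 1))
     (fun e : nat * nat => (e.1 == off x + i) || (e.2 == off x + i))) (iota 0 (2 * t - 1)) <=
     (i < 2 * t - 1) + (0 < i).
    apply: (@leq_trans (count (pred1 i) (iota 0 (2 * t - 1)) + count (fun j => j.+1 == i) (iota 0 (2 * t - 1)))).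
      rewrite -count_predUI; apply: leq_trans (leq_addr _ _); apply: sub_count => j /=.
      by case/orP=> /eqP h; apply/orP; [left|right]; apply/eqP; lia.
    apply: leq_add; first by rewrite count_uniq_mem ?iota_uniq // mem_iota.
    case: (i) => [|i'] /=; first by rewrite (eq_count (a2 := pred0)) ?count_pred0.
    rewrite (eq_count (a2 := pred1 i')) ?count_uniq_mem ?iota_uniq ?leq_b1 //.
  by case: eqP; case: eqP; case: ltnP; case: ltnP => /=; lia.
move=> y; rewrite mem_iota add0n /= => hy nyx; have [h1 h2 nvo] := edge_lt hy.
apply: (count_hasN (s := subpath t (off y) (edge y))).
apply/hasPn => p hp; rewrite /touches negb_or.
have h := subpath_snd hp.
have hne : off y + 2 * t <= off x \/ off x + 2 * t <= off y.
  have [hl|hl|e] := ltngtP y x; last by rewrite e eqxx in nyx.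
    by left; rewrite -addnA leq_add2l addnC -mulSn leq_mul2r hl orbT.
  by right; rewrite -addnA leq_add2l addnC -mulSn leq_mul2r hl orbT.
apply/andP; split; apply/eqP; last by case/andP: h => ha hb e; rewrite e in ha hb; lia.
by case/subpathP: hp {h} => [->|->|[j hj ->]] /=; lia.
Qed.

Lemma path_vertex v : nv <= v -> v < nv + size E0 * (2 * t) ->
  exists x i, [/\ x < size E0, i < 2 * t & v = off x + i].
Proof.
move=> h1 h2; have h0 : 0 < 2 * t by rewrite muln_gt0.
exists ((v - nv) %/ (2 * t)), ((v - nv) %% (2 * t)); split.
- by rewrite ltn_divLR //; lia.
- by rewrite ltn_mod.
- by rewrite -addnA -divn_eq; lia.
Qed.

Lemma subdivide_degree : (forall v, v < nv -> incidence v E0 <= 3) ->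
  max_degree_le3 (nv + size E0 * (2 * t)) E.
Proof.
move=> hd v hv; case: (ltnP v nv) => h; last first.
  have [x [i [hx hi ->]]] := path_vertex h hv.
  exact: leq_trans (touches_path hx hi) _.
apply: leq_trans (hd v h); rewrite -/(touches v) count_flatten_map /incidence.
rewrite -[in X in _ <= sumn (map _ X)](mkseq_nth (0, 0) E0) /mkseq -map_comp.
rewrite leq_eqVlt; apply/orP; left; apply/eqP; congr sumn; apply/eq_in_map => x.
by rewrite mem_iota add0n => hx; apply: touches_base.
Qed.

(** A path vertex has degree at most 2 in the whole graph; a set without path vertices is
    independent. *)
Lemma subdivide_2degenerate : two_degenerate (nv + size E0 * (2 * t)) E.
Proof.
move=> X X0 /allP hX; case: (boolP (has (fun v => nv <= v) X)) => [/hasP[v vX hv]|/hasPn hb].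
  have [x [i [hx hi e]]] := path_vertex hv (hX _ vX).
  exists v => //; rewrite e; apply: leq_trans (touches_path hx hi).
  by apply: sub_count => p /andP[/andP[]].
case: X X0 hX hb => // v X _ hX hb; exists v; first exact: mem_head.
rewrite /degree_in count_hasN //; apply/hasPn => p /subdivideP[x hx /subpath_snd h]; apply/negP => /andP[_ hp].
by have := hb _ hp; have := leq_addr (x * (2 * t)) nv; case/andP: h => h _ h1; rewrite (leq_trans h1 h).
Qed.

Lemma adj_path x i w : x < size E0 -> i < 2 * t -> adj E (off x + i) w ->
  w = (if i is i'.+1 then off x + i' else (edge x).1) \/
  w = (if i == 2 * t - 1 then (edge x).2 else off x + i.+1).
Proof.
move=> hx hi; have [h1 h2 nvo] := edge_lt hx.
have key y (p : nat * nat) : y < size E0 -> p \in subpath t (off y) (edge y) -> (p.1 == off x + i) || (p.2 == off x + i) -> y = x.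
  move=> hy hp hp'; have hk := subpath_key hp; have [g1 g2 nvy] := edge_lt hy.
  have q0 : 0 < 2 * t by rewrite muln_gt0.
  have hq z : z - nv = x * (2 * t) + i -> (z - nv) %/ (2 * t) = x.
    by move=> ->; rewrite divnMDl // divn_small // addn0.
  case/orP: hp' => /eqP e; last by rewrite -hk hq // e; lia.
  case/subpathP: hp hk e => [->|->|[j hj ->]] /= hk e; try lia.
  have ej : (off y + j - nv) %/ (2 * t) = y.
    by rewrite (_ : off y + j - nv = y * (2 * t) + j) ?divnMDl ?divn_small ?addn0 //; lia.
  by rewrite -ej hq // e; lia.
case/orP=> /subdivideP[y hy hp].
  have e : y = x by apply: (key y _ hy hp); rewrite eqxx.
  subst y; case/subpathP: hp => [[e _]|[e _]|[j hj [e ->]]]; try lia.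
  by right; case: eqP; lia.
have e : y = x by apply: (key y _ hy hp); rewrite eqxx orbT.
subst y; case/subpathP: hp => [[-> e]|[-> e]|[j hj [-> e]]].
- by left; case: (i) e => //; lia.
- by right; case: eqP; lia.
- by left; case: (i) e; lia.
Qed.

Lemma cycle_neighbors (e : rel nat) c v : uniq c -> 3 <= size c -> cycle e c -> v \in c ->
  exists a b, [/\ a \in c, b \in c, a != b, e v a & e b v].
Proof.
move=> uc sc cc vc; have [i p ep] := rot_to vc.
have hp : uniq (v :: p) by rewrite -ep rot_uniq.
have cp : cycle e (v :: p) by rewrite -ep rot_cycle.
have sp : 2 <= size p by move: sc; rewrite -(size_rot i c) ep.
have mp z : z \in p -> z \in c by move=> h; rewrite -(mem_rot i) ep inE h orbT.
case: p ep hp cp sp mp => // a p ep /= /and3P[_ na up] /andP[va]; rewrite rcons_path => /andP[_ lv] sp mp.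
exists a, (last a p); split=> //.
- by apply: mp; rewrite mem_head.
- by apply: mp; apply: mem_last.
- apply: contraNneq na => e1; case: p sp e1 {mp lv up ep} => //= b p _ e1.
  by rewrite {1}e1 mem_last.
Qed.

(** Every edge has an end on some path, and a path vertex has at most two neighbours, both of which
    a cycle through it must use. So the cycle swallows the entire path of [2 t] vertices. *)
Lemma subdivide_girth : girth_ge (2 * t) E.
Proof.
move=> c uc sc cc; have symE u w : adj E u w = adj E w u by rewrite /adj orbC.
have nb x i : x < size E0 -> i < 2 * t -> off x + i \in c ->
    (if i is i'.+1 then off x + i' else (edge x).1) \in c /\
    (if i == 2 * t - 1 then (edge x).2 else off x + i.+1) \in c.
  move=> hx hi hc; have [a [b [ac bc nab va]]] := cycle_neighbors uc sc cc hc.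
  rewrite symE => vb; move: ac bc nab.
  case: (adj_path hx hi va) => ->; case: (adj_path hx hi vb) => -> //; rewrite ?eqxx //.
have [x [i [hx hi hc]]] : exists x i, [/\ x < size E0, i < 2 * t & off x + i \in c].
  have [v vc] : exists v, v \in c by case: c sc {uc cc nb} => // v c _; exists v; apply: mem_head.
  have [a [b [ac _ _ va _]]] := cycle_neighbors uc sc cc vc.
  have pick (p : nat * nat) : p \in E -> p.2 \in c -> exists x i, [/\ x < size E0, i < 2 * t & off x + i \in c].
    move=> /subdivideP[x hx /subpath_snd h] pc; exists x, (p.2 - off x); split=> //; first by lia.
    by rewrite subnKC //; lia.
  by case/orP: va => /pick; apply.
have up k : i + k < 2 * t -> off x + (i + k) \in c.
  elim: k => [|k IH] h; first by rewrite addn0.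
  have hk : i + k < 2 * t by lia.
  have [_] := nb x _ hx hk (IH hk); rewrite [i + k.+1]addnS; case: eqP => // e; exfalso; lia.
have down k : k <= i -> off x + (i - k) \in c.
  elim: k => [|k IH] h; first by rewrite subn0.
  have hk : i - k < 2 * t by lia.
  have [+ _] := nb x _ hx hk (IH (ltnW h)); have -> : i - k = (i - k.+1).+1 by lia.
  by [].
rewrite -(size_iota (off x) (2 * t)); apply: uniq_leq_size; first exact: iota_uniq.
move=> z; rewrite mem_iota => hz; case: (leqP i (z - off x)) => h.
  have := up (z - off x - i); rewrite subnKC // subnKC; last by lia.
  by apply; lia.
have := down (i - (z - off x)); rewrite subKn; last by lia.
by rewrite subnKC; [apply; lia | lia].
Qed.

Definition in_block (x y : nat) : bool := (off x <= y) && (y < off x + 2 * t).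

Lemma block_inj x x' y : in_block x y -> in_block x' y -> x = x'.
Proof.
have h z : in_block z y -> (y - nv) %/ (2 * t) = z.
  move=> /andP[h1 h2]; have -> : y - nv = z * (2 * t) + (y - off z) by lia.
  by rewrite divnMDl ?muln_gt0 // divn_small ?addn0 //; lia.
by move=> /h <- /h.
Qed.

(** The [2 t] path vertices carry [t] disjoint edges, which need [t] cover vertices. If both ends of
    the old edge are missing, the first and the last path vertex are forced, and [t - 1] disjoint
    edges remain between them: one vertex more. *)
Lemma block_covered S x : is_vertex_cover E S -> x < size E0 ->
  t + (((edge x).1 \notin S) && ((edge x).2 \notin S)) <= count (in_block x) S.
Proof.
move=> /allP cov hx.
have covx (p : nat * nat) : p \in subpath t (off x) (edge x) -> (p.1 \in S) || (p.2 \in S).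
  by move=> hp; apply: cov; apply/subdivideP; exists x.
have cstep i : i < 2 * t - 1 -> (off x + i \in S) || (off x + i + 1 \in S).
  by move=> hi; apply: (covx (off x + i, off x + i + 1)); apply/subpathP; constructor 3; exists i.
(* A covering end of the [i]-th of the disjoint edges that start at offset [k]: 0 for the plain
   bound, 1 between the two forced vertices. *)
pose pickv k i := if off x + (k + 2 * i) \in S then off x + (k + 2 * i) else off x + (k + 2 * i) + 1.
have pickS k i : k + 2 * i < 2 * t - 1 -> pickv k i \in S.
  by move=> /cstep; rewrite /pickv; case: ifP.
have pickB k i : off x + (k + 2 * i) <= pickv k i <= off x + (k + 2 * i) + 1.
  by rewrite /pickv; case: ifP; lia.
have pick_uniq k n : uniq [seq pickv k i | i <- iota 0 n].
  rewrite map_inj_uniq ?iota_uniq // => i j e.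
  by have := pickB k i; have := pickB k j; rewrite e; lia.
case: andP => [[n1 n2]|_]; last first.
  rewrite addn0 -[t](size_iota 0) -(size_map (pickv 0)); apply: size_count_sub => //.
    by move=> y /mapP[i]; rewrite mem_iota add0n => hi ->; apply: pickS; lia.
  apply/allP => y /mapP[i]; rewrite mem_iota add0n => hi ->; rewrite /in_block.
  by have := pickB 0 i; lia.
have o1 : off x \in S.
  have /covx : ((edge x).1, off x) \in subpath t (off x) (edge x) by apply/subpathP; constructor 1.
  by rewrite /= (negbTE n1).
have o2 : off x + (2 * t - 1) \in S.
  have /covx : ((edge x).2, off x + (2 * t - 1)) \in subpath t (off x) (edge x).
    by apply/subpathP; constructor 2.
  by rewrite /= (negbTE n2).
have -> : t + true = size (off x :: off x + (2 * t - 1) :: [seq pickv 1 i | i <- iota 0 (t - 1)]).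
  by rewrite /= size_map size_iota; lia.
apply: size_count_sub.
- rewrite /= pick_uniq andbT !inE negb_or -andbA; apply/and3P; split.
  + by apply/eqP; lia.
  + by apply/mapP => -[i _ e]; have := pickB 1 i; rewrite -e; lia.
  + apply/mapP => -[i]; rewrite mem_iota add0n => hi e; have := pickB 1 i; rewrite -e; lia.
- move=> y; rewrite !inE => /or3P[/eqP ->|/eqP ->|/mapP[i]] //.
  by rewrite mem_iota add0n => hi ->; apply: pickS; lia.
- rewrite /= /in_block; apply/and3P; split; try lia.
  apply/allP => y /mapP[i]; rewrite mem_iota add0n => hi ->.
  by have := pickB 1 i; lia.
Qed.

Lemma subdivide_cover k :
  (exists S, size S <= k + t * size E0 /\ is_vertex_cover E S) <->
  (exists S, size S <= k /\ is_vertex_cover E0 S).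
Proof.
split=> -[S [hS cov]].
  (* An uncovered old edge is repaired by its first end, paid for by the extra vertex in its
     block. *)
  pose bad x := ((edge x).1 \notin S) && ((edge x).2 \notin S).
  pose S0 := [seq y <- S | y < nv] ++ [seq (edge x).1 | x <- [seq x <- iota 0 (size E0) | bad x]].
  exists S0; split; last first.
    apply/allP => e eE; set x := index e E0; have hx : x < size E0 by rewrite index_mem.
    have ee : edge x = e by rewrite nth_index.
    have [h1 h2] := E0v eE.
    rewrite !mem_cat !mem_filter h1 h2 /=.
    case b : (bad x).
      have -> : e.1 \in [seq (edge x).1 | x <- [seq x <- iota 0 (size E0) | bad x]].
        by apply/mapP; exists x; rewrite ?ee // mem_filter b mem_iota.
      by rewrite orbT.
    move: b; rewrite /bad ee => /negbT; rewrite negb_and !negbK => /orP[->|->] //.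
    by rewrite orbT.
  rewrite size_cat size_map !size_filter -(leq_add2r (t * size E0)); apply: leq_trans hS.
  have e1 : count bad (iota 0 (size E0)) + t * size E0 = \sum_(x < size E0) (t + bad x).
    rewrite big_split /= sum_nat_const card_ord mulnC addnC; congr (_ + _).
    rewrite -(big_mkord xpredT (fun x => nat_of_bool (bad x))) /index_iota subn0.
    by rewrite -sum1_count big_mkcond; apply: eq_bigr => i _; case: (bad i).
  rewrite -addnA e1.
  (* The old vertices, at index 0, and the blocks, at [x + 1], are disjoint, so the counts in them
     sum to at most [size S]. *)
  pose P z := if z is x.+1 then in_block x else fun y => y < nv.
  have := @sum_count_disjoint P (size E0).+1 S.
  rewrite big_ord_recl /= => h; apply: leq_trans (h _).
    by rewrite leq_add2l; apply: leq_sum => x _; apply: block_covered cov (ltn_ord x).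
  move=> y; apply: (@sum_indicator_le1 (fun z => P z y)) => -[|x1] [|x2] _ _ //=.
  - by move=> h1 /andP[h2 _]; lia.
  - by move=> /andP[h2 _] h1; lia.
  - by move=> h1 h2; rewrite (block_inj h1 h2).
(* Every other path vertex: the odd offsets if the first end is in [S], otherwise the even ones. The
   end edge left out is then covered by the old end in [S]. *)
pose half_path x := [seq off x + (((edge x).1 \in S) + 2 * i) | i <- iota 0 t].
exists (S ++ flatten [seq half_path x | x <- iota 0 (size E0)]); split.
  rewrite size_cat leq_add // size_flatten /shape -map_comp.
  have : forall s : seq nat, sumn [seq (size \o half_path) i | i <- s] = t * size s.
    by elim=> [|x s IH] /=; rewrite ?muln0 // IH size_map size_iota mulnS.
  by move=> ->; rewrite size_iota.
apply/allP => p /subdivideP[x hx hp].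
have inS z : z \in S -> z \in S ++ flatten [seq half_path x | x <- iota 0 (size E0)].
  by rewrite mem_cat => ->.
have inH i : i < t -> off x + (((edge x).1 \in S) + 2 * i) \in S ++ flatten [seq half_path x | x <- iota 0 (size E0)].
  move=> hi; rewrite mem_cat; apply/orP; right; apply/flatten_mapP; exists x; first by rewrite mem_iota.
  by apply/mapP; exists i; rewrite ?mem_iota.
have cx : ((edge x).1 \in S) || ((edge x).2 \in S) by apply: (allP cov); apply: mem_nth.
case/subpathP: hp => [->|->|[i hi ->]] /=.
- case h1 : ((edge x).1 \in S); first by rewrite inS.
  by have := inH 0 t0; rewrite h1 /= muln0 !addn0 => ->; rewrite orbT.
- move: cx; case h1 : ((edge x).1 \in S) => /= h2; last by rewrite inS.
  have := inH (t - 1) ltac:(lia); rewrite h1 /=.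
  have -> : 1 + 2 * (t - 1) = 2 * t - 1 by lia.
  by move=> ->; rewrite orbT.
(* Of two consecutive offsets one has the parity [b] of the chosen half. *)
- set b := (edge x).1 \in S in inH *.
  have e := odd_double_half i; rewrite -mul2n in e.
  case ho : (odd i == b).
    by have := inH i./2 ltac:(lia); rewrite -(eqP ho) e => ->.
  case hb : (b) ho inH => ho inH.
    have oi : odd i = false by case: (odd i) ho.
    have := inH i./2 ltac:(lia); rewrite /= addnA (_ : off x + 1 + 2 * i./2 = off x + i + 1); last by move: e; rewrite oi /=; lia.
    by move=> ->; rewrite orbT.
  have oi : odd i = true by case: (odd i) ho.
  have := inH i.+1./2; rewrite /= add0n.
  have -> : 2 * uphalf i = i.+1 by move: e; rewrite oi uphalf_half oi; lia.
  have hu : uphalf i < t by rewrite uphalf_half oi; move: e; rewrite oi; lia.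
  by move=> /(_ hu); rewrite -(addnA _ i) addn1 => ->; rewrite orbT.
Qed.

Lemma size_subdivide : size E = size E0 * (2 * t + 1).
Proof.
rewrite size_flatten /shape -map_comp -[in RHS](size_iota 0 (size E0)).
elim: (iota 0 (size E0)) => //= x s ->; rewrite size_map size_iota mulSn.
by have -> : (2 * t - 1).+2 = 2 * t + 1 by lia.
Qed.
End Subdivision.

(** * The base graph of a list of clauses *)

Lemma size_occs cs : size (occs cs) = 3 * size cs.
Proof. by elim: cs => //= c cs IH; rewrite mulnS -IH. Qed.

Definition lit_of (c : lit3) (k : nat) : nat := if k == 0 then c.1.1 else if k == 1 then c.1.2 else c.2.

Lemma nth_occs c0 cs i k : k < 3 -> i < size cs ->
  nth 0 (occs cs) (3 * i + k) = lit_of (nth c0 cs i) k.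
Proof.
move=> hk; elim: cs i => //= c cs IH [|i] hi; first by case: (k) hk => [|[|[|?]]].
have -> : 3 * i.+1 + k = (3 * i + k).+3 by lia.
exact: IH.
Qed.

Section BaseGraph.
Variable cs : seq lit3.
Notation o := (occs cs).
Notation n := (size (occs cs)).
Notation m := (size cs).
Notation E0 := (base_edges cs).

Lemma okey_lt i j : i < n -> j < n ->
  (okey o i < okey o j) = (nth 0 o i < nth 0 o j) || ((nth 0 o i == nth 0 o j) && (i < j)).
Proof.
rewrite /okey => hi hj; set x := nth 0 o i; set y := nth 0 o j.
case: (ltngtP x y) => [h|h|->] /=; last by rewrite ltn_add2l.
  have : (x + 1) * n <= y * n by rewrite leq_mul2r; lia.
  by rewrite mulnDl mul1n; lia.
apply/negbTE; rewrite -leqNgt.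
have : (y + 1) * n <= x * n by rewrite leq_mul2r; lia.
by rewrite mulnDl mul1n; lia.
Qed.

Lemma okey_inj i j : i < n -> j < n -> okey o i = okey o j -> i = j.
Proof.
move=> hi hj e; have := okey_lt hi hj; have := okey_lt hj hi; rewrite e ltnn.
by case: (ltngtP (nth 0 o i) (nth 0 o j)) => //= _; case: (ltngtP i j).
Qed.

Lemma osuccP j i k : j < n -> i < n -> k < n -> osucc o j i ->
  okey o j < okey o k -> okey o k < okey o i -> False.
Proof.
move=> hj hi hk /and3P[_ _ /hasPn h] h1 h2.
by have := h k; rewrite mem_iota /= add0n h1 h2 => /(_ hk).
Qed.

Lemma osucc_lt j i : osucc o j i -> okey o j < okey o i.
Proof. by case/and3P. Qed.

Lemma osucc_fun j i i' : j < n -> i < n -> i' < n -> osucc o j i -> osucc o j i' -> i = i'.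
Proof.
move=> hj hi hi' h h'; apply: okey_inj => //.
case: (ltngtP (okey o i) (okey o i')) => // hk; exfalso.
  exact: (osuccP hj hi' hi h' (osucc_lt h) hk).
exact: (osuccP hj hi hi' h (osucc_lt h') hk).
Qed.

Lemma osucc_inj j j' i : j < n -> j' < n -> i < n -> osucc o j i -> osucc o j' i -> j = j'.
Proof.
move=> hj hj' hi h h'; apply: okey_inj => //.
case: (ltngtP (okey o j) (okey o j')) => // hk; exfalso.
  exact: (osuccP hj hi hj' h hk (osucc_lt h')).
exact: (osuccP hj' hi hj h' hk (osucc_lt h)).
Qed.

Lemma ochain_spec j : j < n ->
  (exists i, [/\ i < n, osucc o j i & ochain o j = [:: (n + i, j)]]) \/
  ochain o j = [::] /\ (forall i, i < n -> ~~ osucc o j i).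
Proof.
move=> hj; rewrite /ochain; case e : [seq i <- _ | _] => [|i r]; [right|left].
  split=> // i hi; apply/negP => h.
  have : i \in [seq i <- iota 0 n | osucc o j i] by rewrite mem_filter h mem_iota.
  by rewrite e.
have [] := mem_head_filter e; rewrite mem_iota add0n => hi h.
by exists i.
Qed.

Lemma base_edgeP e : reflect
  [\/ exists2 j, j < n & e = (j, n + j),
      exists2 j, j < n & e = (2 * n + j, if odd (nth 0 o j) then j else n + j),
      exists j i, [/\ j < n, i < n, osucc o j i & e = (n + i, j)] |
      exists i a b, [/\ i < m, a < 3, b < 3, a != b & e = (2 * n + (3 * i + a), 2 * n + (3 * i + b))] /\ a < b]
  (e \in E0).
Proof.
rewrite mem_cat; apply: (iffP orP).
  case=> /flatten_mapP[j]; rewrite mem_iota add0n => hj.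
    rewrite /oedges !inE => /or3P[/eqP ->|/eqP ->|h]; [by constructor 1; exists j|by constructor 2; exists j|].
    have [[i [hi hs ei]]|[ei _]] := ochain_spec hj; last by rewrite ei in h.
    by constructor 3; move: h; rewrite ei inE => /eqP ->; exists j, i.
  rewrite /triangle !inE => /or3P[]/eqP ->; constructor 4; exists j.
  - by exists 0, 1; split=> //; split=> //; congr pair; lia.
  - by exists 0, 2; split=> //; split=> //; congr pair; lia.
  - by exists 1, 2; split=> //; split=> //; congr pair; lia.
case=> [[j hj ->]|[j hj ->]|[j [i [hj hi hs ->]]]|[i [a [b [[hi ha hb hab ->] hlt]]]]].
- left; apply/flatten_mapP; exists j; rewrite ?mem_iota // /oedges inE eqxx //.
- left; apply/flatten_mapP; exists j; rewrite ?mem_iota // /oedges !inE eqxx orbT //.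
- left; apply/flatten_mapP; exists j; rewrite ?mem_iota // /oedges !inE.
  have [[i' [hi' hs' ->]]|[_ hn]] := ochain_spec hj; last by have := hn i hi; rewrite hs.
  by rewrite (osucc_fun hj hi' hi hs' hs) inE eqxx !orbT.
- right; apply/flatten_mapP; exists i; rewrite ?mem_iota // /triangle !inE !xpair_eqE.
  case: a ha hab hlt => [|[|[|a]]] // _ _; case: b hb => [|[|[|b]]] // _ _;
    apply/or3P; [constructor 1|constructor 2|constructor 3]; lia.
Qed.

Lemma base_bound : {in E0, forall e, e.1 < 3 * n /\ e.2 < 3 * n}.
Proof.
have hn := size_occs cs.
move=> e /base_edgeP[[j hj ->]|[j hj ->]|[j [i [hj hi hs ->]]]|[i [a [b [[hi ha hb hab ->] hlt]]]]] /=.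
- lia.
- by case: odd; lia.
- lia.
- lia.
Qed.

(** At most three edges per occurrence, and three per clause, which amounts to one more per
    occurrence. *)
Lemma size_base_edges : size E0 <= 4 * n.
Proof.
have h1 s : {in s, forall j, j < n} -> size (flatten [seq oedges o j | j <- s]) <= 3 * size s.
  elim: s => [|j s IH] h //.
  rewrite (_ : flatten _ = oedges o j ++ flatten [seq oedges o j | j <- s]) // size_cat mulnS.
  apply: leq_add; first by rewrite /oedges /=; have [[i [_ _ ->]]|[-> _]] := ochain_spec (h j (mem_head _ _)).
  by apply: IH => i hi; apply: h; rewrite inE hi orbT.
have h2 s : size (flatten [seq triangle n j | j <- s]) = 3 * size s.
  by elim: s => //= j s IH; rewrite -[(size s).+1]add1n mulnDr -IH.
rewrite size_cat; apply: (@leq_trans (3 * n + 3 * m)); last by rewrite size_occs; lia.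
apply: leq_add; last by rewrite h2 size_iota.
by rewrite -[X in _ <= 3 * X](size_iota 0 n); apply: h1 => j; rewrite mem_iota.
Qed.

Lemma sumn_addf (f g : nat -> nat) s :
  sumn [seq f x + g x | x <- s] = sumn (map f s) + sumn (map g s).
Proof. by elim: s => //= x s ->; lia. Qed.

Lemma sumn_le (f g : nat -> nat) s : {in s, forall x, f x <= g x} ->
  sumn (map f s) <= sumn (map g s).
Proof.
elim: s => //= x s IH h; rewrite leq_add ?h ?mem_head // IH // => y hy.
by apply: h; rewrite inE hy orbT.
Qed.

Lemma incidence_base v : incidence v E0 =
  sumn [seq incidence v (oedges o j) | j <- iota 0 n] +
  sumn [seq incidence v (triangle n i) | i <- iota 0 m].
Proof.
rewrite /incidence /base_edges map_cat sumn_cat !map_flatten !sumn_flatten -!map_comp.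
by congr (_ + _); congr sumn; apply: eq_map.
Qed.

(** True- and false-vertices have the edge between them, at most one clause edge and at most one
    chain edge, since successors and predecessors in the chain are unique. A clause-vertex has one
    clause edge and two triangle edges. *)
Lemma base_degree v : v < 3 * n -> incidence v E0 <= 3.
Proof.
move=> hv; have hn := size_occs cs; rewrite incidence_base.
have tri0 : v < 2 * n -> sumn [seq incidence v (triangle n i) | i <- iota 0 m] = 0.
  move=> h; apply: sumn_eq0 => i _; rewrite /incidence /triangle /=; lia.
case: (ltnP v n) => h1.
  rewrite tri0 ?addn0; last by lia.
  apply: (@sumn_single _ _ v); first exact: iota_uniq.
    rewrite /incidence /oedges /=.
    have [[i [_ _ ->]]|[-> _]] := ochain_spec h1; case: odd => /=; lia.
  move=> j; rewrite mem_iota add0n /= => hj ne; rewrite /incidence /oedges /=.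
  by have [[i [_ _ ->]]|[-> _]] := ochain_spec hj; case: odd => /=; lia.
case: (ltnP v (2 * n)) => h2.
  rewrite tri0 ?addn0 //; pose q := v - n; have hq : q < n by lia.
  have ev : v = n + q by rewrite subnKC.
  apply: (@leq_trans (sumn [seq 2 * (j == q) + osucc o j q | j <- iota 0 n])).
    apply: sumn_le => j; rewrite mem_iota add0n /= => hj; rewrite /incidence /oedges /=.
    have [[i [hi hs ->]]|[-> _]] := ochain_spec hj.
      case hos : (osucc o j q); first by case: odd => /=; lia.
      have : (i == q) = false by apply/eqP => e; move: hs; rewrite e hos.
      by case: odd => /=; lia.
    by case: odd => /=; lia.
  rewrite sumn_addf; apply: (@leq_add _ _ 2 1).
    apply: (@sumn_single _ _ q); first exact: iota_uniq.
      by rewrite eqxx.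
    by move=> x _ /negbTE ->.
  case: (boolP (has (fun j => osucc o j q) (iota 0 n))) => [/hasP[j0]|/hasPn hno].
    rewrite mem_iota add0n /= => hj0 hs0.
    apply: (@sumn_single _ _ j0); [exact: iota_uniq | exact: leq_b1 |].
    move=> x; rewrite mem_iota add0n /= => hx; apply: contraNeq; rewrite eqb0 negbK => hs.
    by rewrite (osucc_inj hx hj0 hq hs hs0).
  by rewrite sumn_eq0 // => j /hno /negbTE ->.
pose q := v - 2 * n; have hq : q < n by lia.
have ev : v = 2 * n + q by rewrite subnKC.
apply: (@leq_add _ _ 1 2).
  apply: (@sumn_single _ _ q); first exact: iota_uniq.
    rewrite /incidence /oedges /=.
    by have [[i [hi hs ->]]|[-> _]] := ochain_spec hq; case: odd => /=; lia.
  move=> j; rewrite mem_iota add0n /= => hj ne; rewrite /incidence /oedges /=.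
  by have [[i [hi hs ->]]|[-> _]] := ochain_spec hj; case: odd => /=; lia.
apply: (@sumn_single _ _ (q %/ 3)); first exact: iota_uniq.
  by rewrite /incidence /triangle /=; lia.
by move=> i _ ne; rewrite /incidence /triangle /=; lia.
Qed.

Lemma sum_tight (f : nat -> nat) N c : (forall i, i < N -> c <= f i) ->
  \sum_(i < N) f i <= c * N -> forall i, i < N -> f i <= c.
Proof.
move=> h hs i hi; rewrite leqNgt; apply/negP => hc.
move: hs; rewrite leqNgt => /negP; apply.
rewrite (bigD1 (Ordinal hi)) //=.
have : \sum_(j < N | j != Ordinal hi) c <= \sum_(j < N | j != Ordinal hi) f j.
  by apply: leq_sum => j _; apply: h.
have : \sum_(j < N) c = c * N by rewrite sum_nat_const card_ord mulnC.
by rewrite (bigD1 (Ordinal hi)) //= => <- e; exact: leq_add hc e.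
Qed.

Section CoverToAssignment.
Variable S : seq nat.
Hypotheses (cov : is_vertex_cover E0 S) (hS : size S <= 5 * m).

Definition in_var (j y : nat) : bool := (y == j) || (y == n + j).
Definition in_clause (i y : nat) : bool := (2 * n + 3 * i <= y) && (y < 2 * n + 3 * i + 3).

Lemma cov_edge x y : (x, y) \in E0 -> (x \in S) || (y \in S).
Proof. exact: (allP cov (x, y)). Qed.

Lemma cov_var j : j < n -> 1 <= count (in_var j) S.
Proof.
move=> hj; rewrite -has_count; have : (j, n + j) \in E0 by apply/base_edgeP; constructor 1; exists j.
move=> /cov_edge /orP[] h; apply/hasP; [exists j => //|exists (n + j) => //];
  by rewrite /in_var eqxx ?orbT.
Qed.

Lemma cov_clause i : i < m -> 2 <= count (in_clause i) S.
Proof.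
move=> hi.
have edge a b : a < 3 -> b < 3 -> a < b -> (2 * n + (3 * i + a) \in S) || (2 * n + (3 * i + b) \in S).
  move=> ha hb hab; apply: cov_edge; apply/base_edgeP; constructor 4; exists i, a, b.
  by split=> //; split=> //; rewrite neq_ltn hab.
have pair a b : a < 3 -> b < 3 -> a != b -> 2 * n + (3 * i + a) \in S -> 2 * n + (3 * i + b) \in S ->
    2 <= count (in_clause i) S.
  move=> ha hb hab sa sb.
  apply: (size_count_sub (l := [:: 2 * n + (3 * i + a); 2 * n + (3 * i + b)])).
  - by rewrite /= inE !eqn_add2l hab.
  - by move=> y; rewrite !inE => /orP[]/eqP ->.
  - by rewrite /= /in_clause; lia.
have := edge 0 1 isT isT isT; have := edge 0 2 isT isT isT; have := edge 1 2 isT isT isT.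
case h0 : (2 * n + (3 * i + 0) \in S); case h1 : (2 * n + (3 * i + 1) \in S);
  case h2 : (2 * n + (3 * i + 2) \in S) => //= _ _ _.
- exact: (pair 0 1).
- exact: (pair 0 1).
- exact: (pair 0 2).
- exact: (pair 1 2).
Qed.

(** The variable edges and triangles are disjoint and need [n + 2 m = 5 m] vertices together, which
    is the whole budget; so each of them gets exactly its minimum. *)
Lemma cov_tight : (forall j, j < n -> count (in_var j) S <= 1) /\
  (forall i, i < m -> count (in_clause i) S <= 2).
Proof.
pose P z := if z < n then in_var z else in_clause (z - n).
have := @sum_count_disjoint P (n + m) S; rewrite big_split_ord /=.
have -> : \sum_(i < n) count (P i) S = \sum_(i < n) count (in_var i) S.
  by apply: eq_bigr => i _; rewrite /P ltn_ord.
have -> : \sum_(i < m) count (P (n + i)) S = \sum_(i < m) count (in_clause i) S.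
  by apply: eq_bigr => i _; rewrite /P ltnNge leq_addr /= addKn.
have hn := size_occs cs => /(_ _)H.
have {}H : \sum_(i < n) count (in_var i) S + \sum_(i < m) count (in_clause i) S <= n + 2 * m.
  apply: (@leq_trans (5 * m)); last by lia.
  apply: leq_trans hS; apply: H => y; apply: (@sum_indicator_le1 (fun z => P z y)) => x1 x2 hx1 hx2.
  by rewrite /P /in_var /in_clause; case: (ltnP x1 n) => g1; case: (ltnP x2 n) => g2 /=; lia.
have h1 : n <= \sum_(i < n) count (in_var i) S.
  rewrite -[X in X <= _]card_ord -sum1_card; apply: leq_sum => i _; exact: cov_var.
have h2 : 2 * m <= \sum_(i < m) count (in_clause i) S.
  rewrite mulnC -[X in X * _ <= _]card_ord -sum_nat_const; apply: leq_sum => i _; exact: cov_clause.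
split.
  by apply: sum_tight => [i hi|]; [exact: cov_var | lia].
by apply: sum_tight => [i hi|]; [exact: cov_clause | lia].
Qed.

Lemma cov_excl j : j < n -> j \in S -> n + j \notin S.
Proof.
move=> hj h1; apply/negP => h2; have := (cov_tight.1 j hj); rewrite leqNgt => /negP; apply.
apply: (size_count_sub (l := [:: j; n + j])).
- by rewrite /= inE andbT; apply/eqP; lia.
- by move=> y; rewrite !inE => /orP[]/eqP ->.
- by rewrite /= /in_var !eqxx orbT.
Qed.

(** Induction on the gap between the keys. An occurrence strictly between belongs to the same
    variable, as keys are sorted by literal; with none between there is a chain edge, and its end at
    the false-vertex of [i] is not in [S]. *)
Lemma cov_chain j i : j < n -> i < n -> (nth 0 o j)./2 = (nth 0 o i)./2 ->
  okey o j < okey o i -> i \in S -> j \in S.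
Proof.
have [d hd] : exists d, okey o i - okey o j <= d by exists (okey o i - okey o j).
elim: d i j hd => [|d IH] i j hd hj hi hv hk iS; first by lia.
case: (boolP (has (fun k => (okey o j < okey o k) && (okey o k < okey o i)) (iota 0 n))).
  move=> /hasP[k]; rewrite mem_iota add0n /= => hkn /andP[k1 k2].
  have e1 : (nth 0 o j)./2 <= (nth 0 o k)./2.
    by apply: half_leq; move: k1; rewrite okey_lt // => /orP[/ltnW|/andP[/eqP ->]].
  have e2 : (nth 0 o k)./2 <= (nth 0 o i)./2.
    by apply: half_leq; move: k2; rewrite okey_lt // => /orP[/ltnW|/andP[/eqP ->]].
  have kS : k \in S by apply: (IH i k) => //; lia.
  by apply: (IH k j) => //; lia.
move=> hno; have hs : osucc o j i by rewrite /osucc hv eqxx hk hno.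
have /cov_edge : (n + i, j) \in E0 by apply/base_edgeP; constructor 3; exists j, i.
by rewrite (negbTE (cov_excl hi iS)).
Qed.

Lemma cover_sat : csat cs.
Proof.
(* Reading off positive occurrences makes true positive literals immediate; the chain is needed for
   negative ones. *)
pose a v := has (fun j => (nth 0 o j == v.*2.+1) && (j \in S)) (iota 0 n).
exists a; apply/allP => c cC; set i := index c cs; have hi : i < m by rewrite index_mem.
have ec : nth c cs i = c by rewrite nth_index.
(* The triangle has only two vertices in the cover; the third one points to a literal that must be
   true. *)
have [k hk hkS] : exists2 k, k < 3 & 2 * n + (3 * i + k) \notin S.
  have := cov_tight.2 i hi.
  case h0 : (2 * n + (3 * i + 0) \in S); last by exists 0; rewrite ?h0.
  case h1 : (2 * n + (3 * i + 1) \in S); last by exists 1; rewrite ?h1.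
  case h2 : (2 * n + (3 * i + 2) \in S); last by exists 2; rewrite ?h2.
  rewrite leqNgt => /negP[].
  apply: (size_count_sub (l := [:: 2 * n + (3 * i + 0); 2 * n + (3 * i + 1); 2 * n + (3 * i + 2)])).
  - by rewrite /= !inE !eqn_add2l.
  - by move=> y; rewrite !inE => /or3P[]/eqP ->.
  - by rewrite /= /in_clause; lia.
have hn := size_occs cs; set j := 3 * i + k in hkS; have hj : j < n by lia.
have hx : nth 0 o j = lit_of c k by rewrite (nth_occs c) // ec.
suff hl : ltrue a (nth 0 o j).
  move: hl; rewrite hx /ctrue /lit_of; case: k hk {hkS j hj hx} => [|[|[|k]]] //= _ ->; by rewrite ?orbT.
have /cov_edge : (2 * n + j, if odd (nth 0 o j) then j else n + j) \in E0.
  by apply/base_edgeP; constructor 2; exists j.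
rewrite (negbTE hkS) /= /ltrue; case ho : (odd (nth 0 o j)) => jS.
  rewrite eqb_id; apply/hasP; exists j; first by rewrite mem_iota.
  by rewrite jS andbT -[X in X == _]odd_double_half ho.
(* A positive occurrence [j'] in the cover would put the earlier negative occurrence [j] into it
   through the chain, although the false-vertex of [j] is there already. *)
apply/eqP/negbTE/hasPn => j'; rewrite mem_iota add0n /= => hj'; rewrite negb_and -implybE.
apply/implyP => /eqP e; apply/negP => j'S.
have e2 : nth 0 o j = (nth 0 o j)./2.*2 by rewrite -[LHS]odd_double_half ho.
have : j \in S.
  apply: (@cov_chain j j') => //; first by rewrite e /= uphalf_double.
  by rewrite okey_lt // e {1}e2 ltnSn.
by move=> /(cov_excl hj); rewrite jS.
Qed.
End CoverToAssignment.

Lemma sat_cover : csat cs -> exists S, size S <= 5 * m /\ is_vertex_cover E0 S.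
Proof.
case=> a /allP ha.
pose c0 : lit3 := (0, 0, 0).
(* The clause-vertex of a true literal may stay outside, because its clause edge is covered at the
   other end. The default 2 is right for satisfied clauses. *)
pose free (c : lit3) := if ltrue a c.1.1 then 0 else if ltrue a c.1.2 then 1 else 2.
pose vs := [seq (if a (nth 0 o j)./2 then j else n + j) | j <- iota 0 n].
pose ts := flatten [seq [seq 2 * n + (3 * i + k) | k <- [seq k <- iota 0 3 | k != free (nth c0 cs i)]] | i <- iota 0 m].
have hn := size_occs cs.
exists (vs ++ ts); split.
  rewrite size_cat size_map size_iota.
  have -> : size ts = 2 * m.
    rewrite size_flatten /shape -map_comp -[in RHS](size_iota 0 m).
    elim: (iota 0 m) => //= i s ->; rewrite size_map mulnS; congr (_ + _).
    by rewrite /free; case: ltrue => //; case: ltrue.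
  lia.
have inv j : j < n -> (if a (nth 0 o j)./2 then j else n + j) \in vs ++ ts.
  by move=> hj; rewrite mem_cat; apply/orP; left; apply/mapP; exists j; rewrite ?mem_iota.
have int i k : i < m -> k < 3 -> k != free (nth c0 cs i) -> 2 * n + (3 * i + k) \in vs ++ ts.
  move=> hi hk hf; rewrite mem_cat; apply/orP; right; apply/flatten_mapP; exists i; rewrite ?mem_iota //.
  by apply/mapP; exists k => //; rewrite mem_filter hf mem_iota.
apply/allP => e /base_edgeP[[j hj ->]|[j hj ->]|[j [i [hj hi hs ->]]]|[i [p [q [[hi hp hq hpq ->] _]]]]] /=.
- by have := inv j hj; case: (a _) => ->; rewrite ?orbT.
- have ej : j = 3 * (j %/ 3) + j %% 3 by rewrite mulnC -divn_eq.
  have hi : j %/ 3 < m by rewrite ltn_divLR //; lia.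
  have hk : j %% 3 < 3 by rewrite ltn_mod.
  case: (boolP (j %% 3 == free (nth c0 cs (j %/ 3)))) => hf; last first.
    by rewrite {1}ej int.
  have hx : ltrue a (nth 0 o j).
    rewrite {1}ej (nth_occs c0) // (eqP hf); set c := nth c0 cs _.
    have : ctrue a c by apply: ha; apply: mem_nth.
    rewrite /ctrue /free /lit_of; case h0 : (ltrue a c.1.1); first by rewrite /= h0.
    by case h1 : (ltrue a c.1.2) => /=; rewrite ?h1.
  have := inv j hj; move: hx; rewrite /ltrue => /eqP ->; case: odd => ->; by rewrite orbT.
- have hv : (nth 0 o i)./2 = (nth 0 o j)./2 by case/and3P: hs => /eqP.
  have := inv j hj; have := inv i hi; rewrite hv; case: (a _) => h1 h2; by rewrite ?h1 ?h2 ?orbT.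
- case: (boolP (p == free (nth c0 cs i))) => hf; last by rewrite int.
  by rewrite (int i q) ?orbT // -(eqP hf) eq_sym.
Qed.
End BaseGraph.

Theorem vc_of_valid d cs : 0 < d -> vc_valid d (vc_of d cs).
Proof.
move=> d0; have hb := @base_bound cs; split.
- exact: subdivide_simple.
- by apply: subdivide_degree => //; exact: base_degree.
- exact: subdivide_2degenerate.
- by move=> c uc sc cc; apply: leq_trans (subdivide_girth d0 hb uc sc cc); lia.
Qed.

Theorem vc_of_correct d cs : 0 < d -> has_vc (vc_of d cs) <-> csat cs.
Proof.
move=> d0; rewrite /has_vc /vc_of /=.
have h := subdivide_cover d0 (@base_bound cs) (5 * size cs); split.
  by move=> /h[S [hS cov]]; apply: cover_sat cov hS.
by move=> /sat_cover hS; apply/h.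
Qed.

(** Per clause there are 9 base vertices and at most 12 base edges; each edge turns into [2 d]
    vertices and [2 d + 1] edges, and [9 + 12 * (4 d + 1) = 48 d + 21]. *)
Lemma vc_of_size d cs : 0 < d -> vc_size (vc_of d cs) <= (48 * d + 21) * size cs.
Proof.
move=> d0; rewrite /vc_size [vc_n _]/= [vc_edges _]/= size_subdivide // -addnA -mulnDr.
have h := size_base_edges cs; rewrite size_occs in h *.
have : size (base_edges cs) * (2 * d + (2 * d + 1)) <= 4 * (3 * size cs) * (2 * d + (2 * d + 1)).
  by rewrite leq_mul2r h orbT.
set x := _ * (2 * d + _); set y := _ * (2 * d + _) => hx.
apply: (@leq_trans (3 * (3 * size cs) + y)); first by rewrite leq_add2l.
by rewrite /y; lia.
Qed.

(** * Input and output encodings *)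

Definition enc_clause (C : clause3) : lit3 :=
  let: (l1, l2, l3) := C in (enc_lit l1, enc_lit l2, enc_lit l3).

Lemma parse_nats_enc s : parse_nats (enc_nats s) = s.
Proof.
elim: s => //= k s IH.
have H r : parse_nats (enc_nat k ++ r) = k :: parse_nats r.
  rewrite /enc_nat -cats1 -catA /parse_nats foldr_cat /=.
  by elim: k => //= k ->.
by rewrite /enc_nats /= H -/(enc_nats s) IH.
Qed.

Lemma parse_enc F : parse (enc_cnf F) = (cnf_N F, map enc_clause (cnf_clauses F)).
Proof.
case: F => N cs; rewrite /parse /enc_cnf parse_nats_enc /=; congr pair.
set l := flatten _.
have hl : size l = 3 * size cs by rewrite /l; elim: (cs) => //= -[[a b] c] s IH; rewrite mulnS -IH.
have -> : [seq i <- iota 0 (size l) | 3 * i + 2 < size l] = iota 0 (size cs).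
  rewrite hl; set z := size cs; rewrite [iota 0 (3 * z)](_ : _ = iota 0 z ++ iota z (2 * z)); last first.
    by rewrite -(iotaD 0 z); congr iota; lia.
  rewrite filter_cat (eq_in_filter (a2 := predT)) ?filter_predT; last first.
    by move=> i; rewrite mem_iota add0n /= => h; have -> : 3 * i + 2 < 3 * z by lia.
  rewrite (eq_in_filter (a2 := pred0)) ?filter_pred0 ?cats0 //.
  by move=> i; rewrite mem_iota => /andP[h _]; apply/negbTE; rewrite -leqNgt; lia.
have hn i k : i < size cs -> k < 3 -> nth 0 l (3 * i + k) = lit_of (nth (0, 0, 0) (map enc_clause cs) i) k.
  move=> hi hk; rewrite /l; elim: (cs) i hi => //= -[[a b] c] s IH [|i] hi.
    by case: (k) hk => [|[|[|?]]].
  have -> : 3 * i.+1 + k = (3 * i + k).+3 by lia.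
  exact: IH.
apply: (@eq_from_nth _ (0, 0, 0)); first by rewrite !size_map size_iota.
move=> i; rewrite size_map size_iota => hi.
rewrite (nth_map 0) ?size_iota // nth_iota // add0n.
have := hn i 0 hi isT; rewrite addn0 => ->; rewrite !hn //.
by case: (nth _ _ _) => [[]].
Qed.

Lemma ltrue_enc a l : ltrue a (enc_lit l) = lit_true a l.
Proof.
case: l => v b; rewrite /ltrue /enc_lit /lit_true /= mul2n addnC half_bit_double.
by rewrite oddD odd_double addbF oddb.
Qed.

Lemma csat_enc cs : csat (map enc_clause cs) <-> exists a, all (clause_true a) cs.
Proof.
have h a : all (ctrue a) (map enc_clause cs) = all (clause_true a) cs.
  by rewrite all_map; apply: eq_all => -[[x y] z]; rewrite /= /ctrue /= !ltrue_enc.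
by split=> -[a ha]; exists a; rewrite ?h // -h.
Qed.

Lemma size_enc_nats s : size (enc_nats s) = sumn s + size s.
Proof.
by elim: s => //= k s IH; rewrite size_cat -/(enc_nats s) IH /enc_nat size_rcons size_nseq; lia.
Qed.

(** The time bound of the given algorithm mentions the length of the encoding, whereas only the
    number of vertices and edges is controlled here; unary entries below [n] keep the two
    polynomially related. *)
Lemma size_enc_vc G : simple_graph (vc_n G) (vc_edges G) -> vc_k G <= vc_n G ->
  (size (enc_vc G)).+1 <= (vc_size G + 2) ^ 4.
Proof.
move=> /andP[_ /allP hs] hk; rewrite /enc_vc size_enc_nats /= /vc_size.
set n := vc_n G in hs hk *; set E := vc_edges G in hs *.
have h1 : sumn (flatten [seq [:: e.1; e.2] | e <- E]) <= size E * (2 * n).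
  elim: E hs => //= e E IH hs; have /andP[e1 e2] := hs e (mem_head _ _).
  rewrite mulSn; have := IH (fun x hx => hs x (mem_behead (s := e :: E) hx)); lia.
have h2 : size (flatten [seq [:: e.1; e.2] | e <- E]) = 2 * size E.
  by elim: (E) => //= e s ->; lia.
rewrite h2; set x := size E in h1 *; set y := n + x.
have hx : size E * (2 * n) <= y * (2 * y) by apply: leq_mul; rewrite /y /x; lia.
apply: (@leq_trans (y * (2 * y) + 4 * y + 8)); first by rewrite /y /x in h1 hx *; lia.
have -> : (y + 2) ^ 4 = (y + 2) ^ 2 * (y + 2) ^ 2 by rewrite -expnD.
have e2 : (y + 2) ^ 2 = y * y + 4 * y + 4 by rewrite -mulnn; lia.
apply: (@leq_trans ((y + 2) ^ 2 * 4)); first by rewrite e2; lia.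
by rewrite leq_mul2l e2; lia.
Qed.

Lemma vc_of_budget d cs : vc_k (vc_of d cs) <= vc_n (vc_of d cs).
Proof.
rewrite /vc_of /= size_occs.
have : d * size (base_edges cs) <= size (base_edges cs) * (2 * d) by rewrite mulnC leq_mul2l; lia.
by lia.
Qed.

(** * Asymptotic analysis of the rounds *)

Lemma pow2_dominates K : exists l, K * (l + 1) <= 2 ^ l.
Proof.
exists (4 * K); have -> : 4 * K = 2 * K + 2 * K by lia.
rewrite expnD; have h := ltn_expl (2 * K) (isT : 1 < 2).
apply: (@leq_trans ((2 * K + 1) * (2 * K + 1))); last by apply: leq_mul; lia.
by lia.
Qed.

Section Asymptotics.
Variables (d : nat) (M : TM) (f : nat -> nat) (a : nat).
Hypotheses (d0 : 0 < d) (hf : littleo f).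
Hypothesis hM : solves_within M (vc_valid d) has_vc enc_vc
  (fun x => a * 2 ^ (f (vc_size x)) * (size (enc_vc x)).+1 ^ a).

(** Machines are deterministic: a run that stops within any budget ends in the configuration that
    the hypothesis on [M] promises, so small budgets can delay an answer but not falsify it. *)
Lemma simulate_correct cs B b : simulate M B (enc_vc (vc_of d cs)) = Some b -> (b <-> csat cs).
Proof.
move=> /simulate_run[c hc <-].
have [c' [hc' hacc]] := hM (vc_of_valid cs d0).
rewrite -(vc_of_correct cs d0) -hacc; set T := _ * _ in hc'.
have h1 := run_mono hc (leq_maxl B T); have h2 := run_mono hc' (leq_maxr B T).
by move: h2; rewrite h1 => -[->].
Qed.

Definition vc_time (cs : seq lit3) : nat :=
  a * 2 ^ (f (vc_size (vc_of d cs))) * (vc_size (vc_of d cs) + 2) ^ (4 * a).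

Lemma simulate_fast cs B : vc_time cs <= B -> simulate M B (enc_vc (vc_of d cs)) <> None.
Proof.
move=> hB; have [c [hc _]] := hM (vc_of_valid cs d0).
rewrite (run_simulate hc) //; apply: leq_trans hB; rewrite /vc_time leq_mul2l expnM.
apply/orP; right; have hv := vc_of_valid cs d0.
case: (a) => // a'; rewrite leq_exp2r //; apply: size_enc_vc; last exact: vc_of_budget.
by case: hv.
Qed.

Lemma stage_finishes N L B cs : 0 < L -> L <= B ->
  {in cs, forall c, [/\ c.1.1 < 2 * N, c.1.2 < 2 * N & c.2 < 2 * N]} ->
  node_bound (2 * L * L) (6 * L * (2 * N + 4)) <= B ->
  (forall F, wf (2 * N + 4) L F -> branch L F = None -> vc_time (leaf_clauses F) <= B) ->
  stage M d B (init_form N cs) <> None.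
Proof.
move=> L0 LB hcs hn hl; rewrite /stage.
have w := init_form_wf L hcs.
have hd : let s := search M d B (init_form N cs) L in nilp s.1 && (s.2 != 2).
  apply: (search_done L0 _ w); first by move=> F wF bF; apply/simulate_fast/hl.
  by rewrite /phi /= !subn0.
have : search M d B (init_form N cs) L \in
    [seq s <- [seq search M d B (init_form N cs) L | L <- iota 1 B] | nilp s.1 && (s.2 != 2)].
  by rewrite mem_filter hd /=; apply: map_f; rewrite mem_iota L0 add1n ltnS.
by case: [seq s <- _ | _].
Qed.

(** Since [f] may fail to be monotone, its finitely many values before the threshold are collected
    in [R]; the bound then holds for all sizes up to [x]. *)
Lemma littleo_bound c : 0 < c -> exists R, forall s x, s <= x -> c * f s <= x + c * R.
Proof.
move=> c0; have [N0 h0] := hf c0.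
exists (\sum_(s < N0) f s) => s x hs; case: (leqP N0 s) => h.
  by apply: leq_trans (h0 s h) _; lia.
apply: (@leq_trans (c * \sum_(s < N0) f s)); last by lia.
by rewrite leq_mul2l (bigD1 (Ordinal h)) //= leq_addr orbT.
Qed.

Lemma div_slack q e N D : 0 < q -> q * e <= N + D -> e <= N %/ q + D + 1.
Proof.
move=> q0 h; have h1 := divn_eq N q; have h2 := ltn_pmod N q0.
rewrite leqNgt; apply/negP => h3.
have : q * (N %/ q + D + 2) <= q * e by rewrite leq_mul2l; lia.
have : D <= q * D by rewrite leq_pmull.
by rewrite !mulnDr; lia.
Qed.

(** The threshold [L] and hence [K] depend on [q] alone. The budget has to cover [L] itself, the
    number of search steps [2 ^ e1], and the time [T] of the given algorithm on one leaf. *)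
Lemma stage_bound q : 0 < q -> exists K, forall N cs,
  {in cs, forall c, [/\ c.1.1 < 2 * N, c.1.2 < 2 * N & c.2 < 2 * N]} ->
  exists2 B, B <= K * 2 ^ (N %/ q) * (N + 2) ^ (4 * a) & stage M d B (init_form N cs) <> None.
Proof.
move=> q0; have [l hl] := pow2_dominates (12 * q).
pose L := 2 ^ l; have L0 : 0 < L by rewrite expn_gt0.
pose W := 1 + 2 * L + 2 * L * L; pose C := (48 * d + 21) * W.
have C0 : 0 < C by rewrite muln_gt0 /W; lia.
(* Leaf instances have size at most [C m]; the constant [2 q C] brings [f] of that down to about
   [m / (2 q)], again close to [N / q]. *)
have c0 : 0 < 2 * q * C by rewrite (muln_gt0 (2 * q)) C0 muln_gt0 q0.
have [R hR] := littleo_bound c0.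
pose D1 := 4 + q * (2 * (2 * l + 2)).
pose D2 := 4 + q * R.
exists (L + 2 ^ (D1 + 1) + a * 2 ^ (D2 + 1) * (2 * C + 2) ^ (4 * a)) => N cs hcs.
set m := 2 * N + 4; pose X := C * m.
pose k := 3 * m %/ L + 1.
(* The potential is at most [6 L m], which is at most [2 L^2 * k]; [node_bound_le] contributes the
   additional 1. *)
pose e1 := (2 * l + 2) * (k + 1).
pose T := a * 2 ^ (N %/ q + D2 + 1) * (X + 2) ^ (4 * a).
exists (L + 2 ^ e1 + T).
  have he1 : e1 <= N %/ q + D1 + 1.
    apply: div_slack => //.
    have h1 : q * ((2 * l + 2) * (3 * m %/ L)) * 2 <= m.
      have h2 : 3 * m %/ L * L <= 3 * m by apply: leq_divM.
      have h3 : 3 * m %/ L * (12 * q * (l + 1)) <= 3 * m by apply: leq_trans h2; rewrite leq_mul2l hl orbT.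
      by lia.
    by rewrite /e1 /k /D1 /m in h1 *; lia.
  have p2 : 2 ^ e1 <= 2 ^ (D1 + 1) * 2 ^ (N %/ q) by rewrite -expnD leq_exp2l //; lia.
  have pT : T <= a * 2 ^ (D2 + 1) * (2 * C + 2) ^ (4 * a) * (2 ^ (N %/ q) * (N + 2) ^ (4 * a)).
    rewrite /T -addnA expnD; set u := 2 ^ (N %/ q); set v := 2 ^ (D2 + 1).
    have -> : a * v * (2 * C + 2) ^ (4 * a) * (u * (N + 2) ^ (4 * a)) =
              a * (u * v) * ((2 * C + 2) ^ (4 * a) * (N + 2) ^ (4 * a)) by lia.
    rewrite leq_mul2l -expnMn; apply/orP; right.
    have hX : X + 2 <= (2 * C + 2) * (N + 2) by rewrite /X /m; lia.
    by case: (4 * a) => // z; rewrite leq_exp2r.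
  set u := 2 ^ (N %/ q) in p2 pT *; set w := (N + 2) ^ (4 * a) in pT *.
  have uw : 0 < u * w by rewrite muln_gt0 !expn_gt0; lia.
  have w0 : 0 < w by rewrite expn_gt0; lia.
  rewrite -mulnA (mulnDl (L + _)) (mulnDl L); apply: leq_add; last exact: pT.
  apply: leq_add; first by rewrite leq_pmulr.
  by apply: leq_trans p2 _; rewrite mulnA leq_pmulr.
apply: (@stage_finishes N L) => //; first by lia.
  have H0 : 0 < 2 * L * L by rewrite !muln_gt0 L0.
  have hnb : 6 * L * (2 * N + 4) <= 2 * L * L * k.
    have h2 : 3 * m < (3 * m %/ L).+1 * L by apply: ltn_ceil.
    have h3 : 2 * L * (3 * m) <= 2 * L * (k * L) by rewrite leq_mul2l /k addn1 (ltnW h2) orbT.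
    by rewrite -/m; lia.
  apply: leq_trans (node_bound_le H0 hnb) _.
  apply: (@leq_trans (2 ^ e1)); last by lia.
  rewrite /e1 addn1 expnM leq_exp2r // (_ : 2 * l + 2 = l + l + 2) ?expnD; last by lia.
  have : 1 <= L * L by rewrite muln_gt0 L0.
  by rewrite -/L; lia.
move=> F wF bF; apply: (@leq_trans T); last by lia.
have hs := leaf_size L0 wF bF.
have hsz : vc_size (vc_of d (leaf_clauses F)) <= X.
  apply: leq_trans (vc_of_size _ d0) _; rewrite /X /C -mulnA leq_mul2l; apply/orP; right.
  by rewrite mulnC.
rewrite /vc_time /T; apply: leq_mul; last first.
  by case: (4 * a) => // z; rewrite leq_exp2r //; lia.
rewrite leq_mul2l leq_exp2l //; apply/orP; right.
apply: div_slack => //.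
have h := hR _ _ hsz.
have h2 : C * (2 * q * f (vc_size (vc_of d (leaf_clauses F)))) <= C * (m + 2 * q * R).
  by rewrite /X in h; lia.
rewrite leq_pmul2l // in h2; rewrite /D2 /m in h2 *; lia.
Qed.
End Asymptotics.

(* The accuracy [q] is not computable from [N], since [f] is arbitrary: the solver tries all
   parameters in parallel, and [best_exponent] is its running time up to polynomial factors. *)
Definition best_exponent (K : nat -> nat) (N : nat) : nat :=
  foldr minn (K 1 + N) [seq K q + N %/ q | q <- iota 1 N].

Lemma best_exponent_attained K N : exists2 q, 0 < q & best_exponent K N = K q + N %/ q.
Proof.
rewrite /best_exponent; have : {in iota 1 N, forall q, 0 < q} by move=> q; rewrite mem_iota => /andP[].
elim: (iota 1 N) => [|q s IH] h /=; first by exists 1; rewrite ?divn1.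
have [q1 h1 ->] := IH (fun x hx => h x (mem_behead (s := q :: s) hx)).
case: (leqP (K q + N %/ q) (K q1 + N %/ q1)) => _; last by exists q1.
by exists q; rewrite ?h ?mem_head.
Qed.

Lemma best_exponent_le K N q : 0 < q -> q <= N -> best_exponent K N <= K q + N %/ q.
Proof.
move=> q0 qN; rewrite /best_exponent; have : q \in iota 1 N by rewrite mem_iota q0 add1n ltnS.
elim: (iota 1 N) => //= x s IH; rewrite inE => /orP[/eqP <-|/IH h]; first exact: geq_minl.
exact: leq_trans (geq_minr _ _) h.
Qed.

(** For a given [c] one fixed accuracy suffices: [q = 2 c b + 1] makes the term with [N / q] at most
    half of [N], and the constant [K q] is negligible for large [N]. *)
Lemma littleo_best_exponent K b : littleo (fun N => b * best_exponent K N).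
Proof.
move=> c c0; pose q := 2 * c * b + 1.
exists (q + 2 * c * b * K q) => N hN.
have hq : best_exponent K N <= K q + N %/ q by apply: best_exponent_le; rewrite /q in hN *; lia.
have h1 : c * (b * best_exponent K N) <= c * b * K q + c * b * (N %/ q).
  by rewrite mulnA -mulnDr leq_mul2l hq orbT.
have h2 : N %/ q * (2 * c * b + 1) <= N by apply: leq_divM.
have h3 : 2 * c * b * K q <= N by apply: leq_trans hN; rewrite leq_addl.
move: h1 h2 h3; move: (N %/ q) (K q) => y k h1 h2 h3.
have : 2 * (c * (b * best_exponent K N)) <= 2 * N; last by rewrite leq_pmul2l.
apply: (@leq_trans (2 * c * b * k + y * (2 * c * b + 1))); last by lia.
by lia.
Qed.

Theorem theorem3 (d : nat) : 0 < d -> ETH ->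
  ~ subexp_solvable (vc_valid d) has_vc enc_vc vc_size.
Proof.
move=> d0 eth [M [f [a [hf hM]]]]; apply: eth.
have hex q : exists K, 0 < q -> forall N cs,
    {in cs, forall c, [/\ c.1.1 < 2 * N, c.1.2 < 2 * N & c.2 < 2 * N]} ->
    exists2 B, B <= K * 2 ^ (N %/ q) * (N + 2) ^ (4 * a) & stage M d B (init_form N cs) <> None.
  case: (posnP q) => [->|q0]; first by exists 0.
  by have [K hK] := stage_bound d0 hf hM q0; exists K.
(* Choice turns the constants into a function of [q]; it enters only the exponent function of the
   time bound, which may be any function. *)
have [K hK] := functional_choice _ hex.
have [S [b hS]] := solver_exists M d.
(* [2 ^ P] serves as factor and as exponent of the final bound: it pays for replacing [size w + 2]
   by [2 * (size w).+1], and it exceeds [P]. *)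
pose P := (4 * a + 2) * b.
exists S, (fun N => b * best_exponent K N), (2 ^ P); split; first exact: littleo_best_exponent.
move=> F vF; set w := enc_cnf F.
have eF : formula_of w = init_form (cnf_N F) (map enc_clause (cnf_clauses F)).
  by rewrite /formula_of parse_enc.
have hcs : {in map enc_clause (cnf_clauses F), forall c,
    [/\ c.1.1 < 2 * cnf_N F, c.1.2 < 2 * cnf_N F & c.2 < 2 * cnf_N F]}.
  have hl l : lit_ok (cnf_N F) l -> enc_lit l < 2 * cnf_N F.
    by case: l => v [] ; rewrite /lit_ok /enc_lit /=; lia.
  by move=> c /mapP[[[x y] z] /(allP vF)/and3P[hx hy hz] ->] /=; rewrite !hl.
have [q q0 eq] := best_exponent_attained K (cnf_N F).
have [B1 hB1 sB1] := hK q q0 _ _ hcs.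
have exB : exists B, isSome (stage M d B (formula_of w)).
  by exists B1; rewrite eF; case: stage sB1.
(* The solver stops at the first deciding budget, which is at most the one guaranteed for the
   accuracy [q] that attains [best_exponent]. *)
case: (ex_minnP exB) => B hB minB.
have BB1 : B <= B1 by apply: minB; rewrite eF; case: stage sB1.
case es : (stage M d B (formula_of w)) hB => [ans|] // _.
have hnone B' : B' < B -> stage M d B' (formula_of w) = None.
  by move=> lt; case e : (stage _ _ _ _) => [x|] //; have := minB B'; rewrite e => /(_ isT); lia.
have [c [hc acc]] := hS w B ans hnone es.
exists c; split; last first.
  have ok := stage_ok (fun cs B b => @simulate_correct d M f a d0 hM cs B b) es.
  rewrite acc; apply: (iff_trans ok); rewrite eF.
  apply: (iff_trans _ (csat_enc (cnf_clauses F))).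
  by split=> -[x hx]; exists x; move: hx; rewrite init_form_true.
apply: run_mono hc _.
pose x := size w + 2.
have Nx : cnf_N F + 2 <= x.
  by rewrite /x /w /enc_cnf size_enc_nats /=; lia.
have hBx : size w + B + 2 <= 2 ^ best_exponent K (cnf_N F) * x ^ (4 * a + 2).
  set g := best_exponent K _ in eq *.
  (* [K q < 2 ^ K q] moves the constant factor into the exponent, where [best_exponent] adds it. *)
  have hKg : K q * 2 ^ (cnf_N F %/ q) <= 2 ^ g.
    by rewrite eq expnD leq_mul2r ltnW ?orbT // ltn_expl.
  have h1 : B <= 2 ^ g * x ^ (4 * a).
    apply: leq_trans BB1 (leq_trans hB1 _); apply: leq_mul => //.
    by case: (4 * a) => // z; rewrite leq_exp2r.
  have g0 : 0 < 2 ^ g by rewrite expn_gt0.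
  have y0 : 0 < x ^ (4 * a) by rewrite expn_gt0 /x; lia.
  have h2 : x <= 2 ^ g * x ^ (4 * a) * x by rewrite leq_pmull // muln_gt0 g0.
  have h3 : 2 ^ g * x ^ (4 * a) * x + 2 ^ g * x ^ (4 * a) <= 2 ^ g * x ^ (4 * a) * (x * x).
    have x2 : 2 <= x by rewrite /x; lia.
    have : 2 ^ g * x ^ (4 * a) * (x + 1) <= 2 ^ g * x ^ (4 * a) * (x * x).
      rewrite leq_mul2l; apply/orP; right; have : 2 * x <= x * x by rewrite leq_mul2r x2 orbT.
      by lia.
    by rewrite mulnDr muln1.
  rewrite expnD mulnA -mulnn; apply: leq_trans h3.
  by have -> : size w + B + 2 = x + B; [rewrite /x; lia | exact: leq_add h2 h1].
apply: (@leq_trans ((2 ^ best_exponent K (cnf_N F) * x ^ (4 * a + 2)) ^ b)).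
  by case: (b) => // b'; rewrite leq_exp2r.
rewrite expnMn -!expnM -/P (mulnC _ b) -mulnA mulnCA leq_mul2l; apply/orP; right.
apply: (@leq_trans ((2 * (size w).+1) ^ P)).
  by case: (P) => // z; rewrite leq_exp2r // /x; lia.
rewrite expnMn leq_mul2l; apply/orP; right.
by rewrite leq_pexp2l // ltnW // ltn_expl.
Qed.
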